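(* Let $p>3$ be a prime. If $p\equiv1\pmod4$ and $p=x^2+4y^2$ with $x,y\in\mathbb Z$, then $$\sum_{k=0}^{(p-1)/2}\frac{\binom{2k}k^3}{64^k(k+2)}\equiv\frac{52}{27}x^2-\frac{26}{27}p-\frac{p^2}{27x^2}\pmod{p^3}.$$ If $p\equiv3\pmod4$, then $$\sum_{k=0}^{(p-1)/2}\frac{\binom{2k}k^3}{64^k(k+2)}\equiv-\frac{(p+1)^2}{3\cdot2^{p-1}}\binom{(p-1)/2}{(p-3)/4}^2-p^2\Big(\frac{13}{27}\binom{(p-1)/2}{(p-3)/4}^{-2}+\frac16\binom{(p-1)/2}{(p-3)/4}^2E_{p-3}\Big)\pmod{p^3}.$$
   Context: Congruences modulo $p^3$ are between rational numbers whose denominators are not divisible by $p$. The Euler numbers $\{E_n\}$ are given by $E_{2n-1}=0$, $E_0=1$, $E_{2n}=-\sum_{k=1}^n\binom{2n}{2k}E_{2n-2k}$ for $n=1,2,3,\ldots$. *)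

(* Defs.v *)
From mathcomp Require Import all_boot all_order all_algebra.

Set Implicit Arguments.
Unset Strict Implicit.
Unset Printing Implicit Defensive.

Import Order.TTheory GRing.Theory Num.Theory.
Local Open Scope ring_scope.

Definition p_integral (p : nat) (a : rat) : bool := ~~ (p%:Z %| denq a)%Z.

(* The congruence asserts in particular that both sides are p-integral; the
   numerator of [a - b] is the one in lowest terms. *)
Definition rat_cong (p n : nat) (a b : rat) : Prop :=
  [/\ p_integral p a, p_integral p b & ((p ^ n)%N%:Z %| numq (a - b))%Z].

(* [:: E_0; E_2; ...; E_(2n)] *)
Fixpoint euler_even_seq (n : nat) : seq int :=
  if n is m.+1 then
    let s := euler_even_seq m in
    rcons s (- \sum_(1 <= k < n.+1) 'C(2 * n, 2 * k)%:Z * s`_(n - k))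
  else [:: 1].

Definition euler_number (n : nat) : int :=
  if odd n then 0 else (euler_even_seq n./2)`_(n./2).

Lemma size_euler_even_seq n : size (euler_even_seq n) = n.+1.
Proof. by elim: n => //= n IHn; rewrite size_rcons IHn. Qed.

Lemma nth_euler_even_seq m n :
  (m <= n)%N -> (euler_even_seq n)`_m = euler_number (2 * m).
Proof.
rewrite /euler_number mul2n odd_double doubleK.
elim: n => [|n IHn]; first by rewrite leqn0 => /eqP->.
rewrite leq_eqVlt => /predU1P[-> //|lt_mn].
by rewrite /= nth_rcons size_euler_even_seq lt_mn IHn.
Qed.

Lemma euler_number0 : euler_number 0 = 1.
Proof. by []. Qed.

Lemma euler_number_odd n : (0 < n)%N -> euler_number (2 * n - 1) = 0.
Proof.
by move=> n_gt0; rewrite /euler_number oddB ?muln_gt0 // mul2n odd_double.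
Qed.

Lemma euler_number_even n : (0 < n)%N ->
  euler_number (2 * n) =
    - \sum_(1 <= k < n.+1) 'C(2 * n, 2 * k)%:Z * euler_number (2 * n - 2 * k).
Proof.
case: n => // n _; rewrite -(nth_euler_even_seq (leqnn _)) /=.
rewrite nth_rcons size_euler_even_seq ltnn eqxx; congr (- _).
apply: eq_big_nat => k /andP[k_gt0 _].
by rewrite -mulnBr nth_euler_even_seq // leq_subLR -addn1 addnC leq_add2r.
Qed.

(* Main.v *)
From HB Require Import structures.
Require Import Defs.
From mathcomp Require Import all_boot all_order all_algebra all_solvable all_field.
From mathcomp Require Import ring lra zify.

Set Implicit Arguments.
Unset Strict Implicit.
Unset Printing Implicit Defensive.

Import Order.TTheory GRing.Theory Num.Theory.
Local Open Scope ring_scope.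

(** Write c(k) = binom(2k,k) / 4^k, S0 = sum c(k)^3 and S1 = sum (4k+1) c(k)^3
    for k <= n = (p-1)/2. Gosper telescoping gives 27 S = 13 S0 + 9 S1 modulo p^3.

    Replacing c(k)^2 by the product of ((2j+1)^2 - t^2) / ((2j+2)^2 - t^2), j < k,
    with t = p turns S0 and S1 into terminating well-poised series with a closed
    form, and changes them by a multiple of p^2. Modulo p, c(k)^3 is
    (-1)^k binom(n,k)^3, so modulo p^3 that change is also the change of Dixon's
    sum under the analogous deformation with parameter p/2, which has a closed form
    too. This expresses S0 and S1 modulo p^3 by products and by the sum H of 1/i^2
    for i <= p/4.

    If p = 3 mod 4, H is congruent to -4 E_(p-3) modulo p by telescoping Euler
    polynomials. If p = 1 mod 4, S0 is the square of the p-adic unit J among the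
    two conjugate quartic Jacobi sums A +- iB, and A^2 + B^2 = p: for e = +-1 and
    z = e mod p, e = z (15 - 10 z^2 + 3 z^4) / 8 mod p^3, so that the quadratic
    character in the Jacobi sum can be replaced by powers, which reduces J to four
    binomial coefficients. *)

(** * Two terminating well-poised sums *)

(** Taking t = p = 2n + 1 makes the deformed series stop by itself after k = n and turns it into one
    member of a family indexed by n, to which a recurrence in n applies. The price is an error of
    order p^2, one power too large. Its coefficient matters only modulo p, where (2j+1)^2 and
    (2(n-j))^2 coincide; this moves the error to Dixon's sum, and clearing a factor 4 makes the
    parameter p/2. Modulo p the weight 4k + 1 is odd under k -> n - k, so one of the two Dixon sums
    vanishes for every parameter and only one of S0, S1 is corrected by H; the parity of n decides
    which. For p = 1 mod 4, p = 4m + 1, the closed form still contains binom(2m,m) and harmonic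
    sums, which have to be matched with x^2. The quintic is the odd one with values +-1 at +-1 and
    vanishing first and second derivatives there, so an error divisible by p in z becomes one
    divisible by p^3. Once the unit J is known modulo p^3, its conjugate is p / J, and 2A = J + p /
    J determines J^2 in terms of A without any knowledge of B. *)

Section WellPoised.
Variable F : numFieldType.
Implicit Types (n k j : nat) (s t : F).

Definition cbin k : F := \prod_(j < k) ((2 * j%:R + 1) / (2 * j%:R + 2)).
(** At t = 2n + 1 the numerator factor j = n vanishes, so the series stops after k = n; at t = 0
    this is [cbin k ^+ 2]. *)
Definition wpr t k : F :=
  \prod_(j < k) (((2 * j%:R + 1) ^+ 2 - t ^+ 2) / ((2 * j%:R + 2) ^+ 2 - t ^+ 2)).

Lemma odd_neq_even a b : (2 * a%:R + 1 - 2 * b%:R : F) != 0.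
Proof.
rewrite (_ : _ - _ = (2 * a + 1)%:R - (2 * b)%:R); last by ring.
by rewrite subr_eq0 eqr_nat; apply/eqP; lia.
Qed.

Lemma natrS_neq0 (a : F) n : a = n.+1%:R -> a != 0.
Proof. by move=> ->; rewrite pnatr_eq0. Qed.

(** Takes one linear factor of numerator and denominator from [wpr] at 2n + 1 and one from [wpr] at
    2n + 3. The terms for n and for n + 1 are then both [wz_term n k] times a polynomial of degree 2
    in k. *)
Let wz_term n k : F := cbin k * \prod_(j < k)
  (4 * (j%:R + n%:R + 1) * (j%:R - n%:R - 1) /
     ((2 * j%:R + 1 - 2 * n%:R) * (2 * j%:R + 2 * n%:R + 5))).

Lemma wz_termS n k : wz_term n k.+1 = wz_term n k * (2 * (2 * k%:R + 1) * (k%:R + n%:R + 1) * (k%:R - n%:R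
  - 1) / ((k%:R + 1) * (2 * k%:R + 1 - 2 * n%:R) * (2 * k%:R + 2 * n%:R + 5))).
Proof.
rewrite /wz_term /cbin !big_ord_recr /=.
have h1 := odd_neq_even k n.
have h2 : (2 * k%:R + 2 * n%:R + 5 : F) != 0 by apply: (@natrS_neq0 _ (2 * k + 2 * n + 4)); ring.
have h3 : (k%:R + 1 : F) != 0 by apply: (@natrS_neq0 _ k); ring.
have h4 : (2 * k%:R + 2 : F) != 0 by apply: (@natrS_neq0 _ (2 * k + 1)); ring.
by field; rewrite h1 h2 h3 h4.
Qed.

Lemma cbin_wpr_wz n k : cbin k * wpr (2 * n%:R + 1) k =
  wz_term n k * ((n%:R + 1 - k%:R) * (2 * k%:R + 2 * n%:R + 3) / ((n%:R + 1) * (2 * n%:R + 3))).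
Proof.
have h3 : (n%:R + 1 : F) != 0 by apply: (@natrS_neq0 _ n); ring.
have h2 : (2 * n%:R + 3 : F) != 0 by apply: (@natrS_neq0 _ (2 * n + 2)); ring.
elim: k => [|k IHk].
  by rewrite /wpr /wz_term !big_ord0 /=; field; rewrite h2 h3.
have h1 := odd_neq_even k n.
have h4 : (k%:R + 1 : F) != 0 by apply: (@natrS_neq0 _ k); ring.
have h5 : (2 * k%:R + 2 * n%:R + 3 : F) != 0 by apply: (@natrS_neq0 _ (2 * k + 2 * n + 2)); ring.
have h6 : (2 * k%:R + 2 * n%:R + 5 : F) != 0 by apply: (@natrS_neq0 _ (2 * k + 2 * n + 4)); ring.
have h7 : (2 * k%:R + 2 : F) != 0 by apply: (@natrS_neq0 _ (2 * k + 1)); ring.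
have e : (2 * k%:R + 2) ^+ 2 - (2 * n%:R + 1) ^+ 2 = (2 * k%:R + 1 - 2 * n%:R) * (2 * k%:R + 2 * n%:R + 3) :> F by ring.
rewrite wz_termS {1}/cbin {1}/wpr !big_ord_recr /= -/(cbin k) -/(wpr _ k).
rewrite mulrACA IHk e -natr1.
by field; rewrite h1 h2 h3 h4 h5 h6 h7.
Qed.

Lemma cbin_wpr_wzS n k : cbin k * wpr (2 * n.+1%:R + 1) k =
  wz_term n k * ((n%:R + 1 + k%:R) * (2 * n%:R + 1 - 2 * k%:R) / ((n%:R + 1) * (2 * n%:R + 1))).
Proof.
have h3 : (n%:R + 1 : F) != 0 by apply: (@natrS_neq0 _ n); ring.
have h2 : (2 * n%:R + 1 : F) != 0 by apply: (@natrS_neq0 _ (2 * n)); ring.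
elim: k => [|k IHk].
  by rewrite /wpr /wz_term !big_ord0 /=; field; rewrite h2 h3.
have h1 := odd_neq_even k n.
have h1' : (2 * k%:R + 1 - 2 * (n%:R + 1) : F) != 0 by rewrite natr1 odd_neq_even.
have h4 : (k%:R + 1 : F) != 0 by apply: (@natrS_neq0 _ k); ring.
have h6 : (2 * k%:R + 2 * n%:R + 5 : F) != 0 by apply: (@natrS_neq0 _ (2 * k + 2 * n + 4)); ring.
have h7 : (2 * k%:R + 2 : F) != 0 by apply: (@natrS_neq0 _ (2 * k + 1)); ring.
have e : (2 * k%:R + 2) ^+ 2 - (2 * n.+1%:R + 1) ^+ 2 = (2 * k%:R + 1 - 2 * n.+1%:R) * (2 * k%:R + 2 * n%:R
  + 5) :> F by ring.
rewrite wz_termS {1}/cbin {1}/wpr !big_ord_recr /= -/(cbin k) -/(wpr _ k).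
rewrite mulrACA IHk e -(natr1 k) -(natr1 n).
by field; rewrite h1 h2 h3 h4 h6 h7 h1'.
Qed.

(* [c] is the certificate of a Gosper-Zeilberger telescoping. *)
Let tele n (c : nat -> F) k := wz_term n k * (k%:R * (2 * k%:R - 1 - 2 * n%:R) * (2 * k%:R + 2 * n%:R + 3)
  * c k / ((n%:R + 1) * (2 * n%:R + 3))).

(** The hypothesis is the telescoping identity with the common factor [wz_term n k] divided out, so
    it contains no products any more. The boundary term at n + 2 vanishes because [wz_term n]
    acquires the factor k - n - 1 at k = n + 1; the term for n at k = n + 1 vanishes too, so both
    sums may run that far. *)
Lemma wp_tele n (w c : nat -> F) r :
  (forall k, w k * ((n%:R + 1 + k%:R) * (2 * n%:R + 1 - 2 * k%:R) * (2 * n%:R + 3) / (2 * n%:R + 1)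
      - r * ((n%:R + 1 - k%:R) * (2 * k%:R + 2 * n%:R + 3))) =
     c k.+1 * (2 * (2 * k%:R + 1) * (k%:R + n%:R + 1) * (k%:R - n%:R - 1)) -
     c k * (k%:R * (2 * k%:R - 1 - 2 * n%:R) * (2 * k%:R + 2 * n%:R + 3))) ->
  \sum_(k < n.+2) w k * (cbin k * wpr (2 * n.+1%:R + 1) k) =
    r * \sum_(k < n.+1) w k * (cbin k * wpr (2 * n%:R + 1) k).
Proof.
move=> H.
have h3 : (n%:R + 1 : F) != 0 by apply: (@natrS_neq0 _ n); ring.
have h2 : (2 * n%:R + 3 : F) != 0 by apply: (@natrS_neq0 _ (2 * n + 2)); ring.
have h5 : (2 * n%:R + 1 : F) != 0 by apply: (@natrS_neq0 _ (2 * n)); ring.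
have T m : \sum_(k < m) (w k * (cbin k * wpr (2 * n.+1%:R + 1) k) - r * (w k * (cbin k * wpr (2 * n%:R
  + 1) k))) = tele n c m.
  elim: m => [|m IHm]; first by rewrite big_ord0 /tele !mul0r mulr0.
  rewrite big_ord_recr /= IHm cbin_wpr_wzS cbin_wpr_wz /tele wz_termS -(natr1 m).
  have h1 := odd_neq_even m n.
  have h4 : (m%:R + 1 : F) != 0 by apply: (@natrS_neq0 _ m); ring.
  have h6 : (2 * m%:R + 2 * n%:R + 5 : F) != 0 by apply: (@natrS_neq0 _ (2 * m + 2 * n + 4)); ring.
  have -> : w m * (wz_term n m * ((n%:R + 1 + m%:R) * (2 * n%:R + 1 - 2 * m%:R) / ((n%:R + 1) * (2 * n%:R + 1)))) -
     r * (w m * (wz_term n m * ((n%:R + 1 - m%:R) * (2 * m%:R + 2 * n%:R + 3) / ((n%:R + 1) * (2 * n%:R + 3)))))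
    = wz_term n m / ((n%:R + 1) * (2 * n%:R + 3)) * (w m * ((n%:R + 1 + m%:R) * (2 * n%:R + 1 - 2 * m%:R) * (2
      * n%:R + 3) / (2 * n%:R + 1)
      - r * ((n%:R + 1 - m%:R) * (2 * m%:R + 2 * n%:R + 3)))) by field; rewrite h2 h3 h5.
  rewrite H.
  by field; rewrite h1 h2 h3 h4 h6.
move: (T n.+2); rewrite sumrB => /eqP.
have -> : tele n c n.+2 = 0.
  by rewrite /tele wz_termS -(natr1 n); ring.
rewrite subr_eq0 => /eqP ->.
rewrite big_ord_recr /= mulr_sumr cbin_wpr_wz -(natr1 n).
by rewrite [X in _ + X](_ : _ = 0) ?addr0 //; ring.
Qed.

Lemma sum_wp0 n : \sum_(k < n.+1) cbin k * wpr (2 * n%:R + 1) k =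
  (2 * n%:R + 1) * \prod_(j < n) ((4 * j%:R + 3) / (4 * j%:R + 5)).
Proof.
elim: n => [|n IHn].
  by rewrite big_ord1 /cbin /wpr !big_ord0 /=; ring.
have h5 : (2 * n%:R + 1 : F) != 0 by apply: (@natrS_neq0 _ (2 * n)); ring.
have h4 : (4 * n%:R + 5 : F) != 0 by apply: (@natrS_neq0 _ (4 * n + 4)); ring.
under eq_bigr do rewrite -[_ * _]mul1r.
(* The last argument is the ratio of the closed forms at n + 1 and n; the certificate does not
   depend on k. *)
rewrite (@wp_tele n (fun=> 1) (fun=> 2 * (2 * n%:R + 3) / ((2 * n%:R + 1) * (4 * n%:R + 5)))
  ((2 * n%:R + 3) / (2 * n%:R + 1) * ((4 * n%:R + 3) / (4 * n%:R + 5)))).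
  under eq_bigr do rewrite mul1r.
  rewrite IHn big_ord_recr /= -(natr1 n).
  by field; rewrite h4 h5.
by move=> k; field; rewrite h4 h5.
Qed.

Lemma sum_wp1 n : \sum_(k < n.+1) (4 * k%:R + 1) * (cbin k * wpr (2 * n%:R + 1) k) =
  (2 * n%:R + 1) * \prod_(j < n) ((4 * j%:R + 5) / (4 * j%:R + 3)).
Proof.
elim: n => [|n IHn].
  by rewrite big_ord1 /cbin /wpr !big_ord0 /=; ring.
have h5 : (2 * n%:R + 1 : F) != 0 by apply: (@natrS_neq0 _ (2 * n)); ring.
have h4 : (4 * n%:R + 3 : F) != 0 by apply: (@natrS_neq0 _ (4 * n + 2)); ring.
rewrite (@wp_tele n (fun k => 4 * k%:R + 1)
  (fun k => 2 * (2 * n%:R + 3) / ((2 * n%:R + 1) * (4 * n%:R + 3)) * (4 * k%:R - 1))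
  ((2 * n%:R + 3) / (2 * n%:R + 1) * ((4 * n%:R + 5) / (4 * n%:R + 3)))).
  rewrite IHn big_ord_recr /= -(natr1 n).
  by field; rewrite h4 h5.
by move=> k; rewrite -(natr1 k); field; rewrite h4 h5.
Qed.

(** * Dixon's alternating sum of cubed binomial coefficients and its deformation *)

Definition wpb n s k : F :=
  \prod_(j < k) (((n%:R - j%:R) ^+ 2 - s ^+ 2) / ((j%:R + 1) ^+ 2 - s ^+ 2)).

Section HalfSum.
Variable s : F.
Hypothesis s_nint : forall j, (j%:R + 1) ^+ 2 - s ^+ 2 != 0.

(** At s = 0 this is (-1)^k binom(n,k)^3, the summand of Dixon's identity. *)
Definition dixon_term n k : F := (-1) ^+ k * 'C(n, k)%:R * wpb n s k.

Lemma natr_binS n k : 'C(n, k.+1)%:R = 'C(n, k)%:R * (n%:R - k%:R) / (k%:R + 1) :> F.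
Proof.
have h4 : (k%:R + 1 : F) != 0 by apply: (@natrS_neq0 _ k); ring.
apply: (canRL (mulfK h4)); rewrite natr1 -natrM mulnC mul_bin_left natrM mulrC.
by have [le_kn|lt_nk] := leqP k n; [rewrite natrB | rewrite bin_small // !mul0r].
Qed.

Lemma dixon_term_small n k : (n < k)%N -> dixon_term n k = 0.
Proof. by move=> lt_nk; rewrite /dixon_term bin_small // mulr0 mul0r. Qed.

Lemma dixon_termS n k : dixon_term n k.+1 =
  - dixon_term n k * ((n%:R - k%:R) * ((n%:R - k%:R) ^+ 2 - s ^+ 2) / ((k%:R + 1) * ((k%:R + 1) ^+ 2 - s ^+ 2))).
Proof.
have h4 : (k%:R + 1 : F) != 0 by apply: (@natrS_neq0 _ k); ring.
rewrite /dixon_term /wpb big_ord_recr /= exprS natr_binS.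
by field; rewrite h4 s_nint.
Qed.

(** The recurrences below go from n to n + 2, since the closed forms depend on the parity of n. No
    division occurs, because the factors on the right vanish at k = n + 1 and k = n + 2. *)
Lemma dixon_term2 n k :
  dixon_term n k * ((n%:R + 2) * (n%:R + 1) * ((n%:R + 2) ^+ 2 - s ^+ 2) * ((n%:R + 1) ^+ 2 - s ^+ 2)) =
  dixon_term n.+2 k * ((n%:R + 2 - k%:R) * (n%:R + 1 - k%:R) * ((n%:R + 2 - k%:R) ^+ 2 - s ^+ 2)
    * ((n%:R + 1 - k%:R) ^+ 2 - s ^+ 2)).
Proof.
elim: k => [|k IHk]; first by rewrite /dixon_term /wpb !big_ord0 !bin0; ring.
have h4 : (k%:R + 1 : F) != 0 by apply: (@natrS_neq0 _ k); ring.
rewrite !dixon_termS mulNr -mulrN mulrAC IHk -(natr1 n.+1) -(natr1 n) -(natr1 k).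
by field; rewrite h4 s_nint.
Qed.

Lemma dixon_term_tele n (w w2 c : nat -> F) q r :
  (forall k, w2 k * (q * ((n%:R + 2) * (n%:R + 1) * ((n%:R + 2) ^+ 2 - s ^+ 2) * ((n%:R + 1) ^+ 2 - s ^+ 2)))
      - r * w k * ((n%:R + 2 - k%:R) * (n%:R + 1 - k%:R) * ((n%:R + 2 - k%:R) ^+ 2 - s ^+ 2)
         * ((n%:R + 1 - k%:R) ^+ 2 - s ^+ 2)) =
     - c k.+1 * ((n%:R + 2 - k%:R) * ((n%:R + 2 - k%:R) ^+ 2 - s ^+ 2)) -
     c k * (k%:R * (k%:R ^+ 2 - s ^+ 2))) ->
  q * \sum_(k < n.+3) w2 k * dixon_term n.+2 k = r * \sum_(k < n.+1) w k * dixon_term n k.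
Proof.
move=> H.
have h3 : (n%:R + 1 : F) != 0 by apply: (@natrS_neq0 _ n); ring.
have h2 : (n%:R + 2 : F) != 0 by apply: (@natrS_neq0 _ n.+1); ring.
have s2 : (n%:R + 2) ^+ 2 - s ^+ 2 != 0.
  by have := s_nint n.+1; rewrite -(natr1 n) -addrA.
set K := (n%:R + 2) * (n%:R + 1) * ((n%:R + 2) ^+ 2 - s ^+ 2) * ((n%:R + 1) ^+ 2 - s ^+ 2).
have K0 : K != 0 by rewrite /K !mulf_neq0 // s_nint.
have T M : \sum_(k < M) K * (q * (w2 k * dixon_term n.+2 k) - r * (w k * dixon_term n k)) =
     M%:R * (M%:R ^+ 2 - s ^+ 2) * c M * dixon_term n.+2 M.
  elim: M => [|M IHM]; first by rewrite big_ord0 !mul0r.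
  rewrite big_ord_recr /= IHM dixon_termS.
  have -> : K * (q * (w2 M * dixon_term n.+2 M) - r * (w M * dixon_term n M)) =
    q * (w2 M * dixon_term n.+2 M) * K - r * w M * (dixon_term n M * K) by ring.
  rewrite dixon_term2 -/K.
  have h4 : (M%:R + 1 : F) != 0 by apply: (@natrS_neq0 _ M); ring.
  have -> : q * (w2 M * dixon_term n.+2 M) * K -
   r * w M * (dixon_term n.+2 M * ((n%:R + 2 - M%:R) * (n%:R + 1 - M%:R) *
      ((n%:R + 2 - M%:R) ^+ 2 - s ^+ 2) * ((n%:R + 1 - M%:R) ^+ 2 - s ^+ 2))) =
   dixon_term n.+2 M * (w2 M * (q * K) -
   r * w M * ((n%:R + 2 - M%:R) * (n%:R + 1 - M%:R) *
      ((n%:R + 2 - M%:R) ^+ 2 - s ^+ 2) * ((n%:R + 1 - M%:R) ^+ 2 - s ^+ 2))) by ring.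
  rewrite H -(natr1 M) -(natr1 n.+1) -(natr1 n).
  by field; rewrite h4 s_nint.
move: (T n.+3); rewrite dixon_term_small // mulr0 -mulr_sumr sumrB -!mulr_sumr.
move/eqP; rewrite mulf_eq0 (negPf K0) subr_eq0 => /eqP ->.
by rewrite 2!big_ord_recr /= !dixon_term_small // !mulr0 !addr0.
Qed.

(* Certificates (found by solving a linear system) for the creative telescoping
   of the two sums below; [S] stands for [s ^+ 2]. *)
Let cert0 (M S x : F) : F := ((- 2 * S + 2 * S ^+ 2 + 18 * M * S - 4 * M * S ^+ 2 + 8 * M ^+ 2 - 59 * M ^+ 2
  * S - 54 * M ^+ 3 + 59 * M ^+ 3 * S + 123 * M ^+ 4 - 91 * M ^+ 5)
  + (- 6 * S - 9 * M + 39 * M * S + 72 * M ^+ 2 - 54 * M ^+ 2 * S - 192 * M ^+ 3 + 162 * M ^+ 4) * x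
  + (3 - 6 * S - 36 * M + 15 * M * S + 126 * M ^+ 2 - 132 * M ^+ 3) * x ^+ 2
  + (6 - 36 * M + 54 * M ^+ 2) * x ^+ 3
  + (3 - 9 * M) * x ^+ 4) / 2.
Let cert1 (M S x : F) : F := (3 * M * S - 3 * M ^+ 3 - 27 * M ^+ 3 * S + 27 * M ^+ 5)
  + (- 3 * S + 2 * S ^+ 2 + 6 * M * S + 4 * M * S ^+ 2 + 9 * M ^+ 2 + 22 * M ^+ 2 * S - 6 * M ^+ 3 - 59
    * M ^+ 3 * S - 66 * M ^+ 4 + 91 * M ^+ 5) * x
  + (- 6 * S - 9 * M + 18 * M ^+ 2 + 54 * M ^+ 2 * S + 81 * M ^+ 3 - 162 * M ^+ 4) * x ^+ 2
  + (3 - 5 * S - 18 * M - 15 * M * S - 37 * M ^+ 2 + 132 * M ^+ 3) * x ^+ 3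
  + (6 - 54 * M ^+ 2) * x ^+ 4
  + (3 + 9 * M) * x ^+ 5.

(** The parameter s enters only through the last product, so the quotient of the values at s = p/2
    and s = 0 is explicit. This is what the comparison in [deform_factor] uses. *)
Lemma sum_dixon_term_even m : \sum_(k < (2 * m).+1) dixon_term (2 * m) k =
  (-1) ^+ m * ((3 * m)`!%:R / m`!%:R) / \prod_(j < m) ((j%:R + 1) ^+ 2 - s ^+ 2).
Proof.
elim: m => [|m IHm].
  by rewrite big_ord1 big_ord0 /dixon_term /wpb big_ord0 bin0 fact0 /=; field.
have h1 : (m%:R + 1 : F) != 0 by apply: (@natrS_neq0 _ m); ring.
have h2 : m`!%:R != 0 :> F by rewrite pnatr_eq0 -lt0n fact_gt0.
have h3 : \prod_(j < m) ((j%:R + 1) ^+ 2 - s ^+ 2) != 0.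
  by apply/prodf_neq0 => j _; apply: s_nint.
rewrite mulnS; under eq_bigr do rewrite -[dixon_term _ _]mul1r.
apply: (mulfI (s_nint m)).
rewrite (@dixon_term_tele (2 * m) (fun=> 1) (fun=> 1) (fun k => cert0 (m%:R + 1) (s ^+ 2) (k%:R - m%:R - 1))
  _ (- (3 * (3 * m%:R + 2) * (3 * m%:R + 1)))).
  under eq_bigr do rewrite mul1r.
  rewrite IHm big_ord_recr /= (exprS (-1)) (mulnS 3) !addSn add0n.
  rewrite (factS (3 * m).+2) (factS (3 * m).+1) (factS (3 * m)) (factS m) !natrM.
  rewrite (_ : (3 * m).+3%:R = 3 * m%:R + 3 :> F); last by ring.
  rewrite (_ : (3 * m).+2%:R = 3 * m%:R + 2 :> F); last by ring.
  rewrite (_ : (3 * m).+1%:R = 3 * m%:R + 1 :> F); last by ring.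
  rewrite -(natr1 m).
  by field; rewrite h1 h2 h3 s_nint.
by move=> k; rewrite /cert0; field.
Qed.

Lemma sum_dixon_term_odd m :
  \sum_(k < (2 * m).+2) ((2 * m).+1%:R - 2 * k%:R) * dixon_term (2 * m).+1 k =
  (-1) ^+ m * (2 * (3 * m).+1`!%:R / m`!%:R) / \prod_(j < m) ((j%:R + 1) ^+ 2 - s ^+ 2).
Proof.
elim: m => [|m IHm].
  have h := s_nint 0; rewrite add0r in h.
  rewrite !muln0 !big_ord_recr /= !big_ord0 /dixon_term /wpb !big_ord_recr !big_ord0 /=.
  by rewrite bin0 binn factS fact0; field; have := h; rewrite expr1n.
have h1 : (m%:R + 1 : F) != 0 by apply: (@natrS_neq0 _ m); ring.
have h2 : m`!%:R != 0 :> F by rewrite pnatr_eq0 -lt0n fact_gt0.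
have h3 : \prod_(j < m) ((j%:R + 1) ^+ 2 - s ^+ 2) != 0.
  by apply/prodf_neq0 => j _; apply: s_nint.
rewrite mulnS; apply: (mulfI (s_nint m)).
rewrite (@dixon_term_tele (2 * m).+1 (fun k => (2 * m).+1%:R - 2 * k%:R)
   (fun k => (2 * m).+3%:R - 2 * k%:R) (fun k => cert1 (m%:R + 1) (s ^+ 2) (k%:R - m%:R - 2))
  _ (- (3 * (3 * m%:R + 4) * (3 * m%:R + 2)))).
  rewrite IHm big_ord_recr /= (exprS (-1)) (mulnS 3) !addSn add0n.
  rewrite (factS (3 * m).+3) (factS (3 * m).+2) (factS (3 * m).+1) (factS m) !natrM.
  rewrite (_ : (3 * m).+4%:R = 3 * m%:R + 4 :> F); last by ring.
  rewrite (_ : (3 * m).+3%:R = 3 * m%:R + 3 :> F); last by ring.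
  rewrite (_ : (3 * m).+2%:R = 3 * m%:R + 2 :> F); last by ring.
  rewrite -(natr1 m).
  by field; rewrite h1 h2 h3 s_nint.
by move=> k; rewrite /cert1; ring.
Qed.
End HalfSum.
End WellPoised.

(** * Congruences in the local ring of rationals prime to p *)

(* The primality proof is an argument so that the closure properties of [zloc]
   can be registered as canonical instances. *)
Definition zloc p of prime p : {pred rat} := p_integral p.

Section Localization.
Variables (p : nat) (p_pr : prime p).
Local Notation Zp := (zloc p_pr).

(** Fractions need not be reduced here, which makes closure under the ring operations immediate; the
    reduced denominator divides every other one. *)
Lemma zlocP a : reflect (exists u v : int, ~~ (p%:Z %| v)%Z /\ a = u%:~R / v%:~R) (a \in Zp).
Proof.
apply: (iffP idP) => [Za | [u [v [pv ->]]]].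
  by exists (numq a), (denq a); split; rewrite ?divq_num_den.
rewrite unfold_in /p_integral; apply: contra pv => pd.
have v0 : v%:~R != 0 :> rat.
  rewrite intr_eq0; apply: contraTneq pd => ->.
  by rewrite invr0 mulr0 dvdzE /= gtnNdvd // prime_gt1.
have /eqP : u%:~R / v%:~R = (numq (u%:~R / v%:~R))%:~R / (denq (u%:~R / v%:~R))%:~R :> rat.
  by rewrite divq_num_den.
set d := denq _ in pd *; set w := numq _.
rewrite eqr_div // ?intr_eq0 ?denq_eq0 // -!intrM eqr_int => /eqP e.
have : (d %| w * v)%Z by rewrite -e dvdz_mull.
rewrite Gauss_dvdzr; first exact: dvdz_trans.
by rewrite coprimezE coprime_sym coprime_num_den.
Qed.

Lemma zloc_subring : subring_closed Zp.
Proof.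
have pZ u v : ~~ (p%:Z %| u)%Z -> ~~ (p%:Z %| v)%Z -> ~~ (p%:Z %| u * v)%Z.
  by rewrite !dvdzE abszM Euclid_dvdM // => /negPf -> /negPf ->.
have n0 v : ~~ (p%:Z %| v)%Z -> v%:~R != 0 :> rat.
  by rewrite intr_eq0; apply: contraNneq => ->; rewrite dvdz0.
split.
- by apply/zlocP; exists 1, 1; rewrite divr1 dvdzE /= gtnNdvd // prime_gt1.
- move=> _ _ /zlocP[u [v [pv ->]]] /zlocP[u' [v' [pv' ->]]]; apply/zlocP.
  exists (u * v' - u' * v), (v * v'); split; first exact: pZ.
  by rewrite !(intrM, intrB); field; rewrite !n0.
- move=> _ _ /zlocP[u [v [pv ->]]] /zlocP[u' [v' [pv' ->]]]; apply/zlocP.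
  exists (u * u'), (v * v'); split; first exact: pZ.
  by rewrite !(intrM, intrB); field; rewrite !n0.
Qed.

HB.instance Definition _ := GRing.isSubringClosed.Build rat Zp zloc_subring.

Definition zunit a := [&& a != 0, a \in Zp & a^-1 \in Zp].

Lemma zunit_neq0 a : zunit a -> a != 0. Proof. by case/and3P. Qed.
Lemma zunit_loc a : zunit a -> a \in Zp. Proof. by case/and3P. Qed.
Lemma zunitV_loc a : zunit a -> a^-1 \in Zp. Proof. by case/and3P. Qed.

Lemma zunit_int (u : int) : ~~ (p%:Z %| u)%Z -> zunit u%:~R.
Proof.
move=> pu; apply/and3P; split; last 2 first.
- exact: rpred_int.
- by apply/zlocP; exists 1, u; rewrite div1r.
by rewrite intr_eq0; apply: contraNneq pu => ->; rewrite dvdz0.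
Qed.

Lemma zunit_nat (u : nat) : ~~ (p %| u)%N -> zunit u%:R.
Proof. by move=> pu; apply: (@zunit_int u). Qed.

Lemma zunit_ltp (u : nat) : (0 < u < p)%N -> zunit u%:R.
Proof. by case/andP => u0 up; apply: zunit_nat; rewrite gtnNdvd. Qed.

Lemma zunitM a b : zunit a -> zunit b -> zunit (a * b).
Proof.
move=> /and3P[a0 Za Va] /and3P[b0 Zb Vb].
by rewrite /zunit mulf_neq0 // rpredM // invfM rpredM.
Qed.

Lemma zunitV a : zunit a -> zunit a^-1.
Proof. by move=> /and3P[a0 Za Va]; rewrite /zunit invr_eq0 a0 invrK Za Va. Qed.

Lemma zunitN a : zunit a -> zunit (- a).
Proof. by move=> /and3P[a0 Za Va]; rewrite /zunit oppr_eq0 a0 invrN !rpredN Za Va. Qed.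

Lemma zunit1 : zunit 1. Proof. by rewrite /zunit oner_neq0 invr1 rpred1. Qed.

Lemma zunitX a k : zunit a -> zunit (a ^+ k).
Proof. by move=> ua; elim: k => [|k IHk]; rewrite ?zunit1 // exprS zunitM. Qed.

Lemma zunit_prod (I : Type) (r : seq I) (P : pred I) (f : I -> rat) :
  (forall i, P i -> zunit (f i)) -> zunit (\prod_(i <- r | P i) f i).
Proof. by move=> uf; elim/big_ind: _ => //; [exact: zunit1 | exact: zunitM]. Qed.

Lemma zloc_div a b : a \in Zp -> zunit b -> a / b \in Zp.
Proof. by move=> Za /zunitV_loc Vb; rewrite rpredM. Qed.

(** Relates arbitrary rationals, so that p-integrality of one side can be deduced from that of the
    other, as in [cong_loc]. *)
Definition cong k (a b : rat) := (a - b) / p%:R ^+ k \in Zp.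

Let p0 : p%:R != 0 :> rat. Proof. by rewrite pnatr_eq0 -lt0n prime_gt0. Qed.
Let pX0 k : p%:R ^+ k != 0 :> rat. Proof. by rewrite expf_neq0. Qed.

Lemma cong_refl k a : cong k a a.
Proof. by rewrite /cong subrr mul0r rpred0. Qed.

Lemma eq_cong k a b : a = b -> cong k a b.
Proof. by move=> ->; apply: cong_refl. Qed.

Lemma cong_sym k a b : cong k a b -> cong k b a.
Proof. by rewrite /cong -opprB mulNr rpredN. Qed.

Lemma cong_trans k b a c : cong k a b -> cong k b c -> cong k a c.
Proof. by rewrite /cong => ab bc; rewrite -(subrKA b) mulrDl rpredD. Qed.

Lemma congD k a b c d : cong k a b -> cong k c d -> cong k (a + c) (b + d).
Proof. by rewrite /cong => ab cd; rewrite opprD addrACA mulrDl rpredD. Qed.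

Lemma congN k a b : cong k a b -> cong k (- a) (- b).
Proof. by rewrite /cong -opprD mulNr rpredN. Qed.

Lemma congB k a b c d : cong k a b -> cong k c d -> cong k (a - c) (b - d).
Proof. by move=> ab cd; apply: congD => //; apply: congN. Qed.

Lemma congM k a b c d : a \in Zp -> d \in Zp -> cong k a b -> cong k c d ->
  cong k (a * c) (b * d).
Proof.
rewrite /cong => Za Zd ab cd.
have -> : (a * c - b * d) / p%:R ^+ k = a * ((c - d) / p%:R ^+ k) + (a - b) / p%:R ^+ k * d.
  by ring.
by apply: rpredD; apply: rpredM.
Qed.

Lemma congMl k a c d : a \in Zp -> cong k c d -> cong k (a * c) (a * d).
Proof. by rewrite /cong => Za cd; rewrite -mulrBr -mulrA rpredM. Qed.

Lemma congMr k a c d : a \in Zp -> cong k c d -> cong k (c * a) (d * a).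
Proof. by rewrite ![_ * a]mulrC; apply: congMl. Qed.

Lemma cong_le k l a b : (l <= k)%N -> cong k a b -> cong l a b.
Proof.
rewrite /cong => lk ab; have -> : (a - b) / p%:R ^+ l = (a - b) / p%:R ^+ k * p%:R ^+ (k - l).
  by rewrite -{1}(subnK lk) exprD; field; rewrite !pX0.
by rewrite rpredM // rpredX // rpred_nat.
Qed.

Lemma cong_loc k a b : cong k a b -> b \in Zp -> a \in Zp.
Proof.
move/(cong_le (leq0n k)); rewrite /cong expr0 divr1 => ab Zb.
by rewrite -(subrK b a) rpredD.
Qed.

Lemma congMpX k l a b : cong k a b -> cong (k + l) (p%:R ^+ l * a) (p%:R ^+ l * b).
Proof.
rewrite /cong -mulrBr exprD.
suff -> : p%:R ^+ l * (a - b) / (p%:R ^+ k * p%:R ^+ l) = (a - b) / p%:R ^+ k by [].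
by field; rewrite !pX0.
Qed.

Lemma cong_pX k a : a \in Zp -> cong k (p%:R ^+ k * a) 0.
Proof. by move=> Za; rewrite /cong subr0 mulrAC divff // mul1r. Qed.

Lemma cong_add_pX k a b : b \in Zp -> cong k (a + p%:R ^+ k * b) a.
Proof. by move=> Zb; rewrite -[X in cong _ _ X]addr0 congD ?cong_refl ?cong_pX. Qed.

Lemma cong_sum k (I : Type) (r : seq I) (P : pred I) (f g : I -> rat) :
  (forall i, P i -> cong k (f i) (g i)) ->
  cong k (\sum_(i <- r | P i) f i) (\sum_(i <- r | P i) g i).
Proof. by move=> fg; elim/big_ind2: _ => //; [exact: cong_refl | by move=> *; exact: congD]. Qed.

Lemma congX k a b l : b \in Zp -> cong k a b -> cong k (a ^+ l) (b ^+ l).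
Proof.
move=> Zb ab; elim: l => [|l IHl]; first exact: cong_refl.
rewrite !exprS; apply: congM => //; first exact: cong_loc ab Zb.
exact: rpredX.
Qed.

(** If p divided the numerator of b, then 1/p = a^-1 ((a - b)/p + b/p) would be p-integral. *)
Lemma zunit_cong a b : cong 1 a b -> zunit a -> zunit b.
Proof.
move=> ab ua; have Zb : b \in Zp by apply: cong_loc (cong_sym ab) (zunit_loc ua).
case/zlocP: (Zb) => u [v [pv eb]].
have [|pu] := boolP (p%:Z %| u)%Z; last by rewrite eb; apply: zunitM (zunit_int pu) (zunitV (zunit_int pv)).
case/dvdzP => w ew; suff : (p%:R : rat)^-1 \in Zp.
  case/zlocP => x [y [py]] /eqP; rewrite -[_^-1]div1r.
  have y0 : y%:~R != 0 :> rat by exact: zunit_neq0 (zunit_int py).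
  rewrite eqr_div // mul1r -[p%:R]/(p%:Z%:~R) -intrM eqr_int => /eqP ey.
  by move: py; rewrite ey dvdz_mull.
have -> : (p%:R : rat)^-1 = a^-1 * ((a - b) / p%:R ^+ 1 + w%:~R / v%:~R).
  have v0 := zunit_neq0 (zunit_int pv).
  by rewrite eb ew intrM; field; rewrite v0 (zunit_neq0 ua) p0.
apply: rpredM; first exact: zunitV_loc.
by rewrite rpredD // zloc_div ?rpred_int // zunit_int.
Qed.

Lemma congV k a b : zunit a -> zunit b -> cong k a b -> cong k a^-1 b^-1.
Proof.
move=> ua ub ab; apply: cong_sym; rewrite /cong.
have -> : (b^-1 - a^-1) / p%:R ^+ k = (a - b) / p%:R ^+ k / a / b.
  by field; rewrite pX0 !zunit_neq0.
by apply: zloc_div => //; apply: zloc_div.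
Qed.

Lemma cong_mulI k c a b : zunit c -> cong k (c * a) (c * b) -> cong k a b.
Proof.
by move=> uc; rewrite /cong -mulrBr -mulrA => /(rpredM (zunitV_loc uc)); rewrite mulKf ?zunit_neq0.
Qed.

Lemma cong_intP k (u v : int) : reflect (cong k u%:~R v%:~R) ((p ^ k)%N%:Z %| u - v)%Z.
Proof.
apply: (iffP idP) => [/dvdzP[w e]|].
  by rewrite /cong -intrB e intrM -pmulrn natrX mulfK // rpred_int.
rewrite /cong -intrB -natrX => /zlocP[x [y [py]]] /eqP.
have y0 : y%:~R != 0 :> rat by exact: zunit_neq0 (zunit_int py).
rewrite eqr_div ?natrX // -natrX -[(p ^ k)%:R]/((p ^ k)%N%:Z%:~R) -!intrM eqr_int => /eqP e.
have : ((p ^ k)%N%:Z %| (u - v) * y)%Z by rewrite e dvdz_mull.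
rewrite Gauss_dvdzl // coprimezE /= coprimeXl // prime_coprime //.
Qed.

Lemma cong_rat_cong k a b : b \in Zp -> cong k a b -> rat_cong p k a b.
Proof.
move=> Zb ab; have Za := cong_loc ab Zb.
split=> //; have Zab : a - b \in Zp by rewrite rpredB.
rewrite -[numq _]subr0; apply/cong_intP.
by rewrite numqE -[X in cong _ _ X](mul0r (denq (a - b))%:~R) congMr ?rpred_int // /cong subr0.
Qed.

End Localization.

Section SmallUnits.
Variables (p : nat) (p_pr : prime p).
Hypothesis p_gt3 : (3 < p)%N.

Lemma natr_prime_neq0 : p%:R != 0 :> rat.
Proof. by rewrite pnatr_eq0 -lt0n prime_gt0. Qed.

Lemma zloc_nat k : k%:R \in zloc p_pr.
Proof. exact: rpred_nat. Qed.

Lemma zunit2 : zunit p_pr 2.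
Proof. by apply: (@zunit_ltp p p_pr 2); rewrite /=; lia. Qed.

Lemma zunit3 : zunit p_pr 3.
Proof. by apply: (@zunit_ltp p p_pr 3); rewrite /=; lia. Qed.

Lemma zunit4 : zunit p_pr 4.
Proof. by rewrite (_ : 4 = 2 ^+ 2); [exact: zunitX zunit2 | ring]. Qed.

Lemma zunit8 : zunit p_pr 8.
Proof. by rewrite (_ : 8 = 2 ^+ 3); [exact: zunitX zunit2 | ring]. Qed.

Lemma zunit16 : zunit p_pr 16.
Proof. by rewrite (_ : 16 = 4 ^+ 2); [exact: zunitX zunit4 | ring]. Qed.

Lemma zunit27 : zunit p_pr 27.
Proof. by rewrite (_ : 27 = 3 ^+ 3); [exact: zunitX zunit3 | ring]. Qed.
End SmallUnits.

(** * Deforming the cubic sums *)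

Section Deformation.
Variables (p : nat) (p_pr : prime p).
Local Notation Zp := (zloc p_pr).
Local Notation cong := (cong p_pr).
Local Notation zunit := (zunit p_pr).
Local Notation q := (p%:R : rat).

Let q0 : q != 0 := natr_prime_neq0 p_pr.

Lemma cong1_p2 a b : b \in Zp -> cong 1 (a - q ^+ 2 * b) a.
Proof.
move=> Zb; rewrite (_ : a - _ = a + q ^+ 1 * (- q * b)); last by ring.
by rewrite cong_add_pX // rpredM // rpredN rpred_nat.
Qed.

Lemma cong1_p2' a : cong 1 (a - q ^+ 2) a.
Proof. by rewrite -[q ^+ 2]mulr1 cong1_p2 // rpred1. Qed.

Lemma congM_p2 a b u v : a \in Zp -> v \in Zp -> cong 1 a b -> cong 1 u v ->
  cong 3 (a * (q ^+ 2 * u)) (b * (q ^+ 2 * v)).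
Proof.
move=> Za Zv ab uv; rewrite !(mulrCA _ (q ^+ 2)).
by apply: (@congMpX _ _ 1 2); apply: congM.
Qed.

Definition rprod (x y : nat -> rat) (t : rat) k : rat := \prod_(j < k) ((x j - t) / (y j - t)).

(** Moving t from 0 to p^2 changes the product by p^2 times a quantity that, modulo p, depends only
    on the [x j] modulo p. Equation [E] is the product rule for this difference quotient and drives
    the induction. *)
Lemma rprod_diff (x x' y : nat -> rat) K :
  (forall j, (j < K)%N -> [/\ x j \in Zp, x' j \in Zp, cong 1 (x j) (x' j) & zunit (y j)]) ->
  [/\ rprod x y 0 K \in Zp, rprod x' y 0 K \in Zp, cong 1 (rprod x y 0 K) (rprod x' y 0 K),
      (rprod x' y (q ^+ 2) K - rprod x' y 0 K) / q ^+ 2 \in Zp &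
      cong 1 ((rprod x y (q ^+ 2) K - rprod x y 0 K) / q ^+ 2)
             ((rprod x' y (q ^+ 2) K - rprod x' y 0 K) / q ^+ 2)].
Proof.
elim: K => [|K IHK] H.
  by rewrite /rprod !big_ord0 subrr mul0r !rpred1 rpred0; split=> //; apply: cong_refl.
have [j lt_jK|Z1 Z2 c12 Zd cd] := IHK; first by apply: H; apply: leqW.
have [Zx Zx' cx uy] := H K (leqnn _).
have uy' : zunit (y K - q ^+ 2) by apply: zunit_cong uy; apply: cong_sym; exact: cong1_p2'.
have y0 := zunit_neq0 uy; have y0' := zunit_neq0 uy'.
have Zq : q ^+ 2 \in Zp by rewrite rpredX // rpred_nat.
have E z : (rprod z y (q ^+ 2) K.+1 - rprod z y 0 K.+1) / q ^+ 2 =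
   (rprod z y (q ^+ 2) K - rprod z y 0 K) / q ^+ 2 * ((z K - q ^+ 2) / (y K - q ^+ 2)) +
   rprod z y 0 K * ((z K - y K) / (y K * (y K - q ^+ 2))).
  rewrite /rprod !big_ord_recr /= -/(rprod z y _ K) -/(rprod z y 0 K) !subr0.
  by field; rewrite q0 y0 y0'.
have E0 z : rprod z y 0 K.+1 = rprod z y 0 K * (z K / y K).
  by rewrite /rprod big_ord_recr /= !subr0.
rewrite !E !E0; have Zy := zunit_loc uy.
have uyy := zunitM uy uy'.
have cq : cong 1 (x K - q ^+ 2) (x' K - q ^+ 2) by apply: congB => //; apply: cong_refl.
have cy : cong 1 (x K - y K) (x' K - y K) by apply: congB => //; apply: cong_refl.
split.
- by rewrite rpredM // zloc_div.
- by rewrite rpredM // zloc_div.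
- by apply: congM => //; [apply: zloc_div | apply: congMr => //; apply: zunitV_loc].
- by apply: rpredD; apply: rpredM => //; apply: zloc_div => //; rewrite rpredB.
apply: congD; apply: congM => //.
- exact: cong_loc cd Zd.
- by apply: zloc_div => //; rewrite rpredB.
- by apply: congMr => //; apply: zunitV_loc.
- by apply: zloc_div => //; rewrite rpredB.
- by apply: congMr => //; apply: zunitV_loc.
Qed.

Variable n : nat.
Hypothesis pE : p = (2 * n).+1.

Let qE : q = 2 * n%:R + 1. Proof. by rewrite pE; ring. Qed.

Lemma half_p_nint j : (j%:R + 1) ^+ 2 - (q / 2) ^+ 2 != 0.
Proof.
rewrite subr_sqr mulf_neq0 //.
  rewrite (_ : _ - _ = (2 * j%:R + 1 - 2 * n%:R) / 2); last by rewrite qE; field.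
  by rewrite mulf_neq0 ?odd_neq_even.
by rewrite (_ : _ + _ = (2 * j%:R + 2 + q) / 2) ?lt0r_neq0 ?divr_gt0 //; [rewrite qE; have := ler0n rat j;
  have := ler0n rat n; lra | field].
Qed.

Lemma nint0 j : (j%:R + 1) ^+ 2 - 0 ^+ 2 != 0 :> rat.
Proof. by rewrite expr0n subr0 expf_neq0 // natr1 pnatr_eq0. Qed.

Let even_unit j : (j < n)%N -> zunit (2 * j%:R + 2).
Proof.
move=> ltjn; rewrite (_ : _ + _ = (2 * j + 2)%:R); last by ring.
by apply: zunit_ltp; rewrite pE; lia.
Qed.

Lemma cbin_loc k : (k <= n)%N -> cbin rat k \in Zp.
Proof.
move=> lekn; apply: rpred_prod => -[j ltjk] _ /=; apply: zloc_div.
  by rewrite rpredD ?rpredM ?rpred_nat ?rpred1.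
by apply: even_unit; apply: leq_trans lekn.
Qed.

Lemma cbin_cong k : (k <= n)%N -> cong 1 (cbin rat k) ((-1) ^+ k * 'C(n, k)%:R).
Proof.
elim: k => [|k IHk] lt_kn; first by rewrite /cbin big_ord0 bin0 mulr1 cong_refl.
have u := even_unit lt_kn; have k0 : (k%:R + 1 : rat) != 0 by rewrite natr1 pnatr_eq0.
have -> : (-1) ^+ k.+1 * 'C(n, k.+1)%:R =
   (-1) ^+ k * 'C(n, k)%:R * ((2 * k%:R + 1 - q ^+ 1) / (2 * k%:R + 2)) :> rat.
  by rewrite exprS natr_binS qE; field; rewrite k0 (zunit_neq0 u).
rewrite /cbin big_ord_recr /=; apply: congM.
- exact: cbin_loc (ltnW lt_kn).
- by apply: zloc_div => //; rewrite !(rpredB, rpredD, rpredM, rpredX, rpred_nat, rpred1).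
- exact: IHk (ltnW lt_kn).
apply: congMr; first exact: zunitV_loc.
by apply: cong_sym; rewrite -[q ^+ 1]mulr1 -mulrN cong_add_pX // rpredN rpred1.
Qed.

(** The quotients [x1 j / y j] multiply up to [cbin k ^+ 2], the quotients [x2 j / y j] to
    binom(n,k)^2. Since 2j + 1 = p - 2(n - j), [x1] and [x2] agree modulo p. *)
Let x1 j : rat := (2 * j%:R + 1) ^+ 2.
Let x2 j : rat := (2 * (n%:R - j%:R)) ^+ 2.
Let y j : rat := (2 * j%:R + 2) ^+ 2.

Lemma rprod_half k : (k <= n)%N ->
  [/\ rprod x1 y 0 k \in Zp, rprod x2 y 0 k \in Zp, cong 1 (rprod x1 y 0 k) (rprod x2 y 0 k),
      (rprod x2 y (q ^+ 2) k - rprod x2 y 0 k) / q ^+ 2 \in Zp &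
      cong 1 ((rprod x1 y (q ^+ 2) k - rprod x1 y 0 k) / q ^+ 2)
             ((rprod x2 y (q ^+ 2) k - rprod x2 y 0 k) / q ^+ 2)].
Proof.
move=> le_kn; apply: rprod_diff => j lt_jk.
have Z1 : x1 j \in Zp by rewrite !(rpredB, rpredD, rpredM, rpredX, rpred_nat, rpred1).
have Z2 : x2 j \in Zp by rewrite !(rpredB, rpredD, rpredM, rpredX, rpred_nat, rpred1).
split=> //; last by apply: zunitX; apply: even_unit; apply: leq_trans le_kn.
have -> : x1 j = x2 j + q ^+ 1 * (2 * (2 * j%:R + 1) - q) by rewrite /x1 /x2 qE; ring.
by rewrite cong_add_pX // !(rpredB, rpredD, rpredM, rpredX, rpred_nat, rpred1).
Qed.

Lemma wprE k : wpr q k = rprod x1 y (q ^+ 2) k. Proof. by []. Qed.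

Lemma wpr0E k : rprod x1 y 0 k = cbin rat k ^+ 2.
Proof.
rewrite /rprod /cbin -prodrXl; apply: eq_bigr => j _.
by rewrite /x1 /y !subr0 expr_div_n.
Qed.

(** The scale 4 between (j+1)^2 and (2j+2)^2 turns t = p into s = p/2. *)
Lemma wpb_halfE k : wpb n (q / 2) k = rprod x2 y (q ^+ 2) k.
Proof.
rewrite /wpb /rprod; apply: eq_bigr => j _; have h := half_p_nint j.
have h' : y j - q ^+ 2 != 0.
  by rewrite (_ : _ - _ = 4 * ((j%:R + 1) ^+ 2 - (q / 2) ^+ 2)) ?mulf_neq0 // /y; field.
by apply/eqP; rewrite eqr_div // /x2 /y; apply/eqP; field.
Qed.

Lemma wpb0E k : wpb n 0 k = rprod x2 y 0 k.
Proof.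
rewrite /wpb /rprod; apply: eq_bigr => j _; have h := nint0 j.
have h' : y j - 0 != 0.
  by rewrite (_ : _ - _ = 4 * ((j%:R + 1) ^+ 2 - 0 ^+ 2)) ?mulf_neq0 // /y; field.
by apply/eqP; rewrite eqr_div // /x2 /y; apply/eqP; field.
Qed.

(** The last congruence is the purpose: the change caused by the deformation carries the factor p^2,
    so [cbin k] may be replaced by (-1)^k binom(n,k) and [w] by [w'] although these agree only
    modulo p. *)
Lemma sum_deform (w w' : nat -> rat) :
  (forall k, (k <= n)%N -> w k \in Zp) -> (forall k, (k <= n)%N -> w' k \in Zp) ->
  (forall k, (k <= n)%N -> cong 1 (w k) (w' k)) ->
  [/\ \sum_(k < n.+1) w k * cbin rat k ^+ 3 \in Zp,
    cong 1 (\sum_(k < n.+1) w k * cbin rat k ^+ 3) (\sum_(k < n.+1) w' k * dixon_term 0 n k),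
    cong 1 (\sum_(k < n.+1) w k * cbin rat k ^+ 3) (\sum_(k < n.+1) w k * (cbin rat k * wpr q k)) &
   cong 3 (\sum_(k < n.+1) w k * (cbin rat k * wpr q k) - \sum_(k < n.+1) w k * cbin rat k ^+ 3)
     (\sum_(k < n.+1) w' k * dixon_term (q / 2) n k - \sum_(k < n.+1) w' k * dixon_term 0 n k)].
Proof.
move=> Zw Zw' cw.
have Zh k : (k <= n)%N -> (-1) ^+ k * 'C(n, k)%:R \in Zp by move=> _; rewrite rpredM ?rpredX ?rpredN ?rpred1 ?rpred_nat.
have e3 k : cbin rat k ^+ 3 = cbin rat k * rprod x1 y 0 k by rewrite wpr0E -exprS.
split.
- by apply: rpred_sum => -[k lekn] _ /=; rewrite rpredM ?rpredX ?cbin_loc ?Zw.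
- apply: cong_sum => -[k lekn] _ /=; have [Z1 Z2 c12 _ _] := rprod_half lekn.
  rewrite e3 /dixon_term wpb0E; apply: congM; [exact: Zw | | exact: cw | ].
    by rewrite rpredM // Zh.
  by apply: congM => //; [exact: cbin_loc | exact: cbin_cong].
- apply: cong_sum => -[k lekn] _ /=; have [Z1 Z2 c12 Zd cd] := rprod_half lekn.
  rewrite e3 wprE; apply: congMl; first exact: Zw.
  apply: congMl; first exact: cbin_loc.
  apply: cong_sym; rewrite -[X in cong _ X](subrK (rprod x1 y 0 k)) addrC.
  set d := _ - _; rewrite (_ : d = q ^+ 1 * (q * (d / q ^+ 2))); last by field; rewrite q0.
  by apply: cong_add_pX; rewrite rpredM ?rpred_nat //; apply: cong_loc cd Zd.
rewrite -!sumrB; apply: cong_sum => -[k lekn] _ /=; have [Z1 Z2 c12 Zd cd] := rprod_half lekn.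
rewrite e3 /dixon_term wpb0E wprE wpb_halfE -!mulrBr.
set d1 := rprod x1 _ _ _ - _ in cd *; set d2 := rprod x2 _ _ _ - _ in cd Zd *.
rewrite (_ : d1 = q ^+ 2 * (d1 / q ^+ 2)); last by field; rewrite q0.
rewrite (_ : d2 = q ^+ 2 * (d2 / q ^+ 2)); last by field; rewrite q0.
rewrite [w k * _]mulrA [w' k * _]mulrA; apply: congM_p2 => //.
  by apply: rpredM; [exact: Zw | exact: cbin_loc].
by apply: congM; [exact: Zw | exact: Zh | exact: cw | exact: cbin_cong].
Qed.

End Deformation.

(** * Vanishing of deformed Dixon sums under reversal of the index *)

Section Antisymmetry.
Variables (F : numFieldType) (s : F).
Hypothesis s_nint : forall j : nat, (j%:R + 1) ^+ 2 - s ^+ 2 != 0.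
Implicit Types n k : nat.

(** A deformed squared factorial: [wpb n s k] is gam(n) / (gam(k) gam(n-k)), which shows its
    symmetry under k -> n - k. *)
Let gam k : F := \prod_(j < k) ((j%:R + 1) ^+ 2 - s ^+ 2).

Let gam0 k : gam k != 0. Proof. by apply/prodf_neq0 => j _; apply: s_nint. Qed.

Let wpb_gam n k : (k <= n)%N -> wpb n s k * (gam (n - k) * gam k) = gam n.
Proof.
elim: k => [|k IHk] lt_kn; first by rewrite /wpb /gam !big_ord0 subn0 mul1r mulr1.
have e : gam (n - k) = gam (n - k.+1) * ((n%:R - k%:R) ^+ 2 - s ^+ 2).
  by rewrite -natrB ?(ltnW lt_kn) // -(subnSK lt_kn) /gam big_ord_recr /= natr1.
have e1 : gam k.+1 = gam k * ((k%:R + 1) ^+ 2 - s ^+ 2) by rewrite /gam big_ord_recr.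
rewrite -[RHS](IHk (ltnW lt_kn)) e e1 /wpb big_ord_recr /=.
by field; apply: s_nint.
Qed.

Lemma dixon_term_rev n k : (k <= n)%N -> dixon_term s n (n - k) = (-1) ^+ n * dixon_term s n k.
Proof.
move=> le_kn; rewrite /dixon_term bin_sub // !mulrA; congr (_ * _ * _).
  by rewrite -[in RHS](subnK le_kn) exprD -mulrA -expr2 sqrr_sign mulr1.
have := wpb_gam (leq_subr k n); rewrite -(wpb_gam le_kn) subKn // [gam k * _]mulrC.
by apply: mulIf; rewrite mulf_neq0.
Qed.

(** Valid for every admissible s, so in these cases the passage from s = 0 to s = p/2 changes
    nothing and the deformed sum gives the cubic sum modulo p^3 directly. *)
Lemma sum_dixon_term_rev n (w : nat -> F) :
  (forall k, (k <= n)%N -> w (n - k)%N * (-1) ^+ n = - w k) ->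
  \sum_(k < n.+1) w k * dixon_term s n k = 0.
Proof.
move=> Hw; apply/eqP; rewrite -[_ == 0](mulrn_eq0 _ 2) mulr2n.
rewrite {1}(reindex_inj rev_ord_inj) /= -big_split /= big1 // => -[k lekn] _ /=.
by rewrite subSS dixon_term_rev // mulrA Hw // mulNr addNr.
Qed.
End Antisymmetry.

(** * Expansion modulo p^3 of the products in the closed forms *)

Section Supercongruence.
Variables (p : nat) (p_pr : prime p).
Hypothesis p_gt3 : (3 < p)%N.
Local Notation Zp := (zloc p_pr).
Local Notation cong := (cong p_pr).
Local Notation zunit := (zunit p_pr).
Local Notation q := (p%:R : rat).

Let Zq : q \in Zp := zloc_nat p_pr p.
Let u2 : zunit 2 := zunit2 p_pr p_gt3.
Let u3 : zunit 3 := zunit3 p_pr p_gt3.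
Let u4 : zunit 4 := zunit4 p_pr p_gt3.
Let u16 : zunit 16 := zunit16 p_pr p_gt3.

Lemma prod_add1_p2 (x : nat -> rat) k : (forall j, (j < k)%N -> x j \in Zp) ->
  exists2 e, \prod_(j < k) (1 + q ^+ 2 * x j) = 1 + q ^+ 2 * e & e \in Zp /\ cong 1 e (\sum_(j < k) x j).
Proof.
elim: k => [|k IHk] Zx.
  exists 0; rewrite ?big_ord0 ?mulr0 ?addr0 //; split; [exact: rpred0 | exact: cong_refl].
have [j lt_jk|e He [Ze ce]] := IHk; first by apply: Zx; apply: leqW.
have Zk := Zx k (leqnn _).
exists (e + x k + q ^+ 1 * (q * (e * x k))).
  by rewrite big_ord_recr /= He; ring.
split; first by rewrite !(rpredD, rpredM, rpredX).
rewrite big_ord_recr /=; apply: (@cong_trans _ _ _ (e + x k)).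
  by apply: cong_add_pX; rewrite !rpredM.
by apply: congD => //; apply: cong_refl.
Qed.

Definition hsum k : rat := \sum_(j < k) (j%:R + 1) ^- 2.
Definition osum k : rat := \sum_(j < k) (2 * j%:R + 1) ^- 2.

Lemma hsum_double k : hsum (2 * k) = osum k + hsum k / 4.
Proof.
elim: k => [|k IHk]; first by rewrite /hsum /osum muln0 !big_ord0 mul0r addr0.
have h1 : (k%:R + 1 : rat) != 0 by rewrite natr1 pnatr_eq0.
have h2 : (2 * k%:R + 1 : rat) != 0 by apply: (@natrS_neq0 _ _ (2 * k)); ring.
have h3 : ((2 * k).+1%:R + 1 : rat) != 0 by rewrite natr1 pnatr_eq0.
have e3 : (2 * k).+1%:R + 1 = 2 * (k%:R + 1) :> rat by ring.
rewrite mulnS /hsum /osum !big_ord_recr /= -/(hsum (2 * k)) -/(hsum k) -/(osum k) IHk e3.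
rewrite natrM; field; rewrite h1 h2; by [].
Qed.

Variable n : nat.
Hypothesis pE : p = (2 * n).+1.
Let qE : q = 2 * n%:R + 1. Proof. by rewrite pE; ring. Qed.

Let uS j : (j.+1 < p)%N -> zunit (j%:R + 1).
Proof. by move=> ltj; rewrite natr1; apply: zunit_ltp. Qed.

Let u2S j : (2 * j + 1 < p)%N -> zunit (2 * j%:R + 1).
Proof. by move=> ltj; rewrite (_ : _ + _ = (2 * j + 1)%:R); [apply: zunit_ltp; rewrite ltj addn1 | ring]. Qed.

Lemma hsum_loc k : (k < p)%N -> hsum k \in Zp.
Proof.
move=> ltk; apply: rpred_sum => -[j ltj] _ /=; apply: zunitV_loc; apply: zunitX; apply: uS.
by apply: leq_ltn_trans ltk.
Qed.

Lemma cong_refl_inv2 a b : zunit a -> zunit b -> cong 1 a (- b) -> cong 1 (a ^- 2) (b ^- 2).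
Proof.
move=> ua ub ab; apply: congV; try exact: zunitX.
by rewrite -[b ^+ 2]sqrrN; apply: congX => //; rewrite rpredN; apply: zunit_loc.
Qed.

(** The reflection i -> p - i gives [osum n] = [hsum n] / 4 and [hsum (2 * n)] = 2 [hsum n] modulo
    p. Together with [hsum_double] this forces 3/2 [hsum n] = 0, and 3 is a unit. *)
Lemma hsum_half : cong 1 (hsum n) 0.
Proof.
have O : cong 1 (osum n) (hsum n / 4).
  rewrite /osum /hsum (reindex_inj rev_ord_inj) mulr_suml /=.
  apply: cong_sum => -[j ltj] _ /=.
  have u : zunit (2 * (j%:R + 1)) by apply: zunitM u2 _; apply: uS; rewrite pE; lia.
  rewrite (_ : _ / 4 = (2 * (j%:R + 1)) ^- 2); last first.
    by field; rewrite natr1 pnatr_eq0.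
  apply: cong_refl_inv2 => //; first by apply: u2S; rewrite pE; lia.
  rewrite (_ : 2 * _ + 1 = - (2 * (j%:R + 1)) + q ^+ 1 * 1); first by rewrite cong_add_pX ?rpred1.
  by rewrite natrB // qE; ring.
have H2 : cong 1 (hsum (2 * n)) (hsum n + hsum n).
  rewrite {1}/hsum mul2n -addnn big_split_ord /=; apply: congD; first exact: cong_refl.
  rewrite /hsum (reindex_inj rev_ord_inj) /=.
  apply: cong_sum => -[j ltj] _ /=.
  have u : zunit (j%:R + 1) by apply: uS; rewrite pE; lia.
  apply: cong_refl_inv2 => //; first by apply: uS; rewrite pE; lia.
  rewrite (_ : _ + 1 = - (j%:R + 1) + q ^+ 1 * 1); first by rewrite cong_add_pX ?rpred1.
  by rewrite natrD natrB // qE; ring.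
apply: (@cong_mulI _ _ _ (3 / 2)); first by apply: zunitM u3 (zunitV u2).
have c : cong 1 (hsum n + hsum n) (hsum n / 4 + hsum n / 4).
  apply: cong_trans (cong_sym H2) _; rewrite hsum_double.
  by apply: congD => //; apply: cong_refl.
have -> : 3 / 2 * hsum n = hsum n + hsum n - (hsum n / 4 + hsum n / 4) by field.
by rewrite mulr0 -(subrr (hsum n / 4 + hsum n / 4)); apply: congB => //; apply: cong_refl.
Qed.

Variable m : nat.
Hypothesis le_m : (2 * m <= n)%N.
Local Notation H := (hsum m).

Let ltmp : (m < p)%N. Proof. by rewrite pE; lia. Qed.
Let ZH : H \in Zp. Proof. exact: hsum_loc. Qed.

(** Here [S] is a cubic sum, [D] its deformation, [Ah] and [A0] are Dixon's sum at s = p/2 and s =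
    0. The quotient A0 / Ah is the product of 1 - p^2 / (4 (j+1)^2), that is 1 - p^2 H / 4 modulo
    p^3. Hence D - S = A0 p^2 H / 4, where [A0] may be replaced by [D] because they agree modulo
    p. *)
Lemma deform_factor (kap S D Ah A0 : rat) :
  cong 1 S A0 -> cong 1 S D -> A0 \in Zp -> D \in Zp -> cong 3 (D - S) (Ah - A0) ->
  Ah = kap / \prod_(j < m) ((j%:R + 1) ^+ 2 - (q / 2) ^+ 2) ->
  A0 = kap / \prod_(j < m) ((j%:R + 1) ^+ 2 - 0 ^+ 2) ->
  cong 3 S (D * (1 - q ^+ 2 / 4 * H)).
Proof.
move=> cSA cSD ZA ZD cDS EAh EA0.
have ZS := cong_loc cSA ZA.
have Zx j : (j < m)%N -> - ((j%:R + 1) ^- 2 / 4) \in Zp.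
  move=> ltj; rewrite rpredN; apply: zloc_div u4; apply/zunitV_loc/zunitX/uS.
  by apply: leq_ltn_trans ltmp.
have [e He [Ze ce]] := prod_add1_p2 Zx.
have ue : zunit (1 + q ^+ 2 * e).
  apply: zunit_cong (zunit1 _); apply: cong_sym.
  by rewrite -[q ^+ 2 * e]opprK -mulrN cong1_p2 // rpredN.
have {Ah EAh cDS} cDS : cong 3 (D - S) (A0 * (q ^+ 2 * (- e / (1 + q ^+ 2 * e)))).
  suff -> : A0 * (q ^+ 2 * (- e / (1 + q ^+ 2 * e))) = Ah - A0 by [].
  have -> : Ah = A0 / (1 + q ^+ 2 * e).
    rewrite EAh EA0 -He -mulrA -invfM -big_split /=; congr (_ / _).
    apply: eq_bigr => j _; rewrite expr0n subr0; field.
    by rewrite natr1 pnatr_eq0.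
  by field; exact: zunit_neq0 ue.
have cH : cong 1 (- e / (1 + q ^+ 2 * e)) (H / 4).
  apply: (@cong_trans _ _ _ (- e)).
    rewrite -[X in cong _ _ X]divr1; apply: congMl; first by rewrite rpredN.
    apply: congV => //; first exact: zunit1.
    by rewrite -[q ^+ 2 * e]opprK -mulrN cong1_p2 // rpredN.
  rewrite [H / 4](_ : _ = - \sum_(j < m) - ((j%:R + 1) ^- 2 / 4)); first exact: congN.
  by rewrite sumrN opprK /hsum mulr_suml.
have cD : cong 3 (D - S) (D * (q ^+ 2 * (H / 4))).
  apply: cong_trans cDS _; apply: congM_p2 => //; first by rewrite zloc_div.
  exact: cong_trans (cong_sym cSA) cSD.
rewrite -[S](subKr D) [D * _](_ : _ = D - D * (q ^+ 2 * (H / 4))); last by field.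
by apply: congB => //; apply: cong_refl.
Qed.

(** This is [wpr (q / 2) m] with all numerators and denominators multiplied by 4. *)
Definition qprod : rat := \prod_(j < m) ((4 * (2 * j%:R + 1) ^+ 2 - q ^+ 2) / (16 * (j%:R + 1) ^+ 2 - q ^+ 2)).

Lemma qprod_expand : cong 3 qprod (cbin rat m ^+ 2 * (1 + q ^+ 2 * (H / 16 - osum m / 4))).
Proof.
pose u (j : nat) : rat := (2 * j%:R + 1) ^+ 2; pose v (j : nat) : rat := (j%:R + 1) ^+ 2.
(* Chosen so that the j-th factor of [qprod] is the squared j-th factor of [cbin] times 1 + p^2
   [x j]; modulo p, [x j] is 1/(16 v) - 1/(4 u). *)
pose x j := (u j - v j *+ 4) / (u j * (16 * v j - q ^+ 2)).
have uu j : (j < m)%N -> zunit (u j) by move=> ltj; apply/zunitX/u2S; rewrite pE; lia.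
have uv j : (j < m)%N -> zunit (v j) by move=> ltj; apply/zunitX/uS; rewrite pE; lia.
have cy j : cong 1 (16 * v j - q ^+ 2) (16 * v j) by apply: cong1_p2'.
have uy j : (j < m)%N -> zunit (16 * v j - q ^+ 2).
  by move=> ltj; apply: zunit_cong (cong_sym (cy j)) _; apply: zunitM u16 (uv _ ltj).
have Zx j : (j < m)%N -> x j \in Zp.
  move=> ltj; apply: zloc_div; last by apply: zunitM; [exact: uu | exact: uy].
  by rewrite rpredB ?rpredMn // zunit_loc ?uu ?uv.
have [e He [Ze ce]] := prod_add1_p2 Zx.
have -> : qprod = cbin rat m ^+ 2 * (1 + q ^+ 2 * e).
  rewrite -He /qprod /cbin -prodrXl -big_split /=; apply: eq_bigr => -[j ltj] _ /=.
  have := zunit_neq0 (uu j ltj); have := zunit_neq0 (uv j ltj); have := zunit_neq0 (uy j ltj).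
  rewrite /x /u /v => y0 v0 u0.
  have v0' : j%:R + 1 != 0 :> rat by move: v0; rewrite expf_eq0.
  have u0' : 2 * j%:R + 1 != 0 :> rat by move: u0; rewrite expf_eq0.
  field; rewrite u0' y0 /=.
  by apply: contraNneq v0' => e0; apply/eqP; lra.
apply: congMl; first by rewrite rpredX // (cbin_loc _ pE) //; lia.
apply: congD; first exact: cong_refl.
apply: (@congMpX _ _ 1 2); apply: (cong_trans ce).
rewrite /hsum /osum !mulr_suml -sumrB; apply: cong_sum => -[j ltj] _ /=.
rewrite -/(u j) -/(v j).
have u0 := zunit_neq0 (uu j ltj); have v0 := zunit_neq0 (uv j ltj).
rewrite [_ - _](_ : _ = (u j - v j *+ 4) / (u j * (16 * v j))); last by field; rewrite u0 v0.
apply: congMl; first by rewrite rpredB ?rpredMn // zunit_loc ?uu ?uv.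
apply: congV.
- by apply: zunitM; [exact: uu | exact: uy].
- by apply: zunitM; [exact: uu | exact: zunitM u16 (uv _ ltj)].
by apply: congMl => //; apply: zunit_loc; exact: uu.
Qed.

End Supercongruence.

(** * The closed forms of the deformed sums written as [qprod] *)

Lemma prod_shift4 (m : nat) :
  (4 * m%:R + 1) * \prod_(j < m) ((4 * j%:R + 3) / (4 * j%:R + 5)) =
  \prod_(j < m) ((4 * j%:R + 3) / (4 * j%:R + 1)) :> rat.
Proof.
elim: m => [|m IHm]; first by rewrite !big_ord0; ring.
have h1 : (4 * m%:R + 1 : rat) != 0 by apply: (@natrS_neq0 _ _ (4 * m)); ring.
have h5 : (4 * m%:R + 5 : rat) != 0 by apply: (@natrS_neq0 _ _ (4 * m + 4)); ring.
by rewrite !big_ord_recr /= -IHm -(natr1 m); field; rewrite h1 h5.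
Qed.

Lemma prod_shift4' (m : nat) :
  (4 * m%:R + 3) * \prod_(j < m.+1) ((4 * (m%:R + j%:R) + 5) / (4 * (m%:R + j%:R) + 3)) =
  (8 * m%:R + 5) * \prod_(j < m) ((4 * (m%:R + j%:R) + 5) / (4 * (m%:R + j%:R) + 7)) :> rat.
Proof.
have h c k : (4 * (m%:R + c%:R) + k.+1%:R : rat) != 0 by apply: (@natrS_neq0 _ _ (4 * (m + c) + k)); ring.
suff E k : (4 * m%:R + 3) * \prod_(j < k.+1) ((4 * (m%:R + j%:R) + 5) / (4 * (m%:R + j%:R) + 3)) =
  (4 * (m%:R + k%:R) + 5) * \prod_(j < k) ((4 * (m%:R + j%:R) + 5) / (4 * (m%:R + j%:R) + 7)) :> rat.
  by rewrite E; congr (_ * _); ring.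
elim: k => [|k IHk].
  by rewrite big_ord1 big_ord0 /=; field; have := h 0 2; rewrite addr0.
rewrite big_ord_recr mulrA IHk [in RHS]big_ord_recr /= -(natr1 k); field.
have := h k 6; have := h k.+1 2; rewrite -(natr1 k) => h1 h2.
by rewrite h2 /=.
Qed.

(** The product is cut at m and its lower half reversed. After the shift [prod_shift4], the factors
    pair into p -+ 2(2j+1) over p -+ 4(j+1), whose products are the differences of squares in
    [qprod]. *)
Lemma qprod_even p m : p = (4 * m).+1 ->
  (2 * (2 * m)%:R + 1) * \prod_(j < 2 * m) ((4 * j%:R + 3) / (4 * j%:R + 5)) = qprod p m.
Proof.
move=> pE.
transitivity (\prod_(j < m) ((4 * j%:R + 3) / (4 * j%:R + 1)) *
   \prod_(j < m) ((4 * (m%:R + j%:R) + 3) / (4 * (m%:R + j%:R) + 5)) : rat).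
  rewrite -prod_shift4 mul2n -addnn big_split_ord /= -!mulrA; congr (_ * (_ * _)).
    by rewrite natrD; ring.
  by apply: eq_bigr => j _; rewrite natrD.
rewrite (reindex_inj rev_ord_inj) -big_split /=; apply: eq_bigr => -[j ltj] _ /=.
have e : (m - j.+1)%:R = m%:R - j%:R - 1 :> rat by rewrite natrB // -natr1; ring.
rewrite e.
have h5 : (4 * (m%:R + j%:R) + 5 : rat) != 0 by apply: (@natrS_neq0 _ _ (4 * (m + j) + 4)); ring.
have h3 : 4 * (m%:R - j%:R - 1) + 1 != 0 :> rat.
  by rewrite -e; apply: (@natrS_neq0 _ _ (4 * (m - j.+1))); ring.
have -> : p%:R = 4 * m%:R + 1 :> rat by rewrite pE; ring.
rewrite mulf_div; apply/eqP; rewrite eqr_div; [by apply/eqP; ring | by apply: mulf_neq0 | ].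
rewrite (_ : _ - _ = - (4 * (m%:R - j%:R - 1) + 1) * (4 * (m%:R + j%:R) + 5)); last by ring.
by rewrite mulf_neq0 ?oppr_eq0.
Qed.

(** The same pairing for p = 4m + 3. The leading factor is p and cancels the denominator 4m + 3 at j
    = m; the numerator 8m + 5 = 2p - 1 at j = 2m stays unpaired. *)
Lemma qprod_odd p m : p = (4 * m).+3 ->
  (2 * (2 * m).+1%:R + 1) * \prod_(j < (2 * m).+1) ((4 * j%:R + 5) / (4 * j%:R + 3)) =
  (2 * p%:R - 1) * qprod p m.
Proof.
move=> pE.
have Ep : p%:R = 4 * m%:R + 3 :> rat by rewrite pE; ring.
transitivity ((8 * m%:R + 5) * (\prod_(j < m) ((4 * j%:R + 5) / (4 * j%:R + 3)) *
   \prod_(j < m) ((4 * (m%:R + j%:R) + 5) / (4 * (m%:R + j%:R) + 7))) : rat).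
  rewrite mulrCA -prod_shift4' mul2n -addnn -addnS big_split_ord /= mulrCA.
  congr (_ * (_ * _)); first by ring.
  by apply: eq_bigr => j _; rewrite natrD.
congr (_ * _); first by rewrite Ep; ring.
rewrite (reindex_inj rev_ord_inj) -big_split /=; apply: eq_bigr => -[j ltj] _ /=.
have e : (m - j.+1)%:R = m%:R - j%:R - 1 :> rat by rewrite natrB // -natr1; ring.
rewrite e.
have h5 : (4 * (m%:R + j%:R) + 7 : rat) != 0 by apply: (@natrS_neq0 _ _ (4 * (m + j) + 6)); ring.
have h3 : 4 * (m%:R - j%:R - 1) + 3 != 0 :> rat.
  by rewrite -e; apply: (@natrS_neq0 _ _ (4 * (m - j.+1) + 2)); ring.
rewrite Ep mulf_div; apply/eqP; rewrite eqr_div; [by apply/eqP; ring | by apply: mulf_neq0 | ].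
rewrite (_ : _ - _ = - (4 * (m%:R - j%:R - 1) + 3) * (4 * (m%:R + j%:R) + 7)); last by ring.
by rewrite mulf_neq0 ?oppr_eq0.
Qed.

Lemma prod_dual n :
  \prod_(j < n) ((4 * j%:R + 3) / (4 * j%:R + 5)) * \prod_(j < n) ((4 * j%:R + 5) / (4 * j%:R + 3)) = 1 :> rat.
Proof.
rewrite -big_split /= big1 // => j _.
have h5 : (4 * j%:R + 5 : rat) != 0 by apply: (@natrS_neq0 _ _ (4 * j + 4)); ring.
have h3 : (4 * j%:R + 3 : rat) != 0 by apply: (@natrS_neq0 _ _ (4 * j + 2)); ring.
by field; rewrite h3 h5.
Qed.

(** * The sums S0 and S1 modulo p^3 *)

Section Values.
Variables (p : nat) (p_pr : prime p).
Hypothesis p_gt3 : (3 < p)%N.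
Local Notation Zp := (zloc p_pr).
Local Notation cong := (cong p_pr).
Local Notation zunit := (zunit p_pr).
Local Notation q := (p%:R : rat).

Let q0 : q != 0 := natr_prime_neq0 p_pr.
Let Zq : q \in Zp := zloc_nat p_pr p.

Definition cubesum n : rat := \sum_(k < n.+1) cbin rat k ^+ 3.
Definition wcubesum n : rat := \sum_(k < n.+1) (4 * k%:R + 1) * cbin rat k ^+ 3.

Section Half.
Variable n : nat.
Hypothesis pE : p = (2 * n).+1.
Let qE : q = 2 * n%:R + 1. Proof. by rewrite pE; ring. Qed.

Lemma cubesum_deform :
  [/\ cubesum n \in Zp, cong 1 (cubesum n) (\sum_(k < n.+1) dixon_term 0 n k),
    cong 1 (cubesum n) (\sum_(k < n.+1) cbin rat k * wpr q k) &
   cong 3 (\sum_(k < n.+1) cbin rat k * wpr q k - cubesum n)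
     (\sum_(k < n.+1) dixon_term (q / 2) n k - \sum_(k < n.+1) dixon_term 0 n k)].
Proof.
have := @sum_deform _ p_pr _ pE (fun=> 1) (fun=> 1) (fun _ _ => rpred1 _) (fun _ _ => rpred1 _) (fun _ _ => cong_refl _ _ _).
have e (f : nat -> rat) : \sum_(k < n.+1) 1 * f k = \sum_(k < n.+1) f k.
  by apply: eq_bigr => k _; rewrite mul1r.
by rewrite !(e (fun k => cbin rat k ^+ 3)) !(e (dixon_term _ n)) (e (fun k => cbin rat k * wpr q k)).
Qed.

(** Modulo p = 2n + 1 the weight 4k + 1 is -2(n - 2k), which is odd under k -> n - k. *)
Lemma wcubesum_deform :
  [/\ wcubesum n \in Zp, cong 1 (wcubesum n) (-2 * \sum_(k < n.+1) (n%:R - 2 * k%:R) * dixon_term 0 n k),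
    cong 1 (wcubesum n) (\sum_(k < n.+1) (4 * k%:R + 1) * (cbin rat k * wpr q k)) &
   cong 3 (\sum_(k < n.+1) (4 * k%:R + 1) * (cbin rat k * wpr q k) - wcubesum n)
     (-2 * \sum_(k < n.+1) (n%:R - 2 * k%:R) * dixon_term (q / 2) n k
      - (-2 * \sum_(k < n.+1) (n%:R - 2 * k%:R) * dixon_term 0 n k))].
Proof.
have e s : -2 * \sum_(k < n.+1) (n%:R - 2 * k%:R) * dixon_term s n k =
   \sum_(k < n.+1) (-2 * (n%:R - 2 * k%:R)) * dixon_term s n k.
  by rewrite mulr_sumr; apply: eq_bigr => k _; rewrite mulrA.
rewrite !e; apply: (@sum_deform _ p_pr _ pE (fun k => 4 * k%:R + 1) (fun k => -2 * (n%:R - 2 * k%:R))).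
- by move=> k _; rewrite rpredD ?rpredM ?rpred_nat ?rpred1.
- by move=> k _; rewrite !(rpredM, rpredB, rpredN, rpred_nat).
move=> k _; rewrite (_ : 4 * k%:R + 1 = -2 * (n%:R - 2 * k%:R) + q ^+ 1 * 1).
  by rewrite cong_add_pX ?rpred1.
by rewrite qE; ring.
Qed.
End Half.

(** For even n the Dixon sum with the odd weight vanishes by reversal, so only [cubesum] receives
    the correction by H. By [prod_dual] the two closed forms are p times reciprocal products, whence
    p^2 / [qprod]. *)
Lemma value_even m : p = (4 * m).+1 ->
  [/\ cong 1 (cubesum (2 * m)) (qprod p m),
    cong 3 (cubesum (2 * m)) (qprod p m * (1 - q ^+ 2 / 4 * hsum m)) &
    cong 3 (wcubesum (2 * m)) (q ^+ 2 / qprod p m)].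
Proof.
move=> pE; have pE' : p = (2 * (2 * m)).+1 by rewrite pE; lia.
have qE : q = 2 * (2 * m)%:R + 1 by rewrite pE'; ring.
have ni := half_p_nint pE'.
have [Z c1 c2 c3] := cubesum_deform pE'.
have ED : \sum_(k < (2 * m).+1) cbin rat k * wpr q k = qprod p m by rewrite qE sum_wp0 (qprod_even pE).
rewrite ED in c2 c3; split; first exact: c2.
  apply: (deform_factor p_gt3 pE' (leqnn _) c1 c2 _ _ c3).
  - exact: cong_loc (cong_sym c1) Z.
  - exact: cong_loc (cong_sym c2) Z.
  - exact: sum_dixon_term_even ni m.
  - exact: sum_dixon_term_even (@nint0) m.
have {Z c1 c2 c3}[Z c1 c2 c3] := wcubesum_deform pE'.
have z s : (forall j : nat, (j%:R + 1) ^+ 2 - s ^+ 2 != 0) -> \sum_(k < (2 * m).+1) ((2 * m)%:R - 2 * k%:R)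
  * dixon_term s (2 * m) k = 0 :> rat.
  move=> hs; apply: (@sum_dixon_term_rev _ _ hs _ (fun k => (2 * m)%:R - 2 * k%:R)) => k lek.
  by rewrite natrB // mulnC exprM sqrr_sign; ring.
rewrite z // z in c3; last exact: nint0.
move: c3; rewrite mulr0 subrr.
have -> : \sum_(k < (2 * m).+1) (4 * k%:R + 1) * (cbin rat k * wpr q k) = q ^+ 2 / qprod p m.
  rewrite {1}qE sum_wp1 -(qprod_even pE) -qE.
  have xy := prod_dual (2 * m); move: xy q0.
  set x := \prod_(j < _) _; set y := \prod_(j < _) _ => xy z0.
  have x0 : x != 0 by apply: contra_eq_neq xy => ->; rewrite mul0r eq_sym oner_neq0.
  have -> : y = x^-1 by rewrite -[y]mul1r -(mulVf x0) -mulrA xy mulr1.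
  by field; rewrite x0.
move=> c3; rewrite -[wcubesum _](subKr (q ^+ 2 / qprod p m)) -[X in cong _ _ X]subr0.
by apply: congB => //; apply: cong_refl.
Qed.

(** For odd n the roles are exchanged: the unweighted Dixon sum vanishes by reversal, and the
    correction falls on [wcubesum]. *)
Lemma value_odd m : p = (4 * m).+3 ->
  cong 3 (cubesum (2 * m).+1) (q ^+ 2 / ((2 * q - 1) * qprod p m)) /\ cong 3 (wcubesum (2 * m).+1) ((2 * q
    - 1) * qprod p m * (1 - q ^+ 2 / 4 * hsum m)).
Proof.
move=> pE; have pE' : p = (2 * (2 * m).+1).+1 by rewrite pE; lia.
have qE : q = 2 * (2 * m).+1%:R + 1 by rewrite pE'; ring.
have ni := half_p_nint pE'.
split.
  have [Z c1 c2 c3] := cubesum_deform pE'.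
  have z s : (forall j : nat, (j%:R + 1) ^+ 2 - s ^+ 2 != 0) -> \sum_(k < (2 * m).+2) dixon_term s (2
    * m).+1 k = 0 :> rat.
    move=> hs; under eq_bigr do rewrite -[dixon_term _ _ _]mul1r.
    apply: (@sum_dixon_term_rev _ _ hs _ (fun k => 1)) => k lek.
    by rewrite mul1r exprS mulnC exprM sqrr_sign mulr1.
  rewrite z // z in c3; last exact: nint0.
  move: c3; rewrite subrr.
  have -> : \sum_(k < (2 * m).+2) cbin rat k * wpr q k = q ^+ 2 / ((2 * q - 1) * qprod p m).
    rewrite -(qprod_odd pE) -qE {1}qE sum_wp0 -qE.
    have xy := prod_dual (2 * m).+1; move: xy q0.
    set x := \prod_(j < _) _; set y := \prod_(j < _) _ => xy z0.
    have y0 : y != 0 by apply: contra_eq_neq xy => ->; rewrite mulr0 eq_sym oner_neq0.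
    have -> : x = y^-1 by rewrite -[x]mulr1 -(mulfV y0) mulrA xy mul1r.
    by field; rewrite y0.
  move=> c3; rewrite -[cubesum _](subKr (q ^+ 2 / ((2 * q - 1) * qprod p m))) -[X in cong _ _ X]subr0.
  by apply: congB => //; apply: cong_refl.
have [Z c1 c2 c3] := wcubesum_deform pE'.
have ED : \sum_(k < (2 * m).+2) (4 * k%:R + 1) * (cbin rat k * wpr q k) = (2 * q - 1) * qprod p m.
  by rewrite [in LHS]qE sum_wp1 (qprod_odd pE).
rewrite ED in c2 c3.
apply: (deform_factor p_gt3 pE' (leqnSn _) c1 c2 _ _ c3).
- exact: cong_loc (cong_sym c1) Z.
- exact: cong_loc (cong_sym c2) Z.
- by rewrite (sum_dixon_term_odd ni m) mulrA.
- by rewrite (sum_dixon_term_odd (@nint0) m) mulrA.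
Qed.
End Values.

(** * The case p = 3 mod 4 *)

Lemma mul_bin_odd_mid k : (k.+1 * 'C((2 * k).+1, k) = (2 * k).+1 * 'C(2 * k, k))%N.
Proof. by rewrite (mul_bin_down (2 * k).+1); congr (_ * _)%N; lia. Qed.

Lemma cbinE k : cbin rat k = 'C(2 * k, k)%:R / 4 ^+ k.
Proof.
elim: k => [|k IHk]; first by rewrite /cbin big_ord0 bin0 divr1.
have h : (k%:R + 1 : rat) != 0 by rewrite natr1 pnatr_eq0.
have h2 : (2 * k%:R + 2 : rat) != 0 by apply: (@natrS_neq0 _ _ (2 * k).+1); ring.
rewrite /cbin big_ord_recr /= -/(cbin rat k) IHk.
have e : 'C(2 * k.+1, k.+1)%:R = 'C(2 * k, k)%:R * (2 * (2 * k%:R + 1)) / (k%:R + 1) :> rat.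
  have e2 : (k.+1 * 'C(2 * k.+1, k.+1) = (2 * (2 * k).+1) * 'C(2 * k, k))%N.
    by rewrite mulnS -(mul_bin_diag (2 * k).+2) /= -mulnA -mul_bin_odd_mid mulnA; congr (_ * _)%N; lia.
  apply: (canRL (mulfK h)).
  transitivity ((k.+1 * 'C(2 * k.+1, k.+1))%:R : rat); first by rewrite natrM -natr1 mulrC.
  by rewrite e2; ring.
by rewrite e exprS; field; rewrite h h2 expf_neq0.
Qed.

(** The right side is a Gosper antidifference. Since 36k + 22 = 9(4k + 1) + 13, the subtracted part
    is 9 S1 + 13 S0. At M = n + 1 the right side is divisible by p^3, because [cbin] at n + 1
    contains the factor 2n + 1 = p. *)
Lemma telescope_cube M :
  \sum_(k < M) (27 / (k%:R + 2) - (36 * k%:R + 22)) * cbin rat k ^+ 3 =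
  - (8 * M%:R ^+ 3 / (M%:R + 1) + 64 * M%:R ^+ 2) * cbin rat M ^+ 3.
Proof.
elim: M => [|M IHM]; first by rewrite big_ord0; ring.
have h : (M%:R + 1 : rat) != 0 by rewrite natr1 pnatr_eq0.
have h2 : (M%:R + 2 : rat) != 0 by apply: (@natrS_neq0 _ _ M.+1); ring.
have h3 : (2 * M%:R + 2 : rat) != 0 by apply: (@natrS_neq0 _ _ (2 * M).+1); ring.
rewrite big_ord_recr /= IHM /cbin big_ord_recr /= -/(cbin rat M) -(natr1 M).
by field; rewrite h h3 !natr1 pnatr_eq0.
Qed.

(* [eulerp l x] is [2 ^ (2 l) E_(2 l) ((x + 1) / 2)], with [E_(2 l)] the Euler polynomial. *)
Definition eulerp l (x : rat) : rat :=
  \sum_(k < l.+1) 'C(2 * l, 2 * k)%:R * (euler_number (2 * k))%:~R * x ^+ (2 * (l - k)).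

Lemma sum_euler_number i : \sum_(k < i.+1) 'C(2 * i, 2 * k)%:R * (euler_number (2 * k))%:~R = (i == 0%N)%:R :> rat.
Proof.
case: i => [|i]; first by rewrite big_ord1 muln0 bin0 euler_number0 mulr1.
rewrite (reindex_inj rev_ord_inj) /= big_ord_recl /= subn1 /= binn mul1r.
rewrite euler_number_even // big_add1 big_mkord rmorphN rmorph_sum /= addrC.
apply/eqP; rewrite subr_eq0; apply/eqP/eq_bigr => -[k ltk] _ /=.
rewrite /bump leq0n add1n subSS rmorphM /= -mulnBr subSS.
congr (_ * _); rewrite -pmulrn; congr (_%:R).
by rewrite -[RHS]bin_sub; [congr 'C(_, _) |]; lia.
Qed.

Lemma sum_ord_even (V : nmodType) (g : nat -> V) N : (forall i, odd i -> g i = 0) ->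
  \sum_(i < (2 * N).+1) g i = \sum_(j < N.+1) g (2 * j)%N.
Proof.
move=> g0; elim: N => [|N IHN]; first by rewrite !big_ord1.
rewrite [in RHS]big_ord_recr -IHN mulnS !big_ord_recr /= (g0 (2 * N).+1) ?addr0 //.
by rewrite /= mul2n odd_double.
Qed.

Lemma exprD_sym_even N (x : rat) :
  (x + 1) ^+ (2 * N) + (x - 1) ^+ (2 * N) = 2 * \sum_(j < N.+1) 'C(2 * N, 2 * j)%:R * x ^+ (2 * (N - j)).
Proof.
rewrite !exprDn -big_split /=.
rewrite (@sum_ord_even _ (fun i => x ^+ (2 * N - i) * 1 ^+ i *+ 'C(2 * N, i) + x ^+ (2 * N - i)
  * (-1) ^+ i *+ 'C(2 * N, i))).
  rewrite mulr_sumr; apply: eq_bigr => j _.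
  by rewrite [(-1) ^+ _]exprM sqrrN !expr1n mulr1 -mulnBr -mulr_natl; ring.
by move=> i oi; rewrite expr1n -signr_odd oi mulrN1 mulr1 mulNrn subrr.
Qed.

Lemma bin_trinomial a b c : (c <= b <= a)%N -> ('C(a, b) * 'C(b, c) = 'C(a, c) * 'C(a - c, b - c))%N.
Proof.
case/andP=> le_cb le_ba; have le_ca := leq_trans le_cb le_ba.
have f0 : (0 < c`! * (b - c)`! * (a - b)`!)%N by rewrite !muln_gt0 !fact_gt0.
apply/eqP; rewrite -(eqn_pmul2r f0); apply/eqP; transitivity a`!.
  by rewrite -(bin_fact le_ba) -(bin_fact le_cb); ring.
have := bin_fact (leq_sub2r c le_ba); rewrite -(bin_fact le_ca) => <-.
rewrite (_ : a - c - (b - c) = a - b)%N; [ring | lia].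
Qed.

Lemma exprD_sym_bin l k (x : rat) : (k <= l)%N ->
  'C(2 * l, 2 * k)%:R * ((x + 1) ^+ (2 * (l - k)) + (x - 1) ^+ (2 * (l - k))) =
  2 * \sum_(i < l.+1) 'C(2 * l, 2 * i)%:R * 'C(2 * i, 2 * k)%:R * x ^+ (2 * (l - i)).
Proof.
move=> le_kl; rewrite exprD_sym_even mulrCA; congr (_ * _).
rewrite -(big_mkord xpredT (fun i => 'C(2 * l, 2 * i)%:R * 'C(2 * i, 2 * k)%:R * x ^+ (2 * (l - i)))).
rewrite (@big_cat_nat _ _ _ k) //=; last exact: leqW.
rewrite [X in _ = X + _]big_nat_cond [X in _ = X + _]big1 ?add0r; last first.
  move=> i /andP[/andP[_ lti] _]; rewrite ['C(2 * i, _)]bin_small ?mulr0 ?mul0r //.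
  by rewrite ltn_pmul2l.
rewrite -[X in index_iota X _]add0n big_addn subSn // big_mkord mulr_sumr; apply: eq_bigr => -[j ltj] _ /=.
rewrite mulrA -!natrM; congr (_%:R * _); last by congr (x ^+ (2 * _)); lia.
rewrite (bin_trinomial (a := 2 * l)); last by lia.
by congr (_ * 'C(_, _))%N; lia.
Qed.

(** In terms of Euler polynomials this is E_n(x+1) + E_n(x) = 2 x^n. After [exprD_sym_bin] and an
    exchange of sums the inner sum is the recurrence of the Euler numbers, which leaves only i =
    0. *)
Lemma eulerp_step l x : eulerp l (x + 1) + eulerp l (x - 1) = 2 * x ^+ (2 * l).
Proof.
rewrite /eulerp -big_split /=.
transitivity (2 * \sum_(i < l.+1) 'C(2 * l, 2 * i)%:R * x ^+ (2 * (l - i)) *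
   \sum_(k < l.+1) 'C(2 * i, 2 * k)%:R * (euler_number (2 * k))%:~R : rat).
  rewrite [in RHS]mulr_sumr; under [in RHS]eq_bigr do rewrite mulr_sumr mulr_sumr.
  rewrite exchange_big /=; apply: eq_bigr => -[k ltk] _ /=.
  rewrite -mulrDr -mulrA [_%:~R * _]mulrC mulrA exprD_sym_bin // mulr_sumr mulr_suml.
  by apply: eq_bigr => i _; ring.
have e (i : 'I_l.+1) : \sum_(k < l.+1) 'C(2 * i, 2 * k)%:R * (euler_number (2 * k))%:~R = (val i == 0%N)%:R :> rat.
  rewrite -sum_euler_number -!(big_mkord xpredT (fun k => 'C(2 * i, 2 * k)%:R * (euler_number (2 * k))%:~R)).
  rewrite (@big_cat_nat _ _ _ i.+1) //= [X in _ + X]big_nat_cond [X in _ + X]big1 ?addr0 //.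
  by move=> k /andP[/andP[ltik _] _]; rewrite bin_small ?mul0r // ltn_pmul2l.
under eq_bigr do rewrite e.
rewrite big_ord_recl /= big1 ?addr0; last by move=> i _; rewrite mulr0.
by rewrite muln0 bin0 subn0 mul1r mulr1.
Qed.

Lemma eulerp_alternating l N :
  \sum_(j < N) (-1) ^+ j.+1 * (2 * (2 * j.+1%:R) ^+ (2 * l)) = (-1) ^+ N * eulerp l (2 * N%:R + 1) - eulerp l 1.
Proof.
elim: N => [|N IHN]; first by rewrite big_ord0 mul1r mulr0 add0r subrr.
rewrite big_ord_recr /= IHN -eulerp_step exprS.
rewrite [2 * _ - 1](_ : _ = 2 * N%:R + 1); last by rewrite -natr1; ring.
by ring.
Qed.

Lemma eulerp1 l : (0 < l)%N -> eulerp l 1 = 0.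
Proof.
move=> l0; rewrite /eulerp; under eq_bigr do rewrite expr1n mulr1.
by rewrite sum_euler_number (gtn_eqF l0).
Qed.

(** * Reduction to S0 and S1, and the sum H modulo p for p = 3 mod 4 *)

Section Values.
Variables (p : nat) (p_pr : prime p).
Hypothesis p_gt3 : (3 < p)%N.
Local Notation Zp := (zloc p_pr).
Local Notation cong := (cong p_pr).
Local Notation zunit := (zunit p_pr).
Local Notation q := (p%:R : rat).

Let Zq : q \in Zp := zloc_nat p_pr p.
Let u2 : zunit 2 := zunit2 p_pr p_gt3.

Definition shifted_cubesum n : rat := \sum_(k < n.+1) cbin rat k ^+ 3 / (k%:R + 2).

Lemma shifted_cubesum_cong n : p = (2 * n).+1 -> cong 3 (27 * shifted_cubesum n) (13 * cubesum n + 9 * wcubesum n).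
Proof.
move=> pE.
have qE : q = 2 * n%:R + 1 by rewrite pE; ring.
have u1 : zunit (n%:R + 1) by rewrite natr1; apply: zunit_ltp; lia.
have un2 : zunit (n%:R + 2).
  by rewrite (_ : _ + _ = (n + 2)%:R); [apply: zunit_ltp; lia | ring].
have -> : 27 * shifted_cubesum n = 13 * cubesum n + 9 * wcubesum n + q ^+ 3 * (- ((n%:R + 2)^-1 + 8 / (n%:R
  + 1)) * cbin rat n ^+ 3).
  apply/eqP; rewrite -subr_eq0 opprD addrA subr_eq0; apply/eqP.
  have <- : \sum_(k < n.+1) (27 / (k%:R + 2) - (36 * k%:R + 22)) * cbin rat k ^+ 3 = 27 * shifted_cubesum n
    - (13 * cubesum n + 9 * wcubesum n).
    rewrite /shifted_cubesum /cubesum /wcubesum !mulr_sumr -big_split -sumrB /=; apply: eq_bigr => k _; ring.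
  rewrite telescope_cube /cbin big_ord_recr /= -/(cbin rat n) -(natr1 n) qE.
  have h3 : (2 * n%:R + 2 : rat) != 0 by apply: (@natrS_neq0 _ _ (2 * n).+1); ring.
  by field; rewrite -?addrA (zunit_neq0 u1) (zunit_neq0 un2) h3.
apply: cong_add_pX; apply: rpredM; last by rewrite rpredX // (cbin_loc _ pE).
by rewrite rpredN rpredD ?zunitV_loc // zloc_div // rpred_nat.
Qed.

Lemma fermat_cong a : zunit a%:R -> cong 1 (a%:R ^+ p.-1) 1.
Proof.
move=> ua; apply: (@cong_mulI _ _ _ a%:R) => //; rewrite -exprS prednK ?prime_gt0 //.
rewrite mulr1 -natrX; apply/(@cong_intP p p_pr 1 (a ^ p)%N a); rewrite expn1.
by rewrite -eqz_mod_dvd !modz_nat fermat_little.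
Qed.

Lemma eulerp_p l : cong 1 (eulerp l q) (euler_number (2 * l))%:~R.
Proof.
rewrite /eulerp big_ord_recr /= subnn muln0 expr0 mulr1 binn mul1r -[X in cong _ _ X]add0r.
apply: congD; last exact: cong_refl.
rewrite [X in cong _ _ X](_ : 0 = \sum_(k < l) 0); last by rewrite big1.
apply: cong_sum => -[k ltk] _ /=.
have -> : (2 * (l - k) = 1 + (2 * (l - k)).-1)%N by lia.
rewrite exprD mulrCA; apply: cong_pX.
by rewrite rpredM ?rpredX // rpredM ?rpred_nat ?rpred_int.
Qed.

(** With 2l = p - 3, Fermat turns a^-2 into a^(2l). The alternating sum of 2 / (2j)^2 over j <=
    (p-1)/2 then telescopes, up to the point x = 2(l+1) + 1 = p, where [eulerp] is E_(p-3) modulo p.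
    Separating even and odd indices gives [hsum m] = 2A + 2 [hsum l.+1], and the last sum is 0
    modulo p. *)
Lemma hsum_euler m : p = (4 * m).+3 -> cong 1 (hsum m) (- 4 * (euler_number (p - 3))%:~R).
Proof.
move=> pE; have pE' : p = (2 * (2 * m).+1).+1 by rewrite pE; lia.
have m0 : (0 < 2 * m)%N by case: m pE {pE'} p_gt3 => [-> //|m] _ _; lia.
have {1}-> : (p - 3 = 2 * (2 * m))%N by rewrite pE; lia.
set l := (2 * m)%N in m0 pE' *; set E := (euler_number _)%:~R.
have qE : q = 2 * l.+1%:R + 1 by rewrite pE'; ring.
have uj j : (j < l.+1)%N -> zunit j.+1%:R by move=> ltj; apply: zunit_ltp; rewrite pE'; lia.
have cj a : zunit a%:R -> cong 1 (a%:R ^+ (2 * l)) (a%:R ^- 2).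
  move=> ua; apply: (@cong_mulI _ _ _ (a%:R ^+ 2)); first exact: zunitX.
  rewrite -exprD (divff (expf_neq0 _ (zunit_neq0 ua))) (_ : 2 + 2 * l = p.-1)%N; last by rewrite pE'; lia.
  exact: fermat_cong.
have sl : (-1) ^+ l = 1 :> rat by rewrite /l exprM sqrrN !expr1n.
pose A : rat := \sum_(j < l.+1) (-1) ^+ j.+1 * j.+1%:R ^- 2.
have cA : cong 1 (A / 2) (- E).
  have := eulerp_alternating l l.+1; rewrite -qE eulerp1 // subr0.
  rewrite [(-1) ^+ l.+1]exprS sl mulr1 mulN1r => eA.
  apply: (@cong_trans _ _ _ (- eulerp l q)); last by apply: congN; apply: eulerp_p.
  rewrite -eA /A mulr_suml; apply: cong_sym; apply: cong_sum => -[j ltj] _ /=.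
  rewrite -mulrA; apply: congMl; first by rewrite rpredX // rpredN rpred1.
  have u := uj j ltj; have uu := zunitM u2 u.
  rewrite (_ : _ / 2 = 2 * (2 * j.+1%:R) ^- 2); last by field; rewrite nat1r pnatr_eq0.
  by apply: congMl; rewrite ?rpred_nat // -natrM; apply: cj; rewrite natrM.
have EA k : \sum_(j < (2 * k)) (-1) ^+ j.+1 * j.+1%:R ^- 2 = hsum k / 4 - osum k :> rat.
  elim: k => [|k IHk]; first by rewrite muln0 /hsum /osum !big_ord0 mul0r subrr.
  rewrite mulnS !big_ord_recr /= IHk /hsum /osum !big_ord_recr /= -/(hsum k) -/(osum k).
  have h1 : (k%:R + 1 : rat) != 0 by rewrite natr1 pnatr_eq0.
  have h2 : (2 * k%:R + 1 : rat) != 0 by apply: (@natrS_neq0 _ _ (2 * k)); ring.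
  have -> : (2 * k).+1%:R = 2 * k%:R + 1 :> rat by ring.
  have -> : (2 * k).+2%:R = 2 * (k%:R + 1) :> rat by ring.
  have sk : (-1) ^+ (2 * k) = 1 :> rat by rewrite exprM sqrrN !expr1n.
  by rewrite (exprS (-1) (2 * k).+1) (exprS (-1) (2 * k)) sk; field; rewrite h1 h2.
have cH := hsum_half p_pr p_gt3 pE'.
have eH : hsum l.+1 = hsum l + l.+1%:R ^- 2 by rewrite /hsum big_ord_recr /= natr1.
have eA : A = hsum m / 4 - osum m - l.+1%:R ^- 2.
  by rewrite /A big_ord_recr /= EA [(-1) ^+ l.+1]exprS sl mulr1 mulN1r.
have e : hsum m = 4 * (A / 2) + 2 * hsum l.+1.
  by rewrite eA eH hsum_double; move: (l.+1%:R ^- 2) => a; field.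
rewrite e -[X in cong _ _ X]addr0; apply: congD.
  by rewrite mulNr -mulrN; apply: congMl; rewrite ?rpred_nat.
by rewrite -[X in cong _ _ X](mulr0 2); apply: congMl; rewrite ?rpred_nat.
Qed.
End Values.

Section OddCase.
Variables (p : nat) (p_pr : prime p).
Hypothesis p_gt3 : (3 < p)%N.
Local Notation Zp := (zloc p_pr).
Local Notation cong := (cong p_pr).
Local Notation zunit := (zunit p_pr).
Local Notation q := (p%:R : rat).

Let q0 : q != 0 := natr_prime_neq0 p_pr.
Let Zq : q \in Zp := zloc_nat p_pr p.
Let u2 : zunit 2 := zunit2 p_pr p_gt3.
Let u3 : zunit 3 := zunit3 p_pr p_gt3.
Let u4 : zunit 4 := zunit4 p_pr p_gt3.
Let u16 : zunit 16 := zunit16 p_pr p_gt3.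

Lemma zunit_fact k : (k < p)%N -> zunit k`!%:R.
Proof.
elim: k => [|k IHk] ltk; first exact: zunit1.
by rewrite factS natrM; apply: zunitM; [exact: zunit_ltp | exact/IHk/ltnW].
Qed.

Lemma zunit_bin n k : (k <= n)%N -> (n < p)%N -> zunit 'C(n, k)%:R.
Proof.
move=> le_kn lt_np.
have u1 := zunit_fact (leq_ltn_trans le_kn lt_np).
have u := zunit_fact (leq_ltn_trans (leq_subr k n) lt_np).
have -> : 'C(n, k)%:R = n`!%:R / (k`!%:R * (n - k)`!%:R) :> rat.
  by rewrite -(bin_fact le_kn) !natrM mulfK // (zunit_neq0 (zunitM u1 u)).
by apply: zunitM (zunit_fact lt_np) (zunitV _); apply: zunitM.
Qed.

Lemma cong_addp a b : b \in Zp -> cong 1 (a + q * b) a.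
Proof. by move=> Zb; have := @cong_add_pX p p_pr 1 a b Zb; rewrite expr1. Qed.

Lemma zunit_addp a b : zunit a -> b \in Zp -> zunit (a + q * b).
Proof. by move=> ua Zb; apply: zunit_cong ua; apply: cong_sym; apply: cong_addp. Qed.

Lemma shifted_cubesum_odd m (C : rat) : p = (4 * m).+3 -> C = 'C((2 * m).+1, m)%:R ->
  let v := - ((q + 1) ^+ 2 / (3 * 2 ^+ (p - 1))) * C ^+ 2
    - q ^+ 2 * (13 / 27 * C ^- 2 + 1 / 6 * C ^+ 2 * (euler_number (p - 3))%:~R) in
  v \in Zp /\ cong 3 (shifted_cubesum (2 * m).+1) v.
Proof.
move=> pE CE v; have pE' : p = (2 * (2 * m).+1).+1 by rewrite pE; lia.
have p1E : (p - 1 = 2 * (m * 2 + 1))%N by rewrite pE; lia.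
have lt_2m1_p : (0 < (2 * m).+1 < p)%N by rewrite pE; lia.
rewrite {}/v; set E : rat := (euler_number _)%:~R.
have ZE : E \in Zp by exact: rpred_int.
have qE : q = 4 * m%:R + 3 by rewrite pE; ring.
have uC : zunit C by rewrite CE; apply: zunit_bin; lia.
have u1 : zunit (1 - q).
  by rewrite -mulrN1; apply: zunit_addp; [exact: zunit1 | rewrite rpredN rpred1].
have u1' : zunit (2 * q - 1).
  rewrite (_ : _ - _ = - 1 + q * 2); last by ring.
  by apply: zunit_addp; [exact: zunitN (zunit1 _) | exact: rpred_nat].
have upw : zunit (2 ^+ (p - 1)) by apply: zunitX.
have [q10 q1'0 C0 pw0] : [/\ 1 - q != 0, 2 * q - 1 != 0, C != 0 & 2 ^+ (p - 1) != 0 :> rat].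
  by split; [exact: zunit_neq0 u1 | exact: zunit_neq0 u1' | exact: zunit_neq0 uC | exact: zunit_neq0 upw].
set B := C ^+ 2 * (q + 1) ^+ 2 / 2 ^+ (p - 1).
have ZC2 : C ^+ 2 \in Zp by apply/rpredX/zunit_loc.
have ZB : B \in Zp by apply: zloc_div upw; rewrite rpredM // rpredX // rpredD // rpred1.
have cB : cong 1 B (C ^+ 2).
  rewrite /B -mulrA -[X in cong _ _ X]mulr1; apply: congMl => //.
  rewrite -[X in cong _ _ X](divr1 1); apply: congM.
  - by rewrite rpredX // rpredD // rpred1.
  - by rewrite invr1 rpred1.
  - rewrite (_ : _ ^+ 2 = 1 + q * (2 + q)); last by ring.
    by apply: cong_addp; rewrite rpredD // rpred_nat.
  apply: congV => //; first exact: zunit1.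
  by rewrite subn1; apply: fermat_cong.
set cb := cbin rat m ^+ 2.
(* As p = 4m + 3, one has 4(m+1) = p + 1 and 2(2m+1) = p - 1. So binom(2m,m) = C (p+1) / (2(p-1)),
   while 4^(2m) = 2^(p-1) / 4. *)
have Ecb : cb = B / (1 - q) ^+ 2.
  have [X cbX eC] : exists2 X, cbin rat m = X / 4 ^+ m & C * (m%:R + 1) = X * (2 * m%:R + 1).
    exists 'C(2 * m, m)%:R; first exact: cbinE.
    transitivity ((m.+1 * 'C((2 * m).+1, m))%:R : rat); first by rewrite natrM -CE -(natr1 m) mulrC.
    rewrite mul_bin_odd_mid natrM mulrC; congr (_ * _).
    by ring.
  have h1 : 2 * m%:R + 1 != 0 :> rat by apply: (@natrS_neq0 _ _ (2 * m)); ring.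
  have eX : X = C * (m%:R + 1) / (2 * m%:R + 1) by rewrite eC mulfK.
  have e2 : 2 ^+ (p - 1) = 4 * (4 ^+ m) ^+ 2 :> rat.
    rewrite p1E.
    by rewrite exprM (_ : 2 ^+ 2 = 4) ?exprD ?expr1 ?exprM 1?mulrC //; ring.
  have h2 : 4 ^+ m != 0 :> rat by rewrite expf_neq0.
  have h3 : 1 - q != 0 by [].
  rewrite /cb /B e2 cbX eX.
  move: (4 ^+ m) h2 h3 => w w0; rewrite qE => h3.
  by field; rewrite h1 w0 h3.
have Zcb : cb \in Zp by rewrite Ecb; apply: zloc_div => //; apply: zunitX.
have ccb : cong 1 cb (C ^+ 2).
  rewrite Ecb -[C ^+ 2]divr1; apply: congM => //; first by rewrite invr1 rpred1.
  apply: congV; [exact: zunitX | exact: zunit1 |].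
  rewrite (_ : _ ^+ 2 = 1 + q * (q - 2)); last by ring.
  by apply: cong_addp; rewrite rpredB // rpred_nat.
have [cS0 cS1] := value_odd p_pr p_gt3 pE.
have cH := hsum_euler p_pr p_gt3 pE; rewrite -/E in cH.
have le_m : (2 * m <= (2 * m).+1)%N by [].
have cQ := qprod_expand p_pr p_gt3 pE' le_m; rewrite -/cb in cQ.
set H := hsum m in cS1 cH cQ; set O := osum m in cQ.
have ZH : H \in Zp by apply: cong_loc cH _; rewrite rpredM // rpredN rpred_nat.
(* [hsum (2 * m).+1] is 0 modulo p, and its last term is the inverse square of 2m + 1 = (p-1)/2,
   that is 4 modulo p. *)
have cO : cong 1 O (- 4 - H / 4).
  have n1 : zunit ((2 * m)%:R + 1) by rewrite natr1; apply: zunit_ltp.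
  have -> : O = hsum (2 * m).+1 - ((2 * m)%:R + 1) ^- 2 - H / 4.
    by rewrite /hsum big_ord_recr /= -/(hsum (2 * m)) hsum_double -/O -/H; ring.
  apply: congB; last exact: cong_refl.
  rewrite -[- 4]sub0r; apply: congB; first exact: (hsum_half p_pr p_gt3 pE').
  rewrite -[4]invrK; apply: congV; [exact: zunitX | exact: zunitV |].
  rewrite (_ : (_ + 1) ^+ 2 = 4^-1 + q * ((q - 2) / 4)).
    by apply: cong_addp; apply: zloc_div => //; rewrite rpredB // rpred_nat.
  by rewrite qE natrM; field.
have ZO : O \in Zp by apply: cong_loc cO _; rewrite rpredB ?rpredN ?rpred_nat // zloc_div.
pose K := H / 16 - O / 4 - H / 4.
have ZHO : H / 16 - O / 4 \in Zp by apply: rpredB; apply: zloc_div.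
have ZH4 : H / 4 \in Zp by apply: zloc_div.
have ZK : K \in Zp by rewrite rpredB.
(* The constant 1 coming from -O/4 cancels the -1, and the multiples of H add up to -H/8. *)
have cK : cong 1 (K - 1) (E / 2).
  apply: (@cong_trans _ _ _ (H / 16 - (- 4 - H / 4) / 4 - H / 4 - 1)).
    apply: congB; last exact: cong_refl.
    apply: congB; last exact: cong_refl.
    apply: congB; first exact: cong_refl.
    by apply: congMr => //; apply: zunitV_loc.
  rewrite (_ : _ - 1 = - 8^-1 * H); last by field.
  rewrite (_ : E / 2 = - 8^-1 * (- 4 * E)); last by field.
  apply: congMl => //; rewrite rpredN; apply: zunitV_loc.
  by exact: zunit8.
have {cS1} cS1 : cong 3 (wcubesum (2 * m).+1) (- B - q ^+ 2 * (C ^+ 2 * (E / 2))).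
  apply: (cong_trans cS1).
  apply: (@cong_trans _ _ _ ((2 * q - 1) * (cb * (1 + q ^+ 2 * (H / 16 - O / 4))) * (1 - q ^+ 2 / 4 * H))).
    apply: congMr; last by apply: congMl; [exact: zunit_loc|].
    rewrite (_ : q ^+ 2 / 4 * H = q ^+ 2 * (H / 4)); last by ring.
    by rewrite rpredB ?rpred1 // rpredM // rpredX.
  (* Since 2p - 1 = p^2 - (1-p)^2, the product (2p-1) cb is -B + p^2 cb; the second summand accounts
     for the 1 in K - 1. *)
  have -> : (2 * q - 1) * (cb * (1 + q ^+ 2 * (H / 16 - O / 4))) * (1 - q ^+ 2 / 4 * H) =
     - B + q ^+ 2 * ((2 * q - 1) * cb * (K - 1)) + q ^+ 3 * (2 * B / (1 - q) ^+ 2 - q * (2 * q - 1) * cb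
       * (H / 16 - O / 4) * (H / 4)).
    by rewrite Ecb /K; field; rewrite q10.
  apply: cong_trans (cong_add_pX _ _ _) _.
    apply: rpredB; first by apply: zloc_div (zunitX _ u1); rewrite rpredM ?rpred_nat.
    by have Zq1 := zunit_loc u1'; do 4?[apply: rpredM => //].
  apply: congD; first exact: cong_refl.
  rewrite -mulrN; apply: (@congMpX _ _ 1 2).
  rewrite [X in cong _ _ X](_ : _ = (-1) * C ^+ 2 * (E / 2)); last by ring.
  have Z2 : E / 2 \in Zp by apply: zloc_div.
  have c1 : cong 1 (2 * q - 1) (-1).
    rewrite (_ : _ - _ = - 1 + q * 2); last by ring.
    by apply: cong_addp; exact: rpred_nat.
  apply: congM; [by apply: rpredM; [exact: (zunit_loc u1') | exact: Zcb] | exact: Z2 | | exact: cK].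
  by apply: congM; [exact: (zunit_loc u1') | exact: ZC2 | exact: c1 | exact: ccb].
have {cS0} cS0 : cong 3 (cubesum (2 * m).+1) (- (q ^+ 2 * C ^- 2)).
  apply: (cong_trans cS0); rewrite -mulrN; apply: (@congMpX _ _ 1 2).
  have cQ1 : cong 1 (qprod p m) (C ^+ 2).
    apply: cong_trans (cong_le _ cQ) _ => //; apply: cong_trans ccb.
    rewrite -[X in cong _ _ X]mulr1; apply: congMl => //.
    by rewrite (_ : q ^+ 2 * _ = q * (q * (H / 16 - O / 4))); [apply: cong_addp; rewrite rpredM | ring].
  have uQ : zunit (qprod p m) by apply: zunit_cong (cong_sym cQ1) (zunitX _ uC).
  rewrite -invrN; apply: congV.
  - exact: zunitM.
  - exact/zunitN/zunitX.
  rewrite -[X in cong _ _ X]mulN1r; apply: congM; [exact: zunit_loc | exact: ZC2 | | exact: cQ1].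
  rewrite (_ : _ - _ = - 1 + q * 2); last by ring.
  by apply: cong_addp; exact: rpred_nat.
have u27 : zunit 27 by exact: zunit27.
have Zv : - ((q + 1) ^+ 2 / (3 * 2 ^+ (p - 1))) * C ^+ 2 - q ^+ 2 * (13 / 27 * C ^- 2 + 1 / 6 * C ^+ 2 * E) \in Zp.
  have u6 : zunit 6 by rewrite (_ : 6 = 2 * 3); [exact: zunitM | ring].
  apply: rpredB; apply: rpredM.
  - rewrite rpredN; apply: zloc_div (zunitM u3 upw); apply: rpredX; apply: rpredD => //; exact: rpred1.
  - exact: ZC2.
  - exact: rpredX.
  apply: rpredD; apply: rpredM.
  - by apply: zloc_div u27; exact: rpred_nat.
  - exact: zunitV_loc (zunitX 2 uC).
  - by apply: rpredM ZC2; apply: zloc_div u6; exact: rpred1.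
  exact: ZE.
split; first exact: Zv.
apply: (cong_mulI u27); apply: cong_trans (shifted_cubesum_cong p_pr p_gt3 pE') _.
rewrite (_ : 27 * _ = 13 * (- (q ^+ 2 * C ^- 2)) + 9 * (- B - q ^+ 2 * (C ^+ 2 * (E / 2)))).
  by apply: congD; apply: congMl; rewrite ?rpred_nat.
by rewrite /B; field; rewrite C0 pw0.
Qed.
End OddCase.

(** * The case p = 1 mod 4 *)

Section QuarticSums.
Variables (F : finFieldType) (m : nat) (g : F).
Hypothesis m_gt0 : (0 < m)%N.
Hypothesis cardF : #|F| = (4 * m).+1.
Hypothesis g_prim : (4 * m).-primitive_root g.
Hypothesis two_neq0 : 2 != 0 :> F.

Definition quad (x : F) : int := if x == 0 then 0 else if x ^+ (2 * m) == 1 then 1 else -1.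

Lemma exp_card_pred (x : F) : x != 0 -> x ^+ (4 * m) = 1.
Proof. by move=> x0; apply: (mulfI x0); rewrite -exprS -cardF expf_card mulr1. Qed.

Lemma neq1N1 : (1 : F) != -1.
Proof. by rewrite -subr_eq0 opprK. Qed.

Lemma exp_half (x : F) : x != 0 -> x ^+ (2 * m) = 1 \/ x ^+ (2 * m) = -1.
Proof.
move=> x0; have /eqP : (x ^+ (2 * m)) ^+ 2 = 1 by rewrite -exprM mulnC mulnA exp_card_pred.
by rewrite sqrf_eq1 => /orP[] /eqP; [left | right].
Qed.

Lemma quad0 : quad 0 = 0. Proof. by rewrite /quad eqxx. Qed.

Lemma quadM x y : quad (x * y) = quad x * quad y.
Proof.
have [->|x0] := eqVneq x 0; first by rewrite !(mul0r, quad0).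
have [->|y0] := eqVneq y 0; first by rewrite !(mulr0, quad0).
have n1 := negPf neq1N1; have n2 : (-1 == 1 :> F) = false by rewrite eq_sym.
rewrite /quad mulf_eq0 (negPf x0) (negPf y0) exprMn /=.
by case: (exp_half x0) => ->; case: (exp_half y0) => ->; rewrite ?mulrNN ?mulr1 ?mul1r ?eqxx ?n2.
Qed.

Lemma quad_sq x : x != 0 -> quad x * quad x = 1.
Proof. by rewrite /quad => /negPf->; case: ifP. Qed.

Lemma g_neq0 : g != 0.
Proof.
apply: contraTneq g_prim => ->; apply/negP => /prim_expr_order /eqP.
by rewrite expr0n muln_eq0 /= (gtn_eqF m_gt0) eq_sym oner_eq0.
Qed.

Lemma g_half : g ^+ (2 * m) = -1.
Proof.
case: (exp_half g_neq0) => // /eqP; rewrite -(prim_order_dvd g_prim) => /dvdn_leq.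
by rewrite muln_gt0 m_gt0 => /(_ isT); rewrite leq_pmul2r.
Qed.

Lemma quad_g : quad g = -1.
Proof. by rewrite /quad (negPf g_neq0) g_half eq_sym (negPf neq1N1). Qed.

Lemma sum_anti (h : F -> int) c : c != 0 -> (forall x, h (c * x) = - h x) -> \sum_x h x = 0.
Proof.
move=> c0 hc; suff /eqP : (\sum_x h x) *+ 2 = 0 by rewrite mulrn_eq0 => /eqP.
rewrite mulr2n.
rewrite {1}(reindex_inj (mulfI c0)) -big_split /= big1 // => x _.
by rewrite hc addNr.
Qed.

Lemma sum_quad : \sum_x quad x = 0.
Proof. by apply: (sum_anti g_neq0) => x; rewrite quadM quad_g mulN1r. Qed.

(** Substituting x = 1 - 1/y turns the argument into (1-c)y + c up to the square of 1/y, which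
    leaves a complete character sum without its term [quad c] at y = 0. As the inverse of 0 is 0,
    the substitution is a bijection of F, with y = 0 sent to x = 1, where the term vanishes. *)
Lemma sum_quad_pair c : c != 0 -> c != 1 -> \sum_x quad ((1 - c * x) * (1 - x)) = - quad c.
Proof.
move=> c0 c1.
have inj_h : injective (fun y : F => 1 - y^-1) by move=> x y /addrI /oppr_inj /invr_inj.
rewrite (reindex_inj inj_h) /= (bigD1 0) //= invr0 subr0 mulr1 subrr mulr0 quad0 add0r.
transitivity (\sum_(y | y != 0) quad ((1 - c) * y + c)).
  apply: eq_bigr => y y0; rewrite -[RHS]mulr1 -(quad_sq (x := y^-1)) ?invr_eq0 // -!quadM.
  by congr quad; field.
have inj_l : injective (fun y : F => (1 - c) * y + c).
  by move=> x y /addIr /mulfI; apply; rewrite subr_eq0 eq_sym.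
have := sum_quad; rewrite (reindex_inj inj_l) (bigD1 0) //= mulr0 add0r addrC.
by move/eqP; rewrite addr_eq0 => /eqP.
Qed.

Lemma sum_quad_pair1 : \sum_x quad ((1 - x) * (1 - x)) = (4 * m)%N%:Z.
Proof.
rewrite (bigD1 1) //= subrr mulr0 quad0 add0r.
transitivity (\sum_(x : F | x != 1) (1 : int)).
  by apply: eq_bigr => x x1; rewrite quadM quad_sq // subr_eq0 eq_sym.
rewrite sumr_const natz; congr Posz; apply: succn_inj; rewrite -cardF.
by rewrite [RHS](cardD1 1) inE add1n; congr _.+1; apply: eq_card => x; rewrite !inE andbT.
Qed.

Local Notation i := (g ^+ m).

(** [re4 (x ^+ m)] and [im4 (x ^+ m)] are the real and imaginary parts of the quartic character that
    sends g to the imaginary unit. *)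
Definition re4 (z : F) : int := (z == 1)%:Z - (z == -1)%:Z.
Definition im4 (z : F) : int := (z == i)%:Z - (z == - i)%:Z.

Lemma mulii : i * i = -1.
Proof. by rewrite -exprD addnn -mul2n g_half. Qed.

Lemma mu4_cases (x : F) : x != 0 -> [\/ x ^+ m = 1, x ^+ m = -1, x ^+ m = i | x ^+ m = - i].
Proof.
move=> x0; have e : x ^+ (2 * m) = (x ^+ m) ^+ 2 by rewrite mulnC exprM.
case: (exp_half x0); rewrite e => /eqP.
  by rewrite sqrf_eq1 => /orP[] /eqP; [constructor 1 | constructor 2].
rewrite -mulii -expr2 eqf_sqr => /orP[] /eqP; [constructor 3 | constructor 4]; done.
Qed.

Lemma i_neq : [/\ i != 1, i != -1 & i != - i].
Proof.
have h : i * i != 1 by rewrite mulii eq_sym neq1N1.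
split; first by apply: contraNneq h => ->; rewrite mulr1.
  by apply: contraNneq h => ->; rewrite mulrNN mulr1.
rewrite -subr_eq0 opprK -mulr2n -mulr_natl mulf_neq0 //.
by rewrite expf_neq0 // g_neq0.
Qed.

Lemma re_im4 : [/\ re4 1 = 1 /\ im4 1 = 0, re4 (-1) = -1 /\ im4 (-1) = 0,
  re4 i = 0 /\ im4 i = 1 & re4 (- i) = 0 /\ im4 (- i) = -1].
Proof.
have [a b c] := i_neq; have d := neq1N1.
have b' : 1 != - i by apply: contraNneq b => ->; rewrite opprK.
rewrite /re4 /im4 !eqr_opp !eqxx (negPf a) (negPf b) (negPf c) (negPf d) (negPf b').
rewrite ![1 == i]eq_sym ![-1 == i]eq_sym ![- i == i]eq_sym ![-1 == 1]eq_sym ![- i == 1]eq_sym.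
by rewrite (negPf a) (negPf b) (negPf c) (negPf d) (negPf b').
Qed.

(** The real part of chi(uv) times the conjugate of chi(v), for the quartic character chi. *)
Lemma re_im_kernel u v : u != 0 -> v != 0 ->
  re4 ((u * v) ^+ m) * re4 (v ^+ m) + im4 ((u * v) ^+ m) * im4 (v ^+ m) = re4 (u ^+ m).
Proof.
move=> u0 v0; rewrite exprMn; have [[a1 b1] [a2 b2] [a3 b3] [a4 b4]] := re_im4.
by case: (mu4_cases u0) => ->; case: (mu4_cases v0) => ->;
  rewrite ?(mulNr, mulrN, mul1r, mulr1, opprK, mulii); rewrite ?a1 ?b1 ?a2 ?b2 ?a3 ?b3 ?a4 ?b4.
Qed.

Definition jacA : int := \sum_x re4 (x ^+ m) * quad (1 - x).
Definition jacB : int := \sum_x im4 (x ^+ m) * quad (1 - x).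

Lemma re_im0 : re4 (0 ^+ m) = 0 /\ im4 (0 ^+ m) = 0.
Proof.
rewrite expr0n (gtn_eqF m_gt0) /= /re4 /im4 ![0 == _]eq_sym.
by rewrite !oppr_eq0 oner_eq0 expf_eq0 (negPf g_neq0) andbF.
Qed.

(** In the double sum over x and y, put x = c y: the quartic characters combine to chi(c), and the
    inner sum over y != 0 is -quad(c) - 1, plus the field order if c = 1. The sums of Re chi(c) and
    of Re chi(c) quad(c) vanish because c -> g^2 c changes their sign, so only c = 1 contributes. *)
Lemma jac_norm : jacA ^+ 2 + jacB ^+ 2 = (4 * m).+1%:Z.
Proof.
have [r0 i0] := re_im0; have [[r1 _] _ _ _] := re_im4.
have i2 : (g ^+ 2) ^+ m = -1 by rewrite -exprM g_half.
have gg0 : g ^+ 2 != 0 by rewrite expf_neq0 // g_neq0.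
have reN c : re4 ((g ^+ 2 * c) ^+ m) = - re4 (c ^+ m).
  by rewrite exprMn i2 mulN1r /re4 eqr_opp -[- _ == 1]eqr_opp opprK opprB.
have sre : \sum_c re4 (c ^+ m) = 0 by apply: (sum_anti gg0).
have sreq : \sum_c re4 (c ^+ m) * quad c = 0.
  by apply: (sum_anti gg0) => c; rewrite reN quadM [quad (g ^+ 2)]quadM quad_g mulrNN mulr1 mul1r mulNr.
transitivity (\sum_c re4 (c ^+ m) * \sum_(y | y != 0) quad ((1 - c * y) * (1 - y))).
  under [RHS]eq_bigr do rewrite mulr_sumr.
  rewrite exchange_big /= /jacA /jacB !expr2 !mulr_suml -big_split /=.
  under eq_bigr do rewrite !mulr_sumr -big_split /=.
  rewrite exchange_big /= (bigD1 0) //= big1 ?add0r; last first.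
    by move=> x _; rewrite r0 i0 !mul0r !mulr0 addr0.
  apply: eq_bigr => y y0; rewrite (reindex_inj (mulIf y0)) /=; apply: eq_bigr => c _.
  have [->|c0] := eqVneq c 0; first by rewrite !mul0r r0 i0 !mul0r addr0.
  by rewrite -(re_im_kernel c0 y0) quadM; ring.
have T c : c != 0 -> \sum_(y | y != 0) quad ((1 - c * y) * (1 - y)) =
    - quad c - 1 + (c == 1)%:Z * (4 * m).+1%:Z.
  move=> c0; have q1 : quad 1 = 1 by rewrite /quad oner_eq0 expr1n eqxx.
  have e : \sum_y quad ((1 - c * y) * (1 - y)) = 1 + \sum_(y | y != 0) quad ((1 - c * y) * (1 - y)).
    by rewrite (bigD1 0) //= mulr0 !subr0 mulr1 q1.
  apply: (addrI 1); rewrite -e; have [->|c1] := eqVneq c 1.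
    under eq_bigr do rewrite mul1r.
    by rewrite sum_quad_pair1 q1 /= (intS (4 * m)); move: (Posz (4 * m)) => z; rewrite mul1r; ring.
  by rewrite sum_quad_pair //= mul0r addr0; ring.
transitivity (\sum_c (- (re4 (c ^+ m) * quad c) - re4 (c ^+ m) + re4 (c ^+ m) * ((c == 1)%:Z * (4 * m).+1%:Z))).
  apply: eq_bigr => c _; have [->|c0] := eqVneq c 0; first by rewrite r0 !mul0r oppr0 !addr0.
  by rewrite T //; ring.
rewrite !big_split /= !sumrN sre sreq oppr0 !add0r (bigD1 1) //= eqxx big1 ?addr0.
  by rewrite expr1n r1 !mul1r.
by move=> c /negPf->; rewrite mul0r mulr0.
Qed.

(** Modulo 2, [re4 (x ^+ m)] is the indicator [s] of the nonzero squares, and [quad (1 - x)] is odd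
    except at x = 1. So [jacA] has the parity of 2m - 1, the number of nonzero squares other than
    1. *)
Lemma jacA_odd : exists k : int, jacA = 2 * k + 1.
Proof.
have [r0 i0] := re_im0; have [[r1 _] [r2 _] [r3 _] [r4 _]] := re_im4.
pose s (x : F) : int := (x ^+ (2 * m) == 1)%:Z.
have s0 : s 0 = 0 by rewrite /s expr0n muln_eq0 /= (gtn_eqF m_gt0) eq_sym oner_eq0.
have ss : \sum_x s x = (2 * m)%N%:Z.
  have := sum_quad; rewrite (bigD1 0) //= quad0 add0r => e.
  rewrite (bigD1 0) //= s0 add0r; apply: (@mulfI _ 2) => //.
  rewrite mulr_sumr; transitivity (\sum_(x | x != 0) (2 * s x - quad x)); first by rewrite sumrB e subr0.
  transitivity (\sum_(x : F | x != 0) (1 : int)).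
    by apply: eq_bigr => x /negPf x0; rewrite /s /quad x0; case: ifP.
  rewrite sumr_const natz -PoszM mulnA; congr Posz.
  apply: succn_inj; rewrite -cardF [RHS](cardD1 0) inE add1n; congr _.+1.
  by apply: eq_card => x; rewrite !inE andbT.
suff : (2 %| jacA - \sum_x s x + 1)%Z.
  move=> /dvdzP[k e]; exists (k + m%:Z - 1); move: e; rewrite ss PoszM.
  by move=> e; lia.
rewrite /jacA -sumrB (bigD1 1) //= subrr quad0 mulr0 /s expr1n eqxx sub0r.
have tE : Posz true = 1 by [].
rewrite tE addrAC addNr add0r.
apply: rpred_sum => x x1; have [->|x0] := eqVneq x 0.
  by rewrite -/(s 0) s0 r0 mul0r subr0 dvdz0.
have x1' : 1 - x != 0 by rewrite subr_eq0 eq_sym.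
have e : x ^+ (2 * m) = x ^+ m * x ^+ m by rewrite -exprD addnn mul2n.
rewrite /quad (negPf x1') e.
case: (mu4_cases x0) => ->; rewrite ?r1 ?r2 ?r3 ?r4 ?mulrNN ?mulr1 ?mulii ?eqxx ?[-1 == 1]eq_sym ?(negPf neq1N1) ?mul0r //; by case: ifP.
Qed.

Lemma sum_prim_root (V : nmodType) (f : F -> V) :
  f 0 = 0 -> \sum_x f x = \sum_(k < 4 * m) f (g ^+ k).
Proof.
move=> f0; have m4 : (0 < 4 * m)%N by rewrite muln_gt0.
rewrite (bigD1 0) //= f0 add0r.
pose idx (x : F) : 'I_(4 * m) := odflt (Ordinal m4) [pick k : 'I_(4 * m) | g ^+ k == x].
rewrite (reindex_onto (fun k : 'I_(4 * m) => g ^+ k) idx) /=.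
  apply: eq_bigl => k; rewrite expf_neq0 ?g_neq0 //=; apply/eqP; rewrite /idx.
  case: pickP => [k' /eqP e|/(_ k)]; last by rewrite eqxx.
  have /eqP := e; rewrite (eq_prim_root_expr g_prim) !modn_small // => /eqP e'.
  exact: val_inj.
move=> x x0; rewrite /idx; case: pickP => [k /eqP //|h].
have [k e] := prim_rootP g_prim (exp_card_pred x0).
by have := h k; rewrite e eqxx.
Qed.
End QuarticSums.

Lemma bin_prod N k : 'C(N + k, k)%:R = \prod_(l < k) ((N%:R + l%:R + 1) / (l%:R + 1)) :> rat.
Proof.
elim: k => [|k IHk]; first by rewrite big_ord0 bin0.
have k0 : (k%:R + 1 : rat) != 0 by rewrite natr1 pnatr_eq0.
rewrite big_ord_recr /= -IHk; apply: (mulfI k0).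
transitivity ((N%:R + k%:R + 1) * 'C(N + k, k)%:R : rat); last by field.
by rewrite -natrD !natr1 -!natrM; congr (_%:R); rewrite addnS -mul_bin_diag.
Qed.

Lemma bin_central_step M : (M%:R + 1) * 'C(2 * M.+1, M.+1)%:R = 2 * (2 * M%:R + 1) * 'C(2 * M, M)%:R :> rat.
Proof.
have M0 : (M%:R + 1 : rat) != 0 by rewrite natr1 pnatr_eq0.
have w1 : 4 ^+ M.+1 != 0 :> rat by rewrite expf_neq0.
have := cbinE M.+1; rewrite /cbin big_ord_recr /= -/(cbin rat M) cbinE => /(congr1 (fun x => x * 4 ^+ M.+1));
  rewrite divfK // => e.
have h2 : (2 * M%:R + 2 : rat) != 0 by apply: (@natrS_neq0 _ _ (2 * M).+1); ring.
have w0 : 4 ^+ M != 0 :> rat by rewrite expf_neq0.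
rewrite -e exprS.
by field; rewrite h2 w0.
Qed.

(** Each step of the induction on t adds 4m consecutive indices, of which exactly one lies in the
    class of m modulo 4m. *)
Lemma sum_residue (V : nmodType) (m : nat) (f : nat -> V) t : (0 < m)%N ->
  \sum_(j < ((4 * t + 2) * m).+1 | (4 * m %| 3 * m + j)%N) f j = \sum_(i < t.+1) f ((4 * i + 1) * m)%N.
Proof.
move=> m0.
have dv j : (4 * m %| 3 * m + j)%N -> exists s, (j + 3 * m = 4 * s * m)%N.
  by case/dvdnP => s e; exists s; lia.
have dv' s : (4 * m %| 3 * m + (4 * s + 1) * m)%N.
  by apply/dvdnP; exists s.+1; lia.
have iv (a b j0 : nat) : (a <= j0 < b)%N -> (forall j, (a <= j < b)%N -> (4 * m %| 3 * m + j)%N = (j == j0)) ->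
    \sum_(a <= j < b | (4 * m %| 3 * m + j)%N) f j = f j0.
  move=> h e; transitivity (\sum_(a <= j < b | j == j0) f j); last by rewrite big_nat1_eq h.
  rewrite big_nat_cond [RHS]big_nat_cond.
  by apply: eq_bigl => j; case: (boolP (a <= j < b)%N) => //= hj; rewrite e.
rewrite -(big_mkord (fun j => 4 * m %| 3 * m + j)%N f); elim: t => [|t IHt].
  rewrite big_ord1 /=; apply: iv; first by lia.
  move=> j hj; apply/idP/eqP => [/dv[s e]|->]; last exact: (dv' 0%N).
  have : (s < 2)%N by rewrite ltnNge; apply/negP => h; have := leq_mul h (leqnn m); lia.
  have : (0 < s)%N by case: s e => // e; lia.
  by case: s e => [//|[|//]] e _ _; lia.
rewrite (@big_cat_nat _ _ _ ((4 * t + 2) * m).+1) //=; last by rewrite ltnS leq_mul2r; apply/orP; right; lia.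
rewrite IHt [RHS]big_ord_recr /=; congr (_ + _).
apply: iv.
  by apply/andP; split; [rewrite ltn_pmul2r | rewrite ltnS leq_pmul2r]; lia.
move=> j hj; apply/idP/eqP => [/dv[s e]|->]; last exact: (dv' t.+1).
have h1 : (s < t.+3)%N.
  rewrite ltnNge; apply/negP => h; have := leq_mul h (leqnn m).
  by case/andP: hj => _; lia.
have h2 : (t.+1 < s)%N.
  rewrite ltnNge; apply/negP => h; have := leq_mul h (leqnn m).
  by case/andP: hj => + _; lia.
have es : s = t.+2 by lia.
by move: e; rewrite es; lia.
Qed.
(** After a choice of the sign of b, p divides ax - 2by. Brahmagupta's identity writes p^2 as the
    sum of the square of this number and another square, so the number is 0 or +-p. If it is 0, then
    x is even, against p odd; otherwise the other square is 0, which gives a = +-x. *)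
Lemma sum_two_squares_uniq (p : nat) (a b x y : int) : prime p -> odd p ->
  a ^+ 2 + b ^+ 2 = p%:Z -> (exists k, a = 2 * k + 1) -> p%:Z = x ^+ 2 + 4%:Z * y ^+ 2 -> a ^+ 2 = x ^+ 2.
Proof.
move=> p_pr p_odd eab [k ak] exy; have p0 : p%:Z != 0 by rewrite eqz_nat -lt0n prime_gt0.
have e4 : (2 * y) ^+ 2 = p%:Z - x ^+ 2 by rewrite exy; ring.
have dv : (p%:Z %| (a * x - b * (2 * y)) * (a * x + b * (2 * y)))%Z.
  apply/dvdzP; exists (a ^+ 2 + x ^+ 2 - p%:Z).
  transitivity (a ^+ 2 * x ^+ 2 - b ^+ 2 * (2 * y) ^+ 2); first by ring.
  by rewrite e4 -eab; ring.
wlog dv1 : b eab {dv} / (p%:Z %| a * x - b * (2 * y))%Z.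
  move=> W; move: dv; rewrite dvdzE abszM Euclid_dvdM // => /orP[] h; first exact: (W b).
  by apply: (W (- b)); rewrite ?sqrrN // mulNr opprK dvdzE.
have norm : (a * x - b * (2 * y)) ^+ 2 + (a * (2 * y) + b * x) ^+ 2 = p%:Z ^+ 2.
  transitivity ((a ^+ 2 + b ^+ 2) * (x ^+ 2 + 4 * y ^+ 2)); first by ring.
  by rewrite eab -exy expr2.
case/dvdzP: dv1 => s es; have le1 : (s ^+ 2 <= 1).
  have : s ^+ 2 * p%:Z ^+ 2 <= 1 * p%:Z ^+ 2.
    by rewrite -exprMn -es mul1r -norm lerDl sqr_ge0.
  by rewrite ler_pM2r // exprn_gt0 // ltz_nat prime_gt0.
have [/eqP s0|s1] : s ^+ 2 = 0 \/ s ^+ 2 = 1.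
  by move: le1 (sqr_ge0 s); clear; move: (s ^+ 2) => w; lia.
  move: s0; rewrite sqrf_eq0 => /eqP s0.
  have e : a * x = b * (2 * y) by apply/eqP; rewrite -subr_eq0 es s0 mul0r.
  have ex : x = 2 * (b * y - k * x) by move: e; rewrite ak; clear; lia.
  have : p%:Z = 2 * (2 * ((b * y - k * x) ^+ 2 + y ^+ 2)) by rewrite exy {1}ex; ring.
  by move: (_ ^+ 2 + _) p_odd => w; clear; lia.
have e0 : a * (2 * y) + b * x = 0.
  apply/eqP; rewrite -sqrf_eq0; apply/eqP; move: norm; rewrite es exprMn s1 mul1r.
  by move/(canRL (addKr _)); rewrite addNr.
have : a * p%:Z = x * (s * p%:Z).
  rewrite -es {1}exy; transitivity (a * x ^+ 2 + 2 * y * (a * (2 * y) + b * x) - 2 * y * b * x); first by ring.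
  by rewrite e0; ring.
rewrite mulrA => /(mulIf p0) ->.
by rewrite exprMn s1 mulr1.
Qed.

(** * Products and binomial coefficients modulo p^3 for p = 4m + 1 *)

Section QuarterPrime.
Variables (p m : nat) (p_pr : prime p).
Hypothesis p_gt3 : (3 < p)%N.
Hypothesis pE : p = (4 * m).+1.
Local Notation Zp := (zloc p_pr).
Local Notation cong := (cong p_pr).
Local Notation zunit := (zunit p_pr).
Local Notation q := (p%:R : rat).

Local Lemma q0 : q != 0. Proof. exact: natr_prime_neq0. Qed.
Local Lemma Zq : q \in Zp. Proof. exact: rpred_nat. Qed.
Local Lemma u2 : zunit 2. Proof. exact: zunit2. Qed.
Local Lemma u3 : zunit 3. Proof. exact: zunit3. Qed.
Local Lemma u4 : zunit 4. Proof. exact: zunit4. Qed.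
Local Lemma u8 : zunit 8. Proof. exact: zunit8. Qed.
Local Lemma u16 : zunit 16. Proof. exact: zunit16. Qed.
Local Lemma qE : q = 4 * m%:R + 1. Proof. by rewrite pE; ring. Qed.
Local Lemma uS j : (j.+1 < p)%N -> zunit (j%:R + 1).
Proof. by move=> ltj; rewrite natr1; apply: zunit_ltp. Qed.
Local Lemma m_gt0 : (0 < m)%N. Proof. lia. Qed.

#[local] Hint Resolve q0 Zq u2 u3 u4 u8 u16 m_gt0 : core.

(** (s1^2 - s2) / 2 is the second elementary symmetric polynomial of the [a j]. *)
Lemma prod_add1_p (a : nat -> rat) k : (forall j, (j < k)%N -> a j \in Zp) ->
  let s1 := \sum_(j < k) a j in let s2 := \sum_(j < k) a j ^+ 2 in
  cong 3 (\prod_(j < k) (1 + q * a j)) (1 + q * s1 + q ^+ 2 * ((s1 ^+ 2 - s2) / 2)).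
Proof.
elim: k => [|k IHk] Za /=.
  by rewrite !big_ord0; apply: eq_cong; ring.
have {}IHk := IHk (fun j ltj => Za j (leqW ltj)); rewrite /= in IHk.
have Zs1 : \sum_(j < k) a j \in Zp by apply: rpred_sum => -[j ltj] _ /=; apply/Za/leqW.
have Zs2 : \sum_(j < k) a j ^+ 2 \in Zp by apply: rpred_sum => -[j ltj] _ /=; apply/rpredX/Za/leqW.
have Zk := Za k (leqnn _).
rewrite !big_ord_recr /=; set P := \prod_(j < k) _ in IHk *.
set s1 := \sum_(j < k) a j in Zs1 IHk *; set s2 := \sum_(j < k) a j ^+ 2 in Zs2 IHk *.
clearbody P s1 s2.
have Ze : (s1 ^+ 2 - s2) / 2 \in Zp by apply: zloc_div => //; rewrite rpredB ?rpredX.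
apply: cong_trans (congMr _ IHk) _; first by rewrite rpredD ?rpred1 // rpredM.
have -> : (1 + q * s1 + q ^+ 2 * ((s1 ^+ 2 - s2) / 2)) * (1 + q * a k) =
   1 + q * (s1 + a k) + q ^+ 2 * (((s1 + a k) ^+ 2 - (s2 + a k ^+ 2)) / 2) + q ^+ 3 * ((s1 ^+ 2 - s2) / 2 * a k).
  by field.
by apply: cong_add_pX; rewrite rpredM.
Qed.

(** The sum of 1/i over m < i <= 2m. The corresponding sum of 1/i^2 is -H modulo p, because
    [hsum (2 * m)] is 0 modulo p; so all expansions below involve only h and H. *)
Definition hdiff : rat := \sum_(l < m) (m%:R + l%:R + 1)^-1.
Local Notation h := hdiff.
Local Notation H := (hsum m).
Local Notation X := ('C(2 * m, m)%:R : rat).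

Local Lemma ul l : (l < m)%N -> zunit (m%:R + l%:R + 1).
Proof. by move=> ltl; rewrite -natrD; apply: uS; lia. Qed.

Local Lemma ZH : H \in Zp. Proof. by apply: hsum_loc; lia. Qed.

Lemma hdiff_loc : h \in Zp.
Proof. by apply: rpred_sum => -[l ltl] _ /=; apply/zunitV_loc/ul. Qed.

Local Lemma cH2 : cong 1 (hsum (2 * m)) 0.
Proof. by apply: hsum_half => //; rewrite pE; lia. Qed.

#[local] Hint Resolve ZH hdiff_loc cH2 : core.

Lemma hdiff_prod c : c \in Zp ->
  cong 3 (\prod_(l < m) (1 + q * (c / (m%:R + l%:R + 1)))) (1 + q * (c * h) + q ^+ 2 * (c ^+ 2 * (h ^+ 2 + H) / 2)).
Proof.
move=> Zc; pose a (l : nat) := c / (m%:R + l%:R + 1).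
have Za j : (j < m)%N -> a j \in Zp by move=> ltj; apply: zloc_div Zc (ul ltj).
have := prod_add1_p Za; rewrite /= -mulr_sumr -/h => H1; apply: cong_trans H1 _.
apply: congD; first exact: cong_refl.
apply: (@congMpX _ _ 1 2); apply: congMr; first exact: zunitV_loc.
rewrite exprMn mulrDr; apply: congD; first exact: cong_refl.
have -> : \sum_(j < m) a j ^+ 2 = c ^+ 2 * (hsum (2 * m) - H).
  rewrite /hsum mul2n -addnn big_split_ord /= [_ + _ - _]addrAC subrr add0r mulr_sumr.
  by apply: eq_bigr => j _; rewrite /a natrD expr_div_n.
rewrite -mulrN opprB; apply: congMl; first exact: rpredX.
rewrite -[X in cong _ _ X]subr0; apply: congB => //; exact: cong_refl.
Qed.

Lemma X_prod : X = \prod_(l < m) ((m%:R + l%:R + 1) / (l%:R + 1)).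
Proof. by rewrite -bin_prod addnn mul2n. Qed.

(** The numerators, read in reverse order, are 2(m-1-l) + 1 = p - 2(m+l+1). *)
Lemma cbin_central : cbin rat m = (-1) ^+ m * X * \prod_(l < m) (1 + q * (- (1 / 2) / (m%:R + l%:R + 1))).
Proof.
have e : \prod_(l < m) (1 + q * (- (1 / 2) / (m%:R + l%:R + 1))) =
    (-1) ^+ m * \prod_(l < m) (2 * l%:R + 1) * \prod_(l < m) (2 * (m%:R + l%:R + 1))^-1 :> rat.
  rewrite [\prod_(l < m) (2 * l%:R + 1)](reindex_inj rev_ord_inj) /=.
  have -> : (-1) ^+ m = \prod_(l < m) (-1) :> rat by rewrite prodr_const card_ord.
  rewrite -!big_split /=.
  apply: eq_bigr => -[l ltl] _ /=; have := zunit_neq0 (ul ltl) => l0.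
  by rewrite natrB // qE -(natr1 l); field.
have sm : (-1) ^+ m * (-1) ^+ m = 1 :> rat by rewrite -expr2 sqrr_sign.
rewrite e !mulrA mulrAC -mulrA X_prod [(-1) ^+ m * _]mulrC -![_ * (-1) ^+ m * _]mulrA.
rewrite ![(-1) ^+ m * _]mulrC -!mulrA sm mulr1 -!big_split /=.
apply: eq_bigr => -[l ltl] _ /=; have := zunit_neq0 (ul ltl) => l0.
have l1 : (l%:R + 1 : rat) != 0 by rewrite natr1 pnatr_eq0.
have l2 : (2 * l%:R + 2 : rat) != 0 by apply: (@natrS_neq0 _ _ (2 * l).+1); ring.
by field; rewrite l0 l1 l2.
Qed.

Lemma prod_shift1 (z : rat) k :
  \prod_(l < k) ((z + l%:R) / (l%:R + 1)) * (z + k%:R) = z * \prod_(l < k) ((z + 1 + l%:R) / (l%:R + 1)).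
Proof.
elim: k => [|k IHk]; first by rewrite !big_ord0; ring.
have l1 : (k%:R + 1 : rat) != 0 by rewrite natr1 pnatr_eq0.
rewrite !big_ord_recr /= [in RHS]mulrA -IHk -(natr1 k).
by field.
Qed.

(** [X] times [dprod c] is the generalized binomial coefficient with upper index c p + 2m and lower
    index m. *)
Definition dprod c : rat := \prod_(l < m) (1 + q * (c / (m%:R + l%:R + 1))).

Lemma dprod_bin c : \prod_(l < m) ((c * q + m%:R + 1 + l%:R) / (l%:R + 1)) = X * dprod c.
Proof.
rewrite X_prod -big_split /=; apply: eq_bigr => -[l ltl] _ /=; have := zunit_neq0 (ul ltl) => l0.
have l1 : (l%:R + 1 : rat) != 0 by rewrite natr1 pnatr_eq0.
by field; rewrite l0 l1.
Qed.

(** 6m = p + 2m - 1 is one shift below the upper index of [dprod 1]. In [bin10], 10m = 2p + 2m - 2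
    is two shifts below that of [dprod 2]. *)
Lemma bin6 : 'C(6 * m, m)%:R * (2 * (3 * q - 1)) = X * dprod 1 * (5 * q - 1).
Proof.
have -> : (6 * m = 5 * m + m)%N by lia.
rewrite bin_prod -dprod_bin mul1r.
have -> : \prod_(l < m) (((5 * m)%:R + l%:R + 1) / (l%:R + 1)) = \prod_(l < m) ((q + m%:R + l%:R) / (l%:R + 1)) :> rat.
  by apply: eq_bigr => l _; congr (_ / _); rewrite qE natrM; ring.
have -> : 2 * (3 * q - 1) = 4 * (q + m%:R + m%:R) by rewrite qE; ring.
have -> : 5 * q - 1 = 4 * (q + m%:R) by rewrite qE; ring.
by rewrite mulrCA prod_shift1; ring.
Qed.

Lemma bin10 : 'C(10 * m, m)%:R * (4 * (5 * q - 3) * (5 * q - 1)) = X * dprod 2 * ((9 * q - 5) * (9 * q - 1)).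
Proof.
have -> : (10 * m = 9 * m + m)%N by lia.
rewrite bin_prod -dprod_bin.
pose z := 2 * q + m%:R - 1.
have -> : \prod_(l < m) (((9 * m)%:R + l%:R + 1) / (l%:R + 1)) = \prod_(l < m) ((z + l%:R) / (l%:R + 1)) :> rat.
  by apply: eq_bigr => l _; congr (_ / _); rewrite /z qE natrM; ring.
have -> : \prod_(l < m) ((2 * q + m%:R + 1 + l%:R) / (l%:R + 1)) = \prod_(l < m) ((z + 1 + 1 + l%:R) / (l%:R
  + 1)) :> rat.
  by apply: eq_bigr => l _; congr (_ / _); rewrite /z; ring.
have -> : 4 * (5 * q - 3) * (5 * q - 1) = (z + m%:R) * (16 * (z + 1 + m%:R)) by rewrite /z qE; ring.
have -> : (9 * q - 5) * (9 * q - 1) = 16 * (z * (z + 1)) by rewrite /z qE; ring.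
rewrite mulrA prod_shift1; have e := prod_shift1 (z + 1) m.
set P := \prod_(l < m) ((z + 1 + l%:R) / _) in e *.
set P' := \prod_(l < m) ((z + 1 + 1 + l%:R) / _) in e *.
by transitivity (16 * z * (P * (z + 1 + m%:R))); [ring | rewrite e; ring].
Qed.

Definition cprod : rat := \prod_(l < 2 * m) (1 + q * (2 / (l%:R + 1))) / \prod_(l < m) (1 + q * (l%:R + 1)^-1) ^+ 2.

Lemma bin_2p_add k :
  'C(2 * (p + k), p + k)%:R = 'C(2 * p, p)%:R * 'C(2 * k, k)%:R *
    (\prod_(l < 2 * k) (1 + q * (2 / (l%:R + 1))) / \prod_(l < k) (1 + q * (l%:R + 1)^-1) ^+ 2) :> rat.
Proof.
elim: k => [|k IHk]; first by rewrite addn0 muln0 !big_ord0 bin0; field.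
have k0 : (k%:R + 1 : rat) != 0 by rewrite natr1 pnatr_eq0.
have pk0 : ((p + k)%:R + 1 : rat) != 0 by rewrite natr1 pnatr_eq0.
have P0 : \prod_(l < k) (1 + q * (l%:R + 1)^-1) ^+ 2 != 0.
  apply/prodf_neq0 => l _; rewrite expf_neq0 //.
  have l0 : (l%:R + 1 : rat) != 0 by rewrite natr1 pnatr_eq0.
  rewrite (_ : 1 + _ = (l.+1 + p)%:R / (l%:R + 1)); last by rewrite natrD -natr1; field.
  by rewrite mulf_neq0 ?invr_eq0 // pnatr_eq0.
apply: (mulfI pk0); rewrite addnS bin_central_step IHk.
apply: (mulfI k0); rewrite [in RHS]mulnS !big_ord_recr /=.
transitivity ((k%:R + 1) * 'C(2 * k.+1, k.+1)%:R * ('C(2 * p, p)%:R * ((p + k)%:R + 1) *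
 (\prod_(i < 2 * k) (1 + q * (2 / (i%:R + 1))) * (1 + q * (2 / ((2 * k)%:R + 1))) *
   (1 + q * (2 / ((2 * k).+1%:R + 1))) /
   (\prod_(i < k) (1 + q * (i%:R + 1)^-1) ^+ 2 * (1 + q * (k%:R + 1)^-1) ^+ 2))) : rat); last first.
  by rewrite mulnS; ring.
rewrite bin_central_step.
have e1 : (2 * k)%:R + 1 = 2 * k%:R + 1 :> rat by ring.
have e2 : (2 * k).+1%:R + 1 = 2 * (k%:R + 1) :> rat by ring.
have e3 : (p + k)%:R = q + k%:R by ring.
have h1 : (2 * k%:R + 1 : rat) != 0 by apply: (@natrS_neq0 _ _ (2 * k)); ring.
move: pk0; rewrite e1 e2 e3 => pk0.
by field; rewrite P0 h1 k0 /= andbT addrC addrA.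
Qed.

(** A case of Wolstenholme's theorem: the factors of i and p - i multiply to 1 + 2p^2 / (i(p-i)),
    and the sum of 2 / (i(p-i)) over i <= (p-1)/2 is -2 [hsum (2 * m)] = 0 modulo p. *)
Lemma bin_2p_cong : cong 3 'C(2 * p, p)%:R 2.
Proof.
have pE' : p = (2 * (2 * m)).+1 by rewrite pE; lia.
set n := (2 * m)%N in pE'; have qn : q = 2 * n%:R + 1 by rewrite pE'; ring.
have un j : (j < n)%N -> zunit (j%:R + 1) by move=> ltj; apply: uS; rewrite pE'; lia.
have un' j : (j < n)%N -> zunit (q - (j%:R + 1)).
  move=> ltj; rewrite (_ : _ - _ = (p - j.+1)%:R); first by apply: zunit_ltp; rewrite pE'; lia.
  by rewrite natrB ?natr1 // pE'; lia.
pose x j := 2 / ((j%:R + 1) * (q - (j%:R + 1))).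
have Zx j : (j < n)%N -> x j \in Zp.
  by move=> ltj; apply: zloc_div; [exact: rpred_nat | apply: zunitM; [exact: un | exact: un']].
have e : 'C(2 * p, p)%:R = 2 * \prod_(j < n) (1 + q ^+ 2 * x j).
  have ep (f : nat -> rat) : \prod_(l < p) f l = (\prod_(l < 2 * n) f l) * f (2 * n)%N by rewrite pE' big_ord_recr.
  rewrite mul2n -addnn bin_prod (ep (fun l => (q + l%:R + 1) / (l%:R + 1))) mulrC; congr (_ * _).
    have n0 : (n%:R * 2 + 1 : rat) != 0 by rewrite mulrC -qn.
    by rewrite natrM qn; field; rewrite mulrC in n0; rewrite n0.
  rewrite mul2n -addnn big_split_ord /= [X in _ * X](reindex_inj rev_ord_inj) -big_split /=.
  apply: eq_bigr => -[j ltj] _ /=.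
  have := zunit_neq0 (un j ltj); have := zunit_neq0 (un' j ltj) => a0 b0.
  have -> : (n + (n - j.+1))%:R = q - (j%:R + 1) - 1 by rewrite natrD natrB // qn -(natr1 j); ring.
  by rewrite /x; field; rewrite b0 a0.
rewrite e -[X in cong _ _ X]mulr1; apply: congMl; first exact: rpred_nat.
have [d -> [Zd cd]] := prod_add1_p2 Zx.
rewrite -[X in cong _ _ X]addr0; apply: congD; first exact: cong_refl.
rewrite -[X in cong _ _ X](mulr0 (q ^+ 2)); apply: (@congMpX _ _ 1 2); apply: cong_trans cd _.
rewrite -[X in cong _ _ X](mulr0 (-2)).
apply: cong_trans (congMl _ cH2); last by rewrite rpredN rpred_nat.
rewrite /hsum mulr_sumr; apply: cong_sum => -[j ltj] _ /=.
rewrite mulNr -mulrN /x; apply: congMl; first exact: rpred_nat.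
have u := un j ltj; rewrite -invrN; apply: congV.
- exact: zunitM (un' j ltj).
- exact/zunitN/zunitX.
rewrite (_ : _ * _ = - (j%:R + 1) ^+ 2 + q * (j%:R + 1)); last by ring.
by apply: cong_addp; apply: zunit_loc.
Qed.

(** The first-order terms are 2(u + h) from the numerator, with u the sum of 1/i for i <= m, against
    2u from the denominator; the power sum of order 2 in the numerator vanishes modulo p. The
    denominator P^2 is cleared, and the remainder is p^3 times an explicit polynomial. *)
Lemma cprod_cong : cong 3 cprod (1 + q * (2 * h) + q ^+ 2 * (2 * h ^+ 2 + H)).
Proof.
pose a (l : nat) : rat := 2 / (l%:R + 1); pose b (l : nat) : rat := (l%:R + 1)^-1.
have Zb l : (l < 2 * m)%N -> b l \in Zp by move=> ltl; apply/zunitV_loc/uS; lia.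
have Zb' l : (l < m)%N -> b l \in Zp by move=> ltl; apply: Zb; lia.
have Za l : (l < 2 * m)%N -> a l \in Zp by move=> ltl; apply: zloc_div; [exact: rpred_nat | apply: uS; lia].
have := prod_add1_p Za; have := prod_add1_p Zb'; rewrite /=.
set u := \sum_(l < m) b l; set v := \sum_(l < m) b l ^+ 2; set s := \sum_(l < 2 * m) a l.
set t := \sum_(l < 2 * m) _ => c1 c2.
have Zu : u \in Zp by apply: rpred_sum => -[l ltl] _; apply: Zb'.
have es : s = 2 * (u + h).
  rewrite /s mul2n -addnn big_split_ord /= mulrDr !mulr_sumr; congr (_ + _).
  by apply: eq_bigr => l _; rewrite /a natrD.
have ev : v = H by apply: eq_bigr => l _; rewrite /b exprVn.
have et : t = 4 * hsum (2 * m).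
  by rewrite /hsum mulr_sumr; apply: eq_bigr => l _; rewrite /a expr_div_n; congr (_ / _); ring.
have c3 : cong 3 (\prod_(l < 2 * m) (1 + q * a l)) (1 + q * s + q ^+ 2 * (s ^+ 2 / 2)).
  apply: cong_trans c2 _; apply: congD; first exact: cong_refl.
  apply: (@congMpX _ _ 1 2); apply: congMr; first exact: zunitV_loc.
  rewrite -[X in cong _ _ X]subr0; apply: congB; first exact: cong_refl.
  by rewrite et -[X in cong _ _ X](mulr0 4); apply: congMl; rewrite ?rpred_nat.
rewrite ev in c1.
set P := \prod_(j < m) _ in c1; rewrite /cprod -/a; set A := \prod_(l < 2 * m) _ in c3 *.
have ePd : \prod_(l < m) (1 + q * (l%:R + 1)^-1) ^+ 2 = P ^+ 2 by rewrite /P -prodrXl.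
have Zd : (u ^+ 2 - H) / 2 \in Zp by apply: zloc_div => //; rewrite rpredB // rpredX.
rewrite ePd; set B := 1 + q * u + q ^+ 2 * ((u ^+ 2 - H) / 2) in c1.
have ZB : B \in Zp.
  by apply: rpredD; [apply: rpredD; [exact: rpred1 | exact: rpredM] | apply: rpredM; [exact: rpredX | exact: Zd]].
have uP : zunit P.
  apply: zunit_prod => l _; apply: zunit_addp; first exact: zunit1.
  by apply: Zb'; case: l.
clearbody a b P A.
apply: (@cong_mulI _ _ _ (P ^+ 2)); first exact: zunitX.
rewrite mulrCA divff ?expf_neq0 ?(zunit_neq0 uP) // mulr1; apply: cong_trans c3 _; apply: cong_sym.
have ZR : 1 + q * (2 * h) + q ^+ 2 * (2 * h ^+ 2 + H) \in Zp by rewrite !(rpredD, rpred1, rpredM, rpredX) ?rpred_nat.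
apply: cong_trans (congMr ZR (congX 2 ZB c1)) _.
rewrite es /B.
have -> : (1 + q * u + q ^+ 2 * ((u ^+ 2 - H) / 2)) ^+ 2 * (1 + q * (2 * h) + q ^+ 2 * (2 * h ^+ 2 + H)) =
  1 + q * (2 * (u + h)) + q ^+ 2 * ((2 * (u + h)) ^+ 2 / 2) +
  q ^+ 3 * (u * (u ^+ 2 - H) + q * ((u ^+ 2 - H) / 2) ^+ 2
     + (2 * u ^+ 2 - H) * (2 * h) + 2 * u * (2 * h ^+ 2 + H)
     + q * ((2 * u ^+ 2 - H) * (2 * h ^+ 2 + H) + (u * (u ^+ 2 - H) + q * ((u ^+ 2 - H) / 2) ^+ 2) * (2 * h
       + q * (2 * h ^+ 2 + H)))).
  by field.
apply: cong_add_pX.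
have Ze : u ^+ 2 - H \in Zp by rewrite rpredB // rpredX.
have Zf : 2 * u ^+ 2 - H \in Zp by rewrite rpredB // rpredM ?rpredX ?rpred_nat.
have Zg : 2 * h ^+ 2 + H \in Zp by rewrite rpredD // rpredM ?rpredX ?rpred_nat.
set d := (u ^+ 2 - H) / 2 in Zd *; set e := u ^+ 2 - H in Ze *.
set f := 2 * u ^+ 2 - H in Zf *; set g := 2 * h ^+ 2 + H in Zg *; clearbody d e f g.
by rewrite !(rpredD, rpredM, rpredX, rpred1, rpred_nat).
Qed.

(** 5m = p + m - 1 is one step below the central coefficient of [bin_2p_add]. *)
Lemma bin10_mid : 'C(10 * m, 5 * m)%:R * (4 * (5 * q - 3)) = 'C(2 * p, p)%:R * X * cprod * (5 * q - 1).
Proof.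
have pm : (p + m = (5 * m).+1)%N by rewrite pE; lia.
rewrite /cprod -bin_2p_add pm (_ : 10 * m = 2 * (5 * m))%N; last by rewrite mulnA.
have -> : 5 * q - 1 = 4 * ((5 * m)%:R + 1) by rewrite qE natrM; ring.
rewrite [RHS]mulrC -mulrA bin_central_step mulnA qE natrM.
by ring.
Qed.

(** Up to sign, [X] times this is the unit Jacobi sum modulo p^3. It differs from the expansion of
    [dprod (- (1 / 2))] by -p^2 H / 16, which is the effect of the square root of 1 - p^2 H / 8. *)
Definition unit_root_expansion : rat := 1 - q * (h / 2) + q ^+ 2 * (h ^+ 2 / 8 + H / 16).
Local Notation Y := unit_root_expansion.

Local Lemma Zn k : k%:R \in Zp. Proof. exact: rpred_nat. Qed.

#[local] Hint Resolve Zn : core.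

Local Lemma um1 k : zunit (-1 + q * k%:R).
Proof. by apply: zunit_addp; [exact/zunitN/zunit1 | exact: rpred_nat]. Qed.
Local Lemma v3 : zunit (3 * q - 1). Proof. by rewrite addrC mulrC; exact: um1. Qed.
Local Lemma v51 : zunit (5 * q - 1). Proof. by rewrite addrC mulrC; exact: um1. Qed.
Local Lemma v53 : zunit (5 * q - 3).
Proof. by rewrite addrC mulrC; apply: zunit_addp; [exact: zunitN | exact: rpred_nat]. Qed.

#[local] Hint Resolve v3 v51 v53 : core.

Local Lemma combination_poly (x a b : rat) : x \in Zp -> a \in Zp -> b \in Zp ->
  cong 3 ((q - 1) * (15 / 8 * x
     - 5 / 2 * (x * (1 + q * (1 * a) + q ^+ 2 * (1 ^+ 2 * (a ^+ 2 + b) / 2)) * ((5 * q - 1) / (2 * (3 * q - 1))))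
     + 3 / 4 * (x * (1 + q * (2 * a) + q ^+ 2 * (2 ^+ 2 * (a ^+ 2 + b) / 2)) * (((9 * q - 5) * (9 * q
       - 1)) / (4 * (5 * q - 3) * (5 * q - 1))))
     + 3 / 8 * (2 * (x * (1 + q * (2 * a) + q ^+ 2 * (2 * a ^+ 2 + b)) * ((5 * q - 1) / (4 * (5 * q - 3)))))))
   (- (x * (1 - q * (a / 2) + q ^+ 2 * (a ^+ 2 / 8 + b / 16)))).
Proof.
move=> Zx Za Zb.
pose G (c : nat -> nat) := - (c 0)%:R - (c 1)%:R * b - (c 2)%:R * a - (c 3)%:R * a ^+ 2
  + q * ((c 4)%:R + (c 5)%:R * b + (c 6)%:R * a + (c 7)%:R * a ^+ 2)
  - q ^+ 2 * ((c 8)%:R * b + (c 9)%:R * a + (c 10)%:R * a ^+ 2) + q ^+ 3 * ((c 11)%:R * b + (c 12)%:R * a ^+ 2).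
have ZG c : G c \in Zp by rewrite /G !(rpredD, rpredB, rpredN, rpredM, rpredX, rpred_nat).
have ZGL A B C c : zunit A -> zunit B -> zunit C -> x * (G c / (16 * A * B * C)) \in Zp.
  by move=> uA uB uC; apply: rpredM Zx (zloc_div (ZG c) (zunitM (zunitM (zunitM u16 uA) uB) uC)).
(* The left side exceeds the right side by x q^3 G / (16 (3q-1)(5q-3)(5q-1)). The list holds the
   absolute values of the coefficients of G, whose signs are built into its definition. *)
pose c := nth 0%N [:: 448; 77; 240; 90; 704; 391; 704; 510; 731; 592; 1046; 433; 658].
apply: cong_trans (cong_add_pX 3 _ (ZGL _ _ _ c v3 v53 v51)); apply: eq_cong.
have n3 := zunit_neq0 v3; have n51 := zunit_neq0 v51; have n53 := zunit_neq0 v53.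
by rewrite /G /c /=; field; rewrite n3 n51 n53.
Qed.

Lemma binomial_combination :
  cong 3 ((q - 1) * (15 / 8 * X - 5 / 2 * 'C(6 * m, m)%:R + 3 / 4 * 'C(10 * m, m)%:R
     + 3 / 8 * 'C(10 * m, 5 * m)%:R)) (- (X * Y)).
Proof.
have ZX : X \in Zp by exact: rpred_nat.
have [n3 n51 n53] : [/\ 3 * q - 1 != 0, 5 * q - 1 != 0 & 5 * q - 3 != 0].
  by split; [exact: zunit_neq0 v3 | exact: zunit_neq0 v51 | exact: zunit_neq0 v53].
have -> : 'C(6 * m, m)%:R = X * dprod 1 * ((5 * q - 1) / (2 * (3 * q - 1))).
  by rewrite mulrA -bin6 mulfK // mulf_neq0.
have -> : 'C(10 * m, m)%:R = X * dprod 2 * (((9 * q - 5) * (9 * q - 1)) / (4 * (5 * q - 3) * (5 * q - 1))).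
  by rewrite mulrA -bin10 mulfK // !mulf_neq0.
have -> : 'C(10 * m, 5 * m)%:R = 'C(2 * p, p)%:R * (X * cprod * ((5 * q - 1) / (4 * (5 * q - 3)))).
  have n4 : 4 * (5 * q - 3) != 0 by rewrite mulf_neq0.
  by apply: (mulIf n4); rewrite bin10_mid -!mulrA mulVf // mulr1.
have c2p := bin_2p_cong; have cc := cprod_cong.
have d1 := hdiff_prod (rpred1 _); rewrite -/(dprod 1) in d1.
have d2 := hdiff_prod (Zn 2); rewrite -/(dprod 2) in d2.
set P1 := 1 + _ + _ in d1; set P2 := 1 + _ + _ in d2; set P3 := 1 + _ + _ in cc.
have Zh2 : h ^+ 2 \in Zp by exact: rpredX.
have ZP3 : P3 \in Zp.
  by apply: rpredD; [apply: rpredD; [exact: rpred1 | rewrite rpredM // rpredM] | rewrite rpredM ?rpredX // rpredD // rpredM].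
have Zc : cprod \in Zp by apply: cong_loc cc ZP3.
have Z53 : (5 * q - 1) / (4 * (5 * q - 3)) \in Zp by apply: zloc_div (zunit_loc v51) (zunitM u4 v53).
apply: (@cong_trans _ _ _ ((q - 1) * (15 / 8 * X - 5 / 2 * (X * P1 * ((5 * q - 1) / (2 * (3 * q - 1))))
   + 3 / 4 * (X * P2 * (((9 * q - 5) * (9 * q - 1)) / (4 * (5 * q - 3) * (5 * q - 1))))
   + 3 / 8 * (2 * (X * P3 * ((5 * q - 1) / (4 * (5 * q - 3)))))))).
  apply: congMl; first by rewrite rpredB // rpred1.
  apply: congD; [apply: congD; [apply: congB; first exact: cong_refl |] |].
  - apply: congMl; first exact: zloc_div.
    apply: congMr; last exact: congMl.
    by apply: zloc_div (zunit_loc v51) (zunitM u2 v3).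
  - apply: congMl; first exact: zloc_div.
    apply: congMr; last exact: congMl.
    by apply: zloc_div (zunitM (zunitM u4 v53) v51); rewrite rpredM // rpredB ?rpredM // rpred1.
  apply: congMl; first exact: zloc_div.
  apply: congM => //; first by rewrite rpredM // rpredM.
  by apply: congMr => //; apply: congMl.
exact: combination_poly.
Qed.

(** Modulo p^3 the closed form is [cbin rat m ^+ 2] times (1 + p^2 H/8)(1 - p^2 H/4), and the
    resulting factor 1 - p^2 H/8 turns the square of [dprod (- (1 / 2))] into Y^2. *)
Lemma cubesum_expansion : cong 3 (cubesum (2 * m)) ((X * Y) ^+ 2).
Proof.
have pE' : p = (2 * (2 * m)).+1 by rewrite pE; lia.
have ZX : X \in Zp by exact: rpred_nat.
have ZO : osum m \in Zp.
  have -> : osum m = hsum (2 * m) - H / 4 by rewrite hsum_double addrK.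
  by apply: rpredB; [apply: cong_loc cH2 (rpred0 _) | apply: zloc_div].
have ZH16 : H / 16 \in Zp by apply: zloc_div.
have ZO4 : osum m / 4 \in Zp by apply: zloc_div.
have ZH4 : H / 4 \in Zp by apply: zloc_div.
have Zcb : cbin rat m \in Zp by apply: (cbin_loc p_pr pE'); lia.
have [_ cS _] := value_even p_pr p_gt3 pE.
have cQ := qprod_expand p_pr p_gt3 pE' (leqnn _).
have cO : cong 1 (H / 16 - osum m / 4) (H / 8).
  have -> : H / 16 - osum m / 4 = H / 8 - hsum (2 * m) / 4 by rewrite hsum_double; field.
  rewrite -[X in cong _ _ X]subr0; apply: congB; first exact: cong_refl.
  by rewrite -[0](mul0r 4^-1); apply: congMr => //; apply: zunitV_loc.
have ZH8 : H / 8 \in Zp by apply: zloc_div.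
have Zh2 : h / 2 \in Zp by apply: zloc_div.
have Zhh : (- (1 / 2)) ^+ 2 * (h ^+ 2 + H) / 2 \in Zp.
  by apply: zloc_div => //; rewrite rpredM ?rpredX ?rpredD ?rpredX // rpredN; apply: zloc_div => //; exact: rpred1.
have {cS} cS : cong 3 (cubesum (2 * m)) (cbin rat m ^+ 2 * (1 + q ^+ 2 * (H / 8)) * (1 - q ^+ 2 * (H / 4))).
  have Z1 : 1 - q ^+ 2 * (H / 4) \in Zp by rewrite rpredB ?rpred1 // rpredM ?rpredX.
  apply: cong_trans cS _; rewrite (_ : q ^+ 2 / 4 * H = q ^+ 2 * (H / 4)); last by ring.
  apply: congMr Z1 _; apply: cong_trans cQ _; apply: congMl; first exact: rpredX.
  by apply: congD; [exact: cong_refl | apply: (@congMpX _ _ 1 2)].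
apply: cong_trans cS _.
have cE : cong 3 (cbin rat m ^+ 2) (X ^+ 2 * (1 + q * (- (1 / 2) * h) + q ^+ 2 * ((- (1 / 2)) ^+ 2 * (h ^+ 2
  + H) / 2)) ^+ 2).
  have ZN : - (1 / 2) \in Zp by rewrite rpredN; apply: zloc_div => //; exact: rpred1.
  have -> : cbin rat m ^+ 2 = X ^+ 2 * dprod (- (1 / 2)) ^+ 2.
    rewrite cbin_central -/(dprod _); move: (dprod _) => d; move: ((-1) ^+ m) (sqrr_sign rat m) => s s2.
    by rewrite 2!exprMn s2 mul1r.
  apply: congMl; first exact: rpredX.
  apply: congX; last exact: hdiff_prod.
  by apply: rpredD; [apply: rpredD; [exact: rpred1 | by apply: rpredM => //; apply: rpredM] | apply:
    rpredM => //; exact: rpredX].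
have Z2 : (1 + q ^+ 2 * (H / 8)) * (1 - q ^+ 2 * (H / 4)) \in Zp.
  have Zq2 : q ^+ 2 \in Zp by exact: rpredX.
  by apply: rpredM; [apply: rpredD | apply: rpredB]; rewrite ?rpred1 // rpredM.
rewrite -mulrA; apply: cong_trans (congMr Z2 cE) _.
(* Then Y = 1 - q w, and the expansion of [dprod (- (1 / 2))] is Y + q^2 d. The terms of order q^2
   combine to 2 q^2 d Y (1 - Y), which is divisible by q^3. *)
pose d := H / 16; pose w := h / 2 - q * (h ^+ 2 / 8 + H / 16).
have Zd : d \in Zp by [].
have Zw : w \in Zp.
  by apply: rpredB => //; apply: rpredM => //; apply: rpredD => //; apply: zloc_div => //; exact: rpredX.
have ZY : Y \in Zp.
  have -> : Y = 1 - q * w by rewrite /Y /w; ring.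
  by rewrite rpredB ?rpred1 // rpredM.
have eY : Y = 1 - q * w by rewrite /Y /w; ring.
apply: cong_trans (cong_add_pX 3 ((X * Y) ^+ 2) (b := X ^+ 2 * (2 * d * Y * w
   + q * (d ^+ 2 - 4 * d ^+ 2 * Y - 8 * d ^+ 2 * Y ^+ 2) - q ^+ 3 * (2 * d ^+ 3 + 16 * d ^+ 3 * Y) - q ^+ 5
     * (8 * d ^+ 4))) _).
  by apply: eq_cong; rewrite eY /d /w; field.
clear eY; clearbody d w; move: (X) ZX (Y) ZY => x Zx y Zy.
by rewrite !(rpredD, rpredN, rpredM, rpredX, rpred1, rpred_nat).
Qed.

(** * The quartic Jacobi sum modulo p^3 *)

Lemma cong1_Fp (u v : int) : u%:~R = v%:~R :> 'F_p -> cong 1 u%:~R v%:~R.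
Proof.
move=> e; apply/cong_intP; rewrite expn1 (dvdz_pcharf (pchar_Fp p_pr)).
by rewrite rmorphB /= e subrr.
Qed.

Lemma Fp_int_eq0 (u : int) : (u%:~R == 0 :> 'F_p) = (p%:Z %| u)%Z.
Proof. by rewrite (dvdz_pcharf (pchar_Fp p_pr)). Qed.

Lemma card_Fp_4m : #|'F_p| = (4 * m).+1. Proof. by rewrite card_Fp. Qed.

Lemma Fp_two_neq0 : 2 != 0 :> 'F_p.
Proof. by rewrite -(dvdn_pcharf (pchar_Fp p_pr)) gtnNdvd //; lia. Qed.

(** A Teichmueller lift to precision p^3: g^(p^2) is g modulo p by Fermat, and its power 4m is
    g^phi(p^3) = 1 modulo p^3 by Euler. *)
Lemma primitive_root_lift : exists G : nat,
  (4 * m).-primitive_root (G%:R : 'F_p) /\ cong 3 (G%:R ^+ (4 * m)) 1.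
Proof.
have m4 : (0 < 4 * m)%N by rewrite muln_gt0 m_gt0.
pose rs := enum [pred x : 'F_p | x != 0].
have /hasP[g _ g_prim] : has (4 * m).-primitive_root rs.
  apply: has_prim_root => //.
  - apply/allP => x; rewrite mem_enum inE => x0; rewrite unity_rootE; apply/eqP.
    exact: (exp_card_pred card_Fp_4m).
  - exact: enum_uniq.
  rewrite -cardE -ltnS -card_Fp_4m [X in (X <= _)%N](cardD1 0) inE add1n ltnS.
  by apply: subset_leq_card; apply/subsetP => x; rewrite !inE andbT.
exists (g ^ (p ^ 2))%N.
have eg : (g ^ (p ^ 2))%N%:R = g :> 'F_p.
  have h (x : 'F_p) : x ^+ p = x by have := expf_card x; rewrite card_Fp.
  by rewrite natrX natr_Zp expnS expn1 exprM !h.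
split; first by rewrite eg.
have h : ((p ^ 3)%N%:Z %| (g ^ (p ^ 2 * (4 * m)))%N%:Z - 1%N%:Z)%Z.
  have -> : (p ^ 2 * (4 * m) = totient (p ^ 3))%N by rewrite totient_pfactor //= pE mulnC.
  rewrite -eqz_mod_dvd !modz_nat Euler_exp_totient //.
  rewrite coprimeXr // coprime_sym prime_coprime // (dvdn_pcharf (pchar_Fp p_pr)) natr_Zp.
  by rewrite (prim_root_eq0 g_prim) -lt0n.
by rewrite expnM in h; move/(cong_intP p_pr): h; rewrite -!pmulrn !natrX mulr1n.
Qed.

(* For f = 1 or -1, (15 a - 10 a^3 + 3 a^5) / 8 - f is divisible by (a - f)^3. *)
Lemma quad_cong (z : int) : z = 0 \/ z%:~R != 0 :> 'F_p ->
  cong 3 (15 / 8 * z%:~R ^+ (2 * m) - 5 / 4 * z%:~R ^+ (6 * m) + 3 / 8 * z%:~R ^+ (10 * m))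
    (quad m (z%:~R : 'F_p))%:~R.
Proof.
case=> [->|z0].
  rewrite quad0 !mulr0z !expr0n !muln_eq0 /= (gtn_eqF m_gt0).
  by apply: eq_cong.
set e := quad m _; have ee : (e%:~R : rat) ^+ 2 = 1.
  by rewrite expr2 -intrM quad_sq.
set a : rat := z%:~R ^+ (2 * m).
have -> : z%:~R ^+ (6 * m) = a ^+ 3 by rewrite -exprM; congr (_ ^+ _); rewrite mulnAC.
have -> : z%:~R ^+ (10 * m) = a ^+ 5 by rewrite -exprM; congr (_ ^+ _); rewrite mulnAC.
have c : cong 1 a e%:~R.
  rewrite /a -rmorphXn; apply: cong1_Fp; rewrite rmorphXn /= /e /quad (negPf z0).
  by case: (exp_half card_Fp_4m z0) => ->; rewrite ?eqxx //; case: ifP => // /eqP.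
have Ze : e%:~R \in Zp by exact: rpred_int.
rewrite /cong expr1 in c; move: c Ze ee; move: (e%:~R) => f; move: a => a.
set t := (a - f) / q => Zt Zf ff.
have ea : a = f + q * t by rewrite /t mulrCA divff // mulr1 addrC subrK.
have f3 : f ^+ 3 = f by rewrite exprS ff mulr1.
have f4 : f ^+ 4 = 1 by rewrite (exprM f 2 2) ff expr1n.
have f5 : f ^+ 5 = f by rewrite exprS f4 mulr1.
have -> : 15 / 8 * a - 5 / 4 * a ^+ 3 + 3 / 8 * a ^+ 5 = f + q ^+ 3 * (t ^+ 3 * (20 * f ^+ 2 + 15 * f * q * t
  + 3 * q ^+ 2 * t ^+ 2) / 8).
  have -> : 15 / 8 * a - 5 / 4 * a ^+ 3 + 3 / 8 * a ^+ 5 =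
   15 / 8 * f - 5 / 4 * f ^+ 3 + 3 / 8 * f ^+ 5 + 15 / 8 * (1 - 2 * f ^+ 2 + f ^+ 4) * q * t - 15 / 4 * (f
     - f ^+ 3) * (q * t) ^+ 2
    + (- 5 / 4 + 15 / 4 * f ^+ 2) * (q * t) ^+ 3 + 15 / 8 * f * (q * t) ^+ 4 + 3 / 8 * (q
      * t) ^+ 5 by rewrite ea; field.
  by rewrite f3 f4 f5 ff; field.
apply: cong_add_pX; apply: zloc_div => //.
clearbody t; apply: rpredM; first exact: rpredX.
have Z c k : c \in Zp -> k%:R * c \in Zp by move=> Zc; rewrite rpredM ?rpred_nat.
rewrite -!mulrA; apply: rpredD; [apply: rpredD|]; apply: Z; first exact: rpredX.
  by apply: rpredM => //; apply: rpredM.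
by apply: rpredM => //; apply: rpredM => //; apply: rpredX.
Qed.

Section WithRoot.
Variable G : nat.
Hypothesis G_prim : (4 * m).-primitive_root (G%:R : 'F_p).
Hypothesis G_cong : cong 3 (G%:R ^+ (4 * m)) 1.
Local Notation g := (G%:R : 'F_p).
Local Notation qd k := ((quad m (1 - g ^+ k))%:~R : rat).

(** The exponent 3m, the conjugate quartic character, selects the unit: in the expansion of (1 -
    G^k)^(2m), orthogonality keeps j = m, hence binom(2m,m). With exponent m no index j <= 2m would
    survive. *)
Definition jacsum : rat := \sum_(k < 4 * m) G%:R ^+ (3 * m * k) * qd k.

Local Lemma ZG : G%:R \in Zp. Proof. exact: rpred_nat. Qed.
#[local] Hint Resolve ZG : core.

(** p^3 divides (G^(2m) - 1)(G^(2m) + 1), and the first factor is a unit, being -2 modulo p. So G^m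
    serves as the imaginary unit modulo p^3. *)
Lemma iota_sq : cong 3 (G%:R ^+ (2 * m)) (-1).
Proof.
have c1 : cong 1 (G%:R ^+ (2 * m)) (-1).
  have := @cong1_Fp (G%:Z ^+ (2 * m)) (-1); rewrite !rmorphXn !rmorphN /= -!pmulrn; apply.
  by rewrite (g_half m_gt0 card_Fp_4m G_prim).
have u : zunit (G%:R ^+ (2 * m) - 1).
  apply: (@zunit_cong _ _ (-1 - 1)); last by rewrite -opprD; apply: zunitN u2.
  by apply: cong_sym; apply: congB => //; apply: cong_refl.
apply: (cong_mulI u); rewrite mulrN1 opprB mulrBl mul1r -exprD addnn -muln2 mulnC mulnA.
rewrite -[1 - _]opprB opprB; apply: congB => //; exact: cong_refl.
Qed.

Lemma iota_pow k : cong 3 (G%:R ^+ m ^+ (3 * k)) ((re4 ((g ^+ m) ^+ k))%:~R - G%:R ^+ m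
  * (im4 m g ((g ^+ m) ^+ k))%:~R).
Proof.
have m0 := m_gt0; have ii := mulii m0 card_Fp_4m G_prim.
have [[a1 b1] [a2 b2] [a3 b3] [a4 b4]] := re_im4 m0 card_Fp_4m G_prim Fp_two_neq0.
have c2 : cong 3 ((G%:R ^+ m) ^+ 2) (-1) by rewrite -exprM mulnC; exact: iota_sq.
have ZJ : G%:R ^+ m \in Zp by apply: rpredX.
have Zm1 : -1 \in Zp by rewrite rpredN rpred1.
move: (re4) (im4 m g) a1 b1 a2 b2 a3 b3 a4 b4 => re im a1 b1 a2 b2 a3 b3 a4 b4.
move: (g ^+ m) ii a3 b3 a4 b4 => I ii a3 b3 a4 b4; move: (G%:R ^+ m) c2 ZJ => J c2 ZJ.
have I2 : I ^+ 2 = -1 by rewrite expr2.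
have I4 : I ^+ 4 = 1 by rewrite (exprM I 2 2) I2 sqrrN expr1n.
elim/ltn_ind: k => k IHk; case: (ltnP k 4) => [|le4k]; last first.
  rewrite -(subnK le4k) mulnDr (exprD J (3 * (k - 4)) (3 * 4)) (exprD I (k - 4) 4) I4 mulr1 -[X in cong _ _ X]mulr1.
  apply: congM.
  - exact: rpredX.
  - exact: rpred1.
  - by apply: IHk; lia.
  by have := congX 6 Zm1 c2; rewrite -exprM (exprM (-1) 2 3) sqrrN !expr1n.
move: k {IHk} => [|[|[|[|//]]]] _; rewrite ?muln0 ?expr0 ?expr1.
- by rewrite a1 b1 mulr0 subr0; apply: cong_refl.
- rewrite a3 b3 mulr1 sub0r (exprD J 2 1) expr1 -mulN1r.
  by apply: congMr.
- rewrite I2 a2 b2 mulr0 subr0 (exprM J 2 3).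
  by have := congX 3 Zm1 c2; rewrite (exprS (-1)) sqrrN expr1n mulr1.
rewrite (exprS I) I2 mulrN1 a4 b4 mulrN1 sub0r opprK (exprD J 8 1) expr1.
rewrite -[X in cong _ _ X]mul1r; apply: congMr => //.
by have := congX 4 Zm1 c2; rewrite -exprM (exprM (-1) 2 2) sqrrN !expr1n.
Qed.

Lemma jacsum_split : cong 3 jacsum ((jacA 'F_p m)%:~R - G%:R ^+ m * (jacB m g)%:~R).
Proof.
have m0 := m_gt0.
have e : (jacA 'F_p m)%:~R - G%:R ^+ m * (jacB m g)%:~R =
   \sum_(k < 4 * m) ((re4 ((g ^+ k) ^+ m))%:~R - G%:R ^+ m * (im4 m g ((g ^+ k) ^+ m))%:~R) * qd k.
  rewrite /jacA /jacB.
  have [r0 i0] := re_im0 m0 G_prim.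
  rewrite !(sum_prim_root m0 card_Fp_4m G_prim) ?r0 ?i0 ?mul0r //.
  rewrite !rmorph_sum /= mulr_sumr -sumrB; apply: eq_bigr => k _.
  by rewrite !rmorphM /= mulrBl mulrA.
rewrite e; apply: cong_sum => -[k ltk] _ /=; apply: congMr; first exact: rpred_int.
by rewrite -[(g ^+ k) ^+ m]exprM [(k * m)%N]mulnC [g ^+ _]exprM -mulnA mulnCA exprM; apply: iota_pow.
Qed.

(** 2A - J is the conjugate A + iB of J = A - iB, with i = G^m, so [jac_norm] applies. *)
Lemma jacsum_norm :
  cong 3 (jacsum * (2 * (jacA 'F_p m)%:~R - jacsum)) q.
Proof.
have AB := jac_norm m_gt0 card_Fp_4m G_prim Fp_two_neq0; have cs := jacsum_split.
move: jacsum (jacA _ _) (jacB _ _) AB cs => j a b AB cs.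
have -> : q = a%:~R ^+ 2 + b%:~R ^+ 2 by rewrite -!rmorphXn -rmorphD /= AB -pE.
have Za : a%:~R \in Zp by exact: rpred_int.
have Zb : b%:~R \in Zp by exact: rpred_int.
have Zi : G%:R ^+ m \in Zp by apply: rpredX.
have ci : cong 3 ((G%:R ^+ m) ^+ 2) (-1) by rewrite -exprM mulnC; exact: iota_sq.
move: (a%:~R) (b%:~R) (G%:R ^+ m) Za Zb Zi cs ci => x y i Zx Zy Zi cs ci.
have Zr : x - i * y \in Zp by rewrite rpredB // rpredM.
apply: (@cong_trans _ _ _ ((x - i * y) * (x + i * y))).
  apply: congM => //; first exact: cong_loc cs Zr.
    by rewrite rpredD // rpredM.
  rewrite (_ : x + i * y = 2 * x - (x - i * y)); last by ring.
  by apply: congB => //; apply: cong_refl.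
rewrite (_ : _ * _ = x ^+ 2 - i ^+ 2 * y ^+ 2); last by ring.
rewrite (_ : x ^+ 2 + y ^+ 2 = x ^+ 2 - (-1) * y ^+ 2); last by ring.
apply: congB; first exact: cong_refl.
by apply: congMr => //; apply: rpredX.
Qed.

(** Orthogonality modulo p^3: if 4m does not divide M, then G^M - 1 is a unit, and its product with
    the geometric sum is G^(4mM) - 1. *)
Lemma sum_G_pow M : cong 3 (\sum_(k < 4 * m) (G%:R ^+ M) ^+ k) ((q - 1) * ((4 * m) %| M)%N%:R).
Proof.
have Zk k : G%:R ^+ k \in Zp by apply: rpredX.
have c1 k : cong 3 (G%:R ^+ (4 * m * k)) 1.
  by have := congX k (rpred1 _) G_cong; rewrite -exprM expr1n.
have [/dvdnP[k ->]|ndvd] := boolP ((4 * m) %| M)%N.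
  rewrite mulr1 (_ : q - 1 = \sum_(k < 4 * m) 1).
    apply: cong_sum => j _; rewrite -[X in cong _ _ X](expr1n _ j); apply: congX; first exact: rpred1.
    by rewrite (mulnC k); apply: c1.
  by rewrite sumr_const card_ord pE -natr1 addrK.
rewrite mulr0; have u : zunit (G%:R ^+ M - 1).
  have := @zunit_int p p_pr (G%:Z ^+ M - 1); rewrite rmorphB rmorphXn /= -pmulrn; apply.
  rewrite -Fp_int_eq0 rmorphB rmorphXn /= -pmulrn subr_eq0.
  by rewrite -(prim_order_dvd G_prim).
apply: (cong_mulI u); rewrite mulr0 -subrX1 -exprM mulnC.
by rewrite -(subrr 1); apply: congB; [exact: c1 | exact: cong_refl].
Qed.

Lemma sum_G_binom N : cong 3 (\sum_(k < 4 * m) G%:R ^+ (3 * m * k) * (1 - G%:R ^+ k) ^+ N)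
  ((q - 1) * \sum_(j < N.+1 | (4 * m %| 3 * m + j)%N) (-1) ^+ j * 'C(N, j)%:R).
Proof.
have -> : \sum_(k < 4 * m) G%:R ^+ (3 * m * k) * (1 - G%:R ^+ k) ^+ N =
  \sum_(j < N.+1) (-1) ^+ j * 'C(N, j)%:R * \sum_(k < 4 * m) (G%:R ^+ (3 * m + j)) ^+ k :> rat.
  under [RHS]eq_bigr do rewrite mulr_sumr.
  rewrite exchange_big /=; apply: eq_bigr => k _.
  rewrite exprBn mulr_sumr; apply: eq_bigr => j _.
  rewrite expr1n mulr1 -(exprM _ k j) -(exprM _ (3 * m + j) k) mulnDl exprD (mulnC j k).
  by rewrite -[_ *+ 'C(N, j)]mulr_natr; ring.
rewrite mulr_sumr [X in cong _ _ X]big_mkcond /=; apply: cong_sum => j _.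
have Zc : (-1) ^+ j * 'C(N, j)%:R \in Zp by rewrite rpredM ?rpredX ?rpredN ?rpred1 ?rpred_nat.
apply: cong_trans (congMl Zc (sum_G_pow _)) _.
by case: ifP => _; apply: eq_cong; rewrite /= ?mulr1 ?mulr0 // mulrC.
Qed.

Local Lemma sum_binom_residue t N : N = ((4 * t + 2) * m)%N ->
  \sum_(j < N.+1 | (4 * m %| 3 * m + j)%N) (-1) ^+ j * 'C(N, j)%:R =
  (-1) ^+ m * \sum_(i < t.+1) 'C(N, (4 * i + 1) * m)%:R :> rat.
Proof.
have m0 : (0 < m)%N by lia.
move=> ->; rewrite (sum_residue (fun j => (-1) ^+ j * 'C((4 * t + 2) * m, j)%:R) _ m0) mulr_sumr.
apply: eq_bigr => i _; congr (_ * _).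
have -> : ((4 * i + 1) * m = 2 * (2 * i * m) + m)%N by ring.
by rewrite exprD exprM sqrrN !expr1n mul1r.
Qed.

(** In the powers 2m, 6m, 10m of 1 - G^k, orthogonality keeps the indices m, 5m, 9m as far as they
    occur. The symmetry of binomial coefficients merges two of them in the last two cases, whence
    5/2 = 2 (10/8) and 3/4 = 2 (3/8). *)
Lemma jacsum_expand : cong 3 jacsum ((-1) ^+ m * ((q - 1) * (15 / 8 * 'C(2 * m, m)%:R - 5 / 2 * 'C(6 * m, m)%:R
    + 3 / 4 * 'C(10 * m, m)%:R + 3 / 8 * 'C(10 * m, 5 * m)%:R))).
Proof.
have m0 : (0 < m)%N by lia.
have c8 (k : nat) : k%:R / 8 \in Zp by apply: zloc_div => //; exact: rpred_nat.
have c4 (k : nat) : k%:R / 4 \in Zp by apply: zloc_div => //; exact: rpred_nat.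
apply: (@cong_trans _ _ _ (\sum_(k < 4 * m) G%:R ^+ (3 * m * k) *
   (15 / 8 * (1 - G%:R ^+ k) ^+ (2 * m) - 5 / 4 * (1 - G%:R ^+ k) ^+ (6 * m) + 3 / 8 * (1 - G%:R ^+ k) ^+ (10 * m)))).
  apply: cong_sum => -[k ltk] _ /=; apply: congMl; first by rewrite rpredX // rpred_nat.
  have := @quad_cong (1 - G%:Z ^+ k).
  rewrite !rmorphB !rmorphXn /= -!pmulrn => h; apply: cong_sym; apply: h.
  have [->|k0] := posnP k; [by left | right].
  rewrite subr_eq0 eq_sym -(prim_order_dvd G_prim); apply/negP => /(dvdn_leq k0).
  by rewrite leqNgt ltk.
pose U N := \sum_(k < 4 * m) G%:R ^+ (3 * m * k) * (1 - G%:R ^+ k) ^+ N : rat.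
have cU N t : N = ((4 * t + 2) * m)%N ->
    cong 3 (U N) ((q - 1) * ((-1) ^+ m * \sum_(i < t.+1) 'C(N, (4 * i + 1) * m)%:R)).
  by move=> e; have := sum_G_binom N; rewrite (sum_binom_residue e).
apply: (@cong_trans _ _ _ (15 / 8 * U (2 * m)%N - 5 / 4 * U (6 * m)%N + 3 / 8 * U (10 * m)%N)).
  apply: eq_cong; rewrite /U !mulr_sumr -sumrB -big_split /=; apply: eq_bigr => k _.
  by move: (G%:R ^+ _) (_ ^+ (2 * m)) (_ ^+ (6 * m)) (_ ^+ (10 * m)) => x y z t; ring.
have h2 := cU (2 * m)%N 0%N erefl; have h6 := cU (6 * m)%N 1%N erefl; have h10 := cU (10 * m)%N 2%N erefl.
apply: (@cong_trans _ _ _ _ _ _ (congD (congB (congMl (c8 15%N) h2) (congMl (c4 5%N) h6)) (congMl (c8 3%N) h10))).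
apply: eq_cong; rewrite !big_ord_recr !big_ord0 /= !add0r !mul1n.
have -> : 'C(6 * m, (4 * 1 + 1) * m) = 'C(6 * m, m).
  by rewrite -bin_sub; [congr 'C(_, _) |]; lia.
have -> : 'C(10 * m, (4 * 2 + 1) * m) = 'C(10 * m, m).
  by rewrite -bin_sub; [congr 'C(_, _) |]; lia.
rewrite -[((4 * 1 + 1) * m)%N]/(5 * m)%N.
move: ((-1) ^+ m) ('C(2 * m, m)%:R) ('C(6 * m, m)%:R) ('C(10 * m, m)%:R) ('C(10 * m, 5 * m)%:R) => s x y z t.
by field.
Qed.

Lemma jacsum_unit_root : cong 3 jacsum ((-1) ^+ m * - (X * Y)).
Proof.
apply: cong_trans jacsum_expand _; apply: congMl; last exact: binomial_combination.
by rewrite rpredX // rpredN rpred1.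
Qed.

Lemma XY_unit : zunit (X * Y).
Proof.
have uX : zunit X by apply: zunit_bin => //; lia.
have Zh : h \in Zp by exact: hdiff_loc.
have ZH : hsum m \in Zp by apply: hsum_loc; lia.
apply: zunitM uX _; rewrite /unit_root_expansion.
move: (hdiff) (hsum m) Zh ZH => a b Zh ZH.
rewrite [X in zunit X](_ : _ = 1 + q * (- (a / 2) + q * (a ^+ 2 / 8 + b / 16))); last by ring.
apply: zunit_addp; first exact: zunit1.
apply: rpredD; first by rewrite rpredN; apply: zloc_div.
by apply: rpredM => //; apply: rpredD; apply: zloc_div => //; apply: rpredX.
Qed.

Lemma jacsum_unit : zunit jacsum.
Proof.
apply: zunit_cong (cong_sym (cong_le _ jacsum_unit_root)) _ => //.
apply: zunitM; last exact/zunitN/XY_unit.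
exact/zunitX/zunitN/zunit1.
Qed.

Lemma cubesum_jacsum : cong 3 (cubesum (2 * m)) (jacsum ^+ 2).
Proof.
apply: cong_trans cubesum_expansion _; apply: cong_sym.
have Z : (-1) ^+ m * - (X * Y) \in Zp.
  by rewrite rpredM ?rpredN ?(zunit_loc XY_unit) // rpredX // rpredN rpred1.
apply: cong_trans (congX 2 Z jacsum_unit_root) _.
by apply: eq_cong; rewrite exprMn sqrr_sign mul1r sqrrN.
Qed.

Lemma jacsum_cong1 : cong 1 jacsum (2 * (jacA 'F_p m)%:~R).
Proof.
have c : cong 1 (jacsum * (2 * (jacA 'F_p m)%:~R - jacsum)) (jacsum * 0).
  apply: cong_trans (cong_le _ (jacsum_norm)) _ => //.
  by rewrite mulr0 -[q]mulr1; have := @cong_pX p p_pr 1 1 (rpred1 _); rewrite expr1.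
have := cong_mulI jacsum_unit c => {}c; apply: cong_sym.
rewrite -[X in cong _ X _](subrK jacsum) -[X in cong _ _ X]add0r.
by apply: congD => //; apply: cong_refl.
Qed.

(** Put t = 2A - J, so that J^2 = 4A^2 - 2Jt - t^2. Here Jt = p, hence t^2 = p^2 / J^2, and J may be
    replaced by 2A in this last term since they agree modulo p. *)
Lemma values_jacA (a := (jacA 'F_p m)%:~R : rat) :
  cong 3 (cubesum (2 * m)) (4 * a ^+ 2 - 2 * q - q ^+ 2 / (4 * a ^+ 2)) /\
  cong 3 (wcubesum (2 * m)) (q ^+ 2 / (4 * a ^+ 2)).
Proof.
have uJ := jacsum_unit; have c0 := cubesum_jacsum; have c1 := jacsum_cong1.
have cn := jacsum_norm.
have [cQ _ cS1] := value_even p_pr p_gt3 pE.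
have uS : zunit (cubesum (2 * m)) by apply: zunit_cong (cong_sym (cong_le _ c0)) (zunitX 2 uJ).
rewrite -/a in c1 cn; move: a c1 cn => a c1 cn.
move: (jacsum) uJ c0 c1 cn => j uJ c0 c1 cn.
have u2a : zunit (2 * a) by apply: zunit_cong c1 uJ.
have ca : cong 1 (j ^+ 2) (4 * a ^+ 2).
  rewrite (_ : 4 * _ = (2 * a) ^+ 2); last by ring.
  by apply: congX => //; exact: zunit_loc.
have u4a : zunit (4 * a ^+ 2) by rewrite (_ : 4 * _ = (2 * a) ^+ 2); [exact: zunitX | ring].
have cqj : cong 3 (q ^+ 2 / j ^+ 2) (q ^+ 2 / (4 * a ^+ 2)).
  by apply: (@congMpX _ _ 1 2); apply: congV => //; exact: zunitX.
have Zj := zunit_loc uJ; have j0 := zunit_neq0 uJ.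
split.
  apply: cong_trans c0 _.
  have cj' : cong 3 (2 * a - j) (q / j).
    by apply: (cong_mulI uJ); apply: cong_trans cn _; apply: eq_cong; field.
  have cj2 : cong 3 ((2 * a - j) ^+ 2) (q ^+ 2 / j ^+ 2).
    by rewrite -expr_div_n; apply: congX => //; apply: zloc_div.
  rewrite (_ : j ^+ 2 = 4 * a ^+ 2 - 2 * (j * (2 * a - j)) - (2 * a - j) ^+ 2); last by ring.
  apply: congB; last exact: cong_trans cj2 cqj.
  by apply: congB; [exact: cong_refl | apply: congMl; [exact: zunit_loc u2 | exact: cn]].
apply: cong_trans cS1 _; apply: (@congMpX _ _ 1 2).
have Q := cong_sym cQ.
have uQ : zunit (qprod p m) by apply: zunit_cong (cong_sym Q) uS.
apply: congV => //; apply: cong_trans Q _.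
by apply: cong_trans ca; apply: cong_le c0.
Qed.
End WithRoot.

Lemma shifted_cubesum_even (x y : int) : p%:Z = x ^+ 2 + 4%:Z * y ^+ 2 ->
  (52 / 27 * x%:~R ^+ 2 - 26 / 27 * q - q ^+ 2 / (27 * x%:~R ^+ 2)) \in Zp /\
  cong 3 (shifted_cubesum (2 * m)) (52 / 27 * x%:~R ^+ 2 - 26 / 27 * q - q ^+ 2 / (27 * x%:~R ^+ 2)).
Proof.
move=> exy; have m0 : (0 < m)%N by lia.
have pE' : p = (2 * (2 * m)).+1 by rewrite pE; lia.
have p_odd : odd p by rewrite pE /= oddM.
have [G [G_prim G_cong]] := primitive_root_lift.
have [v0 v1] := values_jacA G_prim G_cong.
have uA := zunit_cong (jacsum_cong1 G_prim G_cong) (jacsum_unit G_prim G_cong).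
have AB := jac_norm m0 card_Fp_4m G_prim Fp_two_neq0.
have Aodd := jacA_odd m0 card_Fp_4m G_prim Fp_two_neq0.
rewrite -pE in AB; have ex := sum_two_squares_uniq p_pr p_odd AB Aodd exy.
have u27 : zunit 27 by exact: zunit27.
have ex' : (jacA 'F_p m)%:~R ^+ 2 = x%:~R ^+ 2 :> rat by rewrite -!rmorphXn ex.
have ux : zunit (x%:~R ^+ 2).
  have := zunitX 2 uA; rewrite exprMn ex' => u.
  rewrite -[_ ^+ 2](mulKf (zunit_neq0 (zunitX 2 u2))).
  exact: zunitM (zunitV (zunitX 2 u2)) u.
rewrite ex' in v0 v1; move: (x%:~R ^+ 2) ux v0 v1 => z uz v0 v1; have z0 := zunit_neq0 uz.
have Zz := zunit_loc uz.
split.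
  have Z27 k : k%:R / 27 \in Zp by apply: zloc_div u27; exact: rpred_nat.
  apply: rpredB; [apply: rpredB|].
  - exact: rpredM (Z27 52%N) Zz.
  - exact: rpredM (Z27 26%N) Zq.
  exact: zloc_div (rpredX 2 Zq) (zunitM u27 uz).
apply: (cong_mulI u27); apply: cong_trans (shifted_cubesum_cong p_pr p_gt3 pE') _.
rewrite (_ : 27 * _ = 13 * (4 * z - 2 * q - q ^+ 2 / (4 * z)) + 9 * (q ^+ 2 / (4 * z))); last by field.
by apply: congD; apply: congMl => //; exact: rpred_nat.
Qed.
End QuarterPrime.

Theorem theorem8p2 (p : nat) (p_prime : prime p) (p_gt3 : (3 < p)%N) :
  ((p = 1 %[mod 4])%N ->
   forall x y : int, p%:Z = x ^+ 2 + 4%:Z * y ^+ 2 ->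
   rat_cong p 3
     (\sum_(0 <= k < ((p - 1) %/ 2).+1)
        'C(2 * k, k)%:R ^+ 3 / (64%:R ^+ k * (k + 2)%N%:R))
     (52%:R / 27%:R * x%:~R ^+ 2 - 26%:R / 27%:R * p%:R
        - p%:R ^+ 2 / (27%:R * x%:~R ^+ 2)))
  /\
  ((p = 3 %[mod 4])%N ->
   rat_cong p 3
     (\sum_(0 <= k < ((p - 1) %/ 2).+1)
        'C(2 * k, k)%:R ^+ 3 / (64%:R ^+ k * (k + 2)%N%:R))
     (- ((p + 1)%N%:R ^+ 2 / (3%:R * 2%:R ^+ (p - 1)))
          * 'C((p - 1) %/ 2, (p - 3) %/ 4)%:R ^+ 2
        - p%:R ^+ 2 *
            (13%:R / 27%:R * 'C((p - 1) %/ 2, (p - 3) %/ 4)%:R ^- 2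
             + 1 / 6%:R * 'C((p - 1) %/ 2, (p - 3) %/ 4)%:R ^+ 2
                 * (euler_number (p - 3))%:~R))).
Proof.
have sumE n : \sum_(0 <= k < n.+1) 'C(2 * k, k)%:R ^+ 3 / (64%:R ^+ k * (k + 2)%N%:R) = shifted_cubesum n.
  rewrite big_mkord /shifted_cubesum; apply: eq_bigr => k _.
  rewrite cbinE natrD expr_div_n -exprM [(k * 3)%N]mulnC exprM invfM mulrA.
  by rewrite (_ : 4 ^+ 3 = 64 :> rat).
rewrite sumE; split=> [p1 x y exy | p3].
  pose m := (p %/ 4)%N; have pE : p = (4 * m).+1.
    by rewrite /m; lia.
  have -> : ((p - 1) %/ 2 = 2 * m)%N by lia.
  have [Z c] := shifted_cubesum_even p_prime p_gt3 pE exy.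
  exact: cong_rat_cong Z c.
pose m := (p %/ 4)%N; have pE : p = (4 * m).+3.
  by rewrite /m; lia.
have -> : ((p - 1) %/ 2 = (2 * m).+1)%N by lia.
have -> : ((p - 3) %/ 4 = m)%N by lia.
have [Z c] := shifted_cubesum_odd p_prime p_gt3 pE erefl.
by rewrite natrD; exact: cong_rat_cong Z c.
Qed.
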